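(* Let $p>0$ and $n\ge 1$. (i) Suppose that $P=\sum_{\alpha\in\mathbb{Z}_{\ge 0}^n} a_\alpha(z)\partial_z^\alpha$ belongs to $\boldsymbol{D}_p$. Then for every entire function $f\in A_p$ the series $$Pf:=\sum_{\alpha} a_\alpha(z)\,\partial_z^\alpha f$$ converges and $Pf\in A_p$. Moreover, $f\mapsto Pf$ defines a linear continuous operator $P:A_p\to A_p$. (ii) Let $F:A_p\to A_p$ be a linear continuous operator. Then there is a unique $P\in\boldsymbol{D}_p$ such that $Ff=Pf$ holds for every $f\in A_p$.
   Context: For $z\in\mathbb{C}^n$ put $|z|=\sqrt{|z_1|^2+\cdots+|z_n|^2}$. For $p,\tau>0$, $A_{p,\tau}$ is the Banach space of all entire functions $f$ on $\mathbb{C}^n$ with $\|f\|_{p,\tau}:=\sup_{z\in\mathbb{C}^n}|f(z)|\exp(-\tau|z|^p)<\infty$. The space $A_p:=\varinjlim_{\tau>0}A_{p,\tau}=\bigcup_{\tau>0}A_{p,\tau}$ carries the (locally convex) inductive limit topology with respect to the inclusions $A_{p,\tau}\hookrightarrow A_{p,\tau'}$, $\tau<\tau'$ (it is a DFS space). A linear operator $F:A_p\to A_p$ is continuous if and only if for every $\tau>0$ there exist $C>0$ and $\tau'>0$ such that $F(A_{p,\tau})\subset A_{p,\tau'}$ and $\|Ff\|_{p,\tau'}\le C\|f\|_{p,\tau}$ for all $f\in A_{p,\tau}$. For a multi-index $\alpha\in\mathbb{Z}_{\ge0}^n$: $|\alpha|=\alpha_1+\cdots+\alpha_n$, $\alpha!=\alpha_1!\cdots\alpha_n!$,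 $\partial_z^\alpha=(\partial/\partial z_1)^{\alpha_1}\cdots(\partial/\partial z_n)^{\alpha_n}$. Put $1/q:=1-1/p$ (so $1/q=0$ if $p=1$), and $0^0=1$. A formal differential operator of infinite order with entire coefficients is a formal sum $P=\sum_{\alpha\in\mathbb{Z}_{\ge0}^n}a_\alpha(z)\partial_z^\alpha$ with each $a_\alpha$ entire on $\mathbb{C}^n$; two such operators are equal iff all their coefficients agree. $\boldsymbol{D}_p$ is the set of all such $P$ satisfying one of the following equivalent conditions: (I) for every $\varepsilon>0$ there exist $B,C>0$ such that $|a_\alpha(z)|\le C\,\frac{\varepsilon^{|\alpha|}}{(|\alpha|!)^{1/q}}\exp(B|z|^p)$ for all $z\in\mathbb{C}^n$, $\alpha\in\mathbb{Z}_{\ge0}^n$; (II) for every $\varepsilon>0$ there exist $B,C>0$ such that $|a_\alpha(z)|\le C\,\frac{|\alpha|^{|\alpha|/p}}{\alpha!}\varepsilon^{|\alpha|}\exp(B|z|^p)$ for all $z\in\mathbb{C}^n$, $\alpha\in\mathbb{Z}_{\ge0}^n$; (III) for every $\varepsilon>0$ there exist $B,C>0$ such that $\|a_\alpha\|_{p,B}\le C\,\frac{\varepsilon^{|\alpha|}}{(|\alpha|!)^{1/q}}$ for all $\alpha$; (IV) for every $\varepsilon>0$ there exist $B,C>0$ such that $\|a_\alpha\|_{p,B}\le C\,\frac{|\alpha|^{|\alpha|/p}}{\alpha!}\varepsilon^{|\alpha|}$ for all $\alpha$. Convergence of the series $\sum_\alpha a_\alpha(z)\partial_z^\alpha f(z)$,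 indexed by the unordered set $\mathbb{Z}_{\ge0}^n$, means absolute convergence at every $z\in\mathbb{C}^n$. *)

(* Defs.v *)
From HB Require Import structures.
From mathcomp Require Import all_boot all_order all_algebra.
From mathcomp Require Import complex.
From mathcomp Require Import all_classical all_reals all_analysis.
From mathcomp.analysis Require showcase.summability.

Set Implicit Arguments.
Unset Strict Implicit.
Unset Printing Implicit Defensive.

Import Order.TTheory GRing.Theory Num.Theory.
Import numFieldNormedType.Exports.

Local Open Scope classical_set_scope.
Local Open Scope ring_scope.

(* The norm and topology of a numFieldType, declared on [R[i]] itself. *)
HB.instance Definition _ (R : realType) := NormedModule.copy R[i] R[i]^o.

Notation Cn R n := 'rV[R[i]]_n.

(* Real-valued modulus of a complex number ([`|c|] lives in [R[i]]). *)
Notation cmod := Normc.normc.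

Lemma cmod_ge0 (R : realType) (c : R[i]) : 0 <= cmod c.
Proof. by case: c => a b; exact: sqrtr_ge0. Qed.

(* The library norm on row vectors is the sup norm; the growth conditions are
   stated with the Euclidean one. *)
Definition enorm (R : realType) (n : nat) (z : Cn R n) : R :=
  Num.sqrt (\sum_(i < n) cmod (z ord0 i) ^+ 2).

(* Complex (Frechet) differentiability: [Cn R n] and [R[i]] are normed modules
   over [R[i]], so the differential is R[i]-linear. *)
Definition entire (R : realType) (n : nat) (f : Cn R n -> R[i]) : Prop :=
  forall z, differentiable f z.

Definition wnorm (R : realType) (n : nat) (p tau : R) (f : Cn R n -> R[i]) :
    \bar R :=
  ereal_sup [set (cmod (f z) * expR (- tau * enorm z `^ p))%:E | z in setT].

Definition inAptau (R : realType) (n : nat) (p tau : R) (f : Cn R n -> R[i]) :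
    Prop :=
  entire f /\ (wnorm p tau f < +oo)%E.

Definition inAp (R : realType) (n : nat) (p : R) (f : Cn R n -> R[i]) : Prop :=
  exists2 tau : R, 0 < tau & inAptau p tau f.

Definition Ap_pred (R : realType) (n : nat) (p : R) : {pred Cn R n -> R[i]} :=
  fun f => `[< inAp p f >].

Record Ap (R : realType) (n : nat) (p : R) : Type := MkAp {
  Ap_val :> Cn R n -> R[i];
  _ : Ap_val \in @Ap_pred R n p }.

Section ApSpace.
Variables (R : realType) (n : nat) (p : R).
Local Notation Ap := (@Ap R n p).

HB.instance Definition _ := [isSub of Ap for @Ap_val R n p].
HB.instance Definition _ := [Choice of Ap by <:].

Lemma wnorm_ltP (tau : R) (f : Cn R n -> R[i]) : (wnorm p tau f < +oo)%E <->
  exists2 M : R, 0 <= M &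
    forall z, cmod (f z) <= M * expR (tau * enorm z `^ p).
Proof.
have E z : cmod (f z) =
    cmod (f z) * expR (- tau * enorm z `^ p) * expR (tau * enorm z `^ p).
  by rewrite -mulrA -expRD mulNr addNr expR0 mulr1.
split=> [fin|[M M0 fM]]; last first.
  apply: (@le_lt_trans _ _ M%:E); last exact: ltry.
  apply: ge_ereal_sup => _ [z _ <-]; rewrite lee_fin.
  by rewrite mulNr expRN ler_pdivrMr ?expR_gt0.
have ub z : ((cmod (f z) * expR (- tau * enorm z `^ p))%:E <= wnorm p tau f)%E.
  by apply: ereal_sup_ubound; exists z.
have wfin : wnorm p tau f \is a fin_num.
  rewrite fin_numElt fin andbT.
  exact: lt_le_trans (ltNyr _) (ub 0).
exists (fine (wnorm p tau f)) => [|z].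
  rewrite -lee_fin fineK//; apply: le_trans (ub 0).
  by rewrite lee_fin mulr_ge0 ?expR_ge0 ?cmod_ge0.
rewrite E ler_wpM2r ?expR_ge0// -lee_fin fineK//; exact: ub.
Qed.

Lemma Ap_submod_closed : submod_closed (@Ap_pred R n p).
Proof.
have c0 : cmod (0 : R[i]) = 0 :> R by exact: Normc.normc0.
split=> [|a f g].
  apply/asboolP; exists 1 => //; split=> [z|].
    exact: (differentiable_cst (0 : R[i])).
  by apply/wnorm_ltP; exists 0 => // z; rewrite mul0r le_eqVlt; apply/orP; left; exact/eqP.
move=> /asboolP[s s0 [fe /wnorm_ltP[M M0 fM]]].
move=> /asboolP[t t0 [ge /wnorm_ltP[N N0 gN]]].
apply/asboolP; exists (Num.max s t); first by rewrite lt_max s0.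
split=> [z|]; first exact/differentiableD/ge/differentiableZ/fe.
apply/wnorm_ltP; exists (cmod a * M + N) => [|z].
  by rewrite addr_ge0// mulr_ge0// cmod_ge0.
have D : cmod (a * f z + g z) <= cmod a * cmod (f z) + cmod (g z).
  by rewrite -Normc.normcM; exact: le_normcD.
apply: (le_trans D); rewrite mulrDl lerD//.
  rewrite -mulrA ler_wpM2l ?cmod_ge0//; apply: (le_trans (fM z)).
  by rewrite ler_wpM2l// ler_expR ler_wpM2r ?powR_ge0// le_max lexx.
apply: (le_trans (gN z)).
by rewrite ler_wpM2l// ler_expR ler_wpM2r ?powR_ge0// le_max lexx orbT.
Qed.

HB.instance Definition _ :=
  GRing.isSubmodClosed.Build _ _ (@Ap_pred R n p) Ap_submod_closed.
HB.instance Definition _ := [SubChoice_isSubLmodule of Ap by <:].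

Definition abs_convex (V : set Ap) : Prop :=
  forall (a b : R[i]) (f g : Ap),
    cmod a + cmod b <= 1 -> V f -> V g -> V (a *: f + b *: g).

(* The trace of V on every step A_{p,tau} is a neighbourhood of 0 there. *)
Definition step_nbhs0 (V : set Ap) : Prop :=
  forall tau : R, 0 < tau -> exists2 r : R, 0 < r &
    forall g : Ap, (wnorm p tau g <= r%:E)%E -> V g.

(* Locally convex inductive limit topology: the absolutely convex sets whose
   trace on every step is a neighbourhood of 0 form a base at 0. *)
Definition ind_open (U : set Ap) : Prop :=
  forall f : Ap, U f -> exists V : set Ap,
    [/\ abs_convex V, step_nbhs0 V & forall g : Ap, V g -> U (f + g)].

Lemma ind_openT : ind_open setT.
Proof. by move=> f _; exists setT; split=> // t _; exists 1. Qed.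

Lemma ind_openI : setI_closed ind_open.
Proof.
move=> U1 U2 o1 o2 f [/o1[V1 [c1 n1 s1]] /o2[V2 [c2 n2 s2]]].
exists (V1 `&` V2); split.
- by move=> a b g h ab [g1 g2] [h1 h2]; split; [exact: c1|exact: c2].
- move=> t t0; have [r1 r10 h1] := n1 t t0; have [r2 r20 h2] := n2 t t0.
  exists (Num.min r1 r2) => [|g gr]; first by rewrite lt_min r10.
  split; [apply: h1|apply: h2]; apply: (le_trans gr);
    by rewrite lee_fin ge_min lexx ?orbT.
- by move=> g [/s1 ? /s2 ?].
Qed.

Lemma ind_open_bigU (I : Type) (U : I -> set Ap) :
  (forall i, ind_open (U i)) -> ind_open (\bigcup_i U i).
Proof.
move=> oU f [i _ /oU[V [cV nV sV]]]; exists V; split=> // g /sV Ug.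
by exists i.
Qed.

HB.instance Definition _ :=
  isOpenTopological.Build Ap ind_openT ind_openI ind_open_bigU.

End ApSpace.

Notation mindex n := {ffun 'I_n -> nat}.

Definition mdeg (n : nat) (alpha : mindex n) : nat := \sum_(i < n) alpha i.

Definition partial (R : realType) (n : nat) (i : 'I_n) (f : Cn R n -> R[i]) :
    Cn R n -> R[i] :=
  fun z => 'D_(delta_mx ord0 i) f z.

Definition mpartial (R : realType) (n : nat) (alpha : mindex n)
    (f : Cn R n -> R[i]) : Cn R n -> R[i] :=
  foldr (fun i g => iter (alpha i) (partial i) g) f (enum 'I_n).

Record formal_op (R : realType) (n : nat) : Type := FormalOp {
  coef : mindex n -> Cn R n -> R[i];
  coef_entire : forall alpha, entire (coef alpha) }.

(* The exponent [1 - p^-1] is 1/q. *)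
Definition inDp (R : realType) (n : nat) (p : R) (P : formal_op R n) : Prop :=
  forall eps : R, 0 < eps -> exists B C : R, [/\ 0 < B, 0 < C &
    forall (z : Cn R n) (alpha : mindex n),
      cmod (coef P alpha z) <=
        C * (eps ^+ mdeg alpha / (((mdeg alpha)`!)%:R `^ (1 - p^-1)))
          * expR (B * enorm z `^ p)].

Definition op_term (R : realType) (n : nat) (P : formal_op R n)
    (f : Cn R n -> R[i]) (z : Cn R n) (alpha : mindex n) : R[i] :=
  coef P alpha z * mpartial alpha f z.

Definition op_converges (R : realType) (n : nat) (P : formal_op R n)
    (f : Cn R n -> R[i]) : Prop :=
  forall z,
    esum.summable [set: mindex n] (fun alpha => (cmod (op_term P f z alpha))%:E).

(* [summability.sum] is the limit of the net of finite partial sums. *)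
Definition op_apply (R : realType) (n : nat) (P : formal_op R n)
    (f : Cn R n -> R[i]) : Cn R n -> R[i] :=
  fun z => summability.sum (op_term P f z).

(* Main.v *)
Require Import Defs.
From HB Require Import structures.
From mathcomp Require Import all_boot all_order all_algebra.
From mathcomp Require Import complex ring lra.
From mathcomp Require Import finmap.
From mathcomp Require Import all_classical all_reals all_analysis.
From mathcomp.analysis Require showcase.summability.
Set Implicit Arguments.
Unset Strict Implicit.
Unset Printing Implicit Defensive.
Import Order.TTheory GRing.Theory Num.Theory numFieldNormedType.Exports.
Local Open Scope classical_set_scope.
Local Open Scope ring_scope.

(** Idea of the proof.

    Everything rests on Cauchy estimates for functions that are only assumed to
    be complex differentiable, and these are obtained without integrals.  Sums of
    a function over the sides of a subdivided square play the role of contour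
    integrals: they are additive under halving of the square and vanish on affine
    functions, so the bisection argument of Goursat shows that they tend to 0
    ([goursat]).  Through the exponential map this says that the averages over
    roots of unity on two concentric circles become equal, whence
    [|f c| <= max |f|] over circles centred at [c], even when [f] is merely
    continuous at [c] ([center_le_circle]).  Applied to difference quotients it
    bounds [f'] and the increments of [f'], hence the quadratic Taylor remainder
    ([cauchy_deriv], [taylor2]).  In several variables it follows that pointwise
    limits of locally bounded sequences of entire functions are entire
    ([entire_limit]); so are partial derivatives and locally bounded series, and
    iteration gives the Cauchy estimates and the Taylor expansion of every order
    ([partials_cauchy], [taylor_ccvg]).

    For [|f z| <= M exp (tau |z|^p)] and [k = |alpha|], Cauchy estimates on a ball
    of radius [k^(1/p)] give [|d^alpha f| <= M A^k (k!)^(1 - 1/p) exp (tau' |z|^p)]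
    ([mpartial_growth]).  The weights [(k!)^(1 - 1/p)] are those by which the
    coefficients of an operator of the class are divided, so its terms are
    dominated by [(A eps)^k], geometric for small [eps]: this gives the
    convergence of the series and the continuity of the operator ([op_growth]).

    Conversely, a continuous operator [F] maps each step of the inductive limit
    boundedly into another one ([continuous_step_bounded]).  The only possible
    coefficients are [a_alpha z = F ((zeta - z)^alpha) z / alpha!], because the
    operator with coefficients [a_alpha] takes the value [alpha! a_alpha z] at [z]
    on [(zeta - z)^alpha] ([op_apply_mono]).  On a step of exponent [tau] the norm
    of [(zeta - z)^alpha] is about [(k!)^(1/p) (p tau)^(-k/p)] ([mono_growth]),
    which is small for large [tau]; this puts the operator in the class
    ([symbol_inDp]) and makes the Taylor series of [f] at a fixed [z] converge to
    [f] inside a single step, where [F] may be applied term by term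
    ([symbol_represents]). *)

Local Notation re := complex.Re.
Local Notation im := complex.Im.

Section Modulus.
Variable R : realType.
Local Notation C := R[i].
Implicit Types (x y z : C) (a b : R).

Lemma cmod0 : cmod (0 : C) = 0 :> R. Proof. exact: Normc.normc0. Qed.
Lemma cmod1 : cmod (1 : C) = 1 :> R. Proof. exact: Normc.normc1. Qed.
Lemma cmodM x y : cmod (x * y) = cmod x * cmod y. Proof. exact: Normc.normcM. Qed.
Lemma cmodV x : cmod x^-1 = (cmod x)^-1. Proof. exact: Normc.normcV. Qed.
Lemma cmodN x : cmod (- x) = cmod x.
Proof. by rewrite -mulN1r cmodM /Normc.normc /= oppr0 sqrrN expr1n expr0n addr0 sqrtr1 mul1r. Qed.
Lemma cmodD x y : cmod (x + y) <= cmod x + cmod y.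
Proof. exact: le_normcD. Qed.
Lemma cmodB x y : cmod (x - y) <= cmod x + cmod y.
Proof. by rewrite -[cmod y]cmodN cmodD. Qed.
Lemma cmodC x y : cmod (x - y) = cmod (y - x).
Proof. by rewrite -cmodN opprB. Qed.
Lemma cmod_real a : cmod (a%:C : C)%C = `|a|.
Proof. by rewrite /Normc.normc /= expr0n addr0 sqrtr_sqr. Qed.
Lemma cmod_i : cmod ('i%C : C) = 1 :> R.
Proof. by rewrite /Normc.normc expr0n expr1n add0r sqrtr1. Qed.
Lemma cmodX x k : cmod (x ^+ k) = cmod x ^+ k.
Proof. by elim: k => [|k IH]; rewrite ?expr0 ?cmod1 // !exprS cmodM IH. Qed.
Lemma cmod_nat k : cmod (k%:R : C) = k%:R :> R.
Proof. by rewrite -[k%:R](rmorph_nat (real_complex R)) cmod_real ger0_norm. Qed.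
Lemma cmod_eq0 x : (cmod x == 0) = (x == 0).
Proof. by apply/eqP/eqP => [/Normc.eq0_normc|->] //; exact: cmod0. Qed.
Lemma cmod_gt0 x : (0 < cmod x) = (x != 0).
Proof. by rewrite lt_def cmod_ge0 andbT cmod_eq0. Qed.
Lemma cmod_sum (I : Type) (r : seq I) (P : pred I) (F : I -> C) :
  cmod (\sum_(i <- r | P i) F i) <= \sum_(i <- r | P i) cmod (F i).
Proof.
elim/big_ind2 : _ => [|u a v b ua vb|//]; first by rewrite cmod0.
by apply: le_trans (cmodD _ _) _; exact: lerD.
Qed.
Lemma cmod_prod (I : Type) (r : seq I) (P : pred I) (F : I -> C) :
  cmod (\prod_(i <- r | P i) F i) = \prod_(i <- r | P i) cmod (F i).
Proof.
by elim/big_ind2 : _ => [|u a v b <- <-|//]; rewrite ?cmod1 ?cmodM.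
Qed.
Lemma cmod_le_ReIm x : cmod x <= `|re x| + `|im x|.
Proof.
case: x => a b /=; rewrite -[leRHS]ger0_norm ?addr_ge0 // -sqrtr_sqr.
rewrite ler_wsqrtr // sqrrD !real_normK ?num_real //.
have := mulr_ge0 (normr_ge0 a) (normr_ge0 b); lra.
Qed.
Lemma Re_le_cmod x : `|re x| <= cmod x.
Proof.
by case: x => a b /=; rewrite -sqrtr_sqr ler_wsqrtr // lerDl sqr_ge0.
Qed.
Lemma Im_le_cmod x : `|im x| <= cmod x.
Proof.
by case: x => a b /=; rewrite -[leLHS]sqrtr_sqr ler_wsqrtr // lerDr sqr_ge0.
Qed.
Lemma ReD x y : re (x + y) = re x + re y. Proof. by case: x; case: y. Qed.
Lemma ReB x y : re (x - y) = re x - re y. Proof. by case: x; case: y. Qed.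
Lemma ImB x y : im (x - y) = im x - im y. Proof. by case: x; case: y. Qed.

End Modulus.

Lemma le_of_eq (R : realType) (a b : R) : a = b -> a <= b.
Proof. by move->. Qed.

Lemma le_of_eps (R : realType) (a b K : R) :
  (forall e, 0 < e -> a <= b + K * e) -> a <= b.
Proof.
move=> H; rewrite leNgt; apply/negP => ba.
have K0 : 0 < `|K| + 1 by rewrite ltr_wpDl.
pose e := (a - b) / 2 / (`|K| + 1).
have e0 : 0 < e by rewrite !divr_gt0 // subr_gt0.
have := H e e0; apply/negP; rewrite -ltNge.
have : K * e <= (a - b) / 2.
  apply: le_trans (_ : (`|K| + 1) * e <= _).
    by rewrite ler_wpM2r ?(ltW e0) // (le_trans (ler_norm _)) // lerDl.
  by rewrite mulrC divfK // gt_eqF.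
by move: ba; lra.
Qed.

Lemma ex_nat_ge (R : realType) (x : R) : exists n : nat, x <= n%:R.
Proof.
exists (Num.bound `|x|); apply: le_trans (ler_norm _) _.
exact/ltW/archi_boundP.
Qed.

(** * Bisection of squares *)

Section Bisection.
Variable R : realType.
Local Notation C := R[i].
Local Notation I := ('i%C : C).
Local Notation rc := (fun a : R => (a%:C)%C).

Lemma half_expn (l : R) m : l / 2 ^+ m.+1 = l / 2 ^+ m / 2.
Proof. by rewrite exprSr invfM mulrA. Qed.

Definition insquare (w : C) (l : R) (v : C) : Prop :=
  [/\ re w <= re v, re v <= re w + l, im w <= im v & im v <= im w + l].

Lemma insquare_dist w l v u : insquare w l v -> insquare w l u ->
  cmod (u - v) <= 2 * l.
Proof.
move=> [a b c d] [a' b' c' d']; apply: le_trans (cmod_le_ReIm _) _.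
rewrite ReB ImB [2 * l]mulr_natl mulr2n; apply: lerD; rewrite ler_norml; lra.
Qed.

(** The left ends of nested intervals increase to a point of all of them. *)
Lemma nested_bounds (a : nat -> R) (l : R) : 0 < l ->
  (forall m, a m <= a m.+1 /\ a m.+1 <= a m + l / 2 ^+ m.+1) ->
  exists x, forall m, a m <= x /\ x <= a m + l / 2 ^+ m.
Proof.
move=> l0 H.
have up m k : a m <= a (m + k)%N.
  by elim: k => [|k IH]; rewrite ?addn0 // addnS (le_trans IH) //; case: (H (m + k)%N).
have dn m k : a (m + k)%N + l / 2 ^+ (m + k) <= a m + l / 2 ^+ m.
  elim: k => [|k IH]; rewrite ?addn0 // addnS; apply: le_trans IH.
  have [_ h] := H (m + k)%N.
  have -> : l / 2 ^+ (m + k) = l / 2 ^+ (m + k).+1 + l / 2 ^+ (m + k).+1.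
    by rewrite half_expn -splitr.
  by rewrite addrA lerD2r.
have cross m k : a k <= a m + l / 2 ^+ m.
  have [mk|km] := leqP m k.
    rewrite -(subnKC mk); apply: le_trans (dn m (k - m)%N).
    by rewrite lerDl divr_ge0 ?ltW // exprn_gt0.
  rewrite -(subnKC (ltnW km)); apply: (le_trans (up k (m - k)%N)).
  by rewrite lerDl divr_ge0 ?ltW // exprn_gt0.
pose S := range a; have S0 : has_sup S.
  by split; [exists (a 0%N), 0%N|exists (a 0%N + l / 2 ^+ 0) => _ [k _ <-]].
exists (sup S) => m; split; first by apply: ub_le_sup; [case: S0|exists m].
by apply: ge_sup; [case: S0|move=> _ [k _ <-]; exact: cross].
Qed.

(** Cousin's principle: were [P] to fail on a square it would fail on a nested
   sequence of quarters, hence on arbitrarily small squares around one point. *)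
Lemma square_cousin (P : C -> R -> Prop) (w0 : C) (l0 : R) : 0 < l0 ->
  (forall w l, 0 < l -> P w (l / 2) -> P (w + rc (l / 2)) (l / 2) ->
     P (w + I * rc (l / 2)) (l / 2) ->
     P (w + rc (l / 2) + I * rc (l / 2)) (l / 2) -> P w l) ->
  (forall v, exists2 del, 0 < del &
     forall w l, 0 < l -> l <= del -> insquare w l v -> P w l) ->
  P w0 l0.
Proof.
move=> l00 split_ loc; apply: contrapT => nP0.
have step (w : C) l : exists w' : C, 0 < l -> ~ P w l ->
    [/\ ~ P w' (l / 2), re w <= re w' <= re w + l / 2
      & im w <= im w' <= im w + l / 2].
  have [l0'|l0'] := ltP 0 l; last by exists w.
  have l2 : 0 <= l / 2 by rewrite divr_ge0 // ltW.
  have E (x : R) : x <= x + l / 2 <= x + l / 2 by rewrite lexx andbT lerDl.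
  have E0 (x : R) : x <= x <= x + l / 2 by rewrite lexx lerDl.
  have [p1|p1] := pselect (P w (l / 2)); last by exists w; split.
  have [p2|p2] := pselect (P (w + rc (l / 2)) (l / 2)); last first.
    exists (w + rc (l / 2)) => _ _; case: w {p1} p2 => a b p2.
    by split; rewrite //= ?addr0.
  have [p3|p3] := pselect (P (w + I * rc (l / 2)) (l / 2)); last first.
    exists (w + I * rc (l / 2)) => _ _; case: w {p1 p2} p3 => a b p3.
    by split; rewrite //= !(mul0r, mulr0, mul1r, addr0, subr0, add0r).
  have [p4|p4] := pselect (P (w + rc (l / 2) + I * rc (l / 2)) (l / 2)); last first.
    exists (w + rc (l / 2) + I * rc (l / 2)) => _ _.
    case: w {p1 p2 p3} p4 => a b p4.
    by split; rewrite //= !(mul0r, mulr0, mul1r, addr0, subr0, add0r).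
  by exists w => _ []; apply: split_.
pose nxt w l := projT1 (cid (step w l)).
have nxtP w l : 0 < l -> ~ P w l -> [/\ ~ P (nxt w l) (l / 2),
    re w <= re (nxt w l) <= re w + l / 2 & im w <= im (nxt w l) <= im w + l / 2].
  by rewrite /nxt; case: (cid _).
pose fix sq (m : nat) : C := if m is m'.+1 then nxt (sq m') (l0 / 2 ^+ m') else w0.
have lm0 m : 0 < l0 / 2 ^+ m by rewrite divr_gt0 // exprn_gt0.
have half m : l0 / 2 ^+ m / 2 = l0 / 2 ^+ m.+1 by rewrite half_expn.
have nP m : ~ P (sq m) (l0 / 2 ^+ m).
  elim: m => [|m IH] /=; first by rewrite expr0 divr1.
  by rewrite -half; case: (nxtP _ _ (lm0 m) IH).
have [x xP] : exists x, forall m, re (sq m) <= x /\ x <= re (sq m) + l0 / 2 ^+ m.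
  apply: nested_bounds => // m; have [_ /andP[? ?] _] := nxtP _ _ (lm0 m) (nP m).
  by rewrite -half.
have [y yP] : exists x, forall m, im (sq m) <= x /\ x <= im (sq m) + l0 / 2 ^+ m.
  apply: nested_bounds => // m; have [_ _ /andP[? ?]] := nxtP _ _ (lm0 m) (nP m).
  by rewrite -half.
have [del d0 H] := loc (Complex x y).
have [m ml] : exists m, l0 / 2 ^+ m <= del.
  have [m hm] := ex_nat_ge (l0 / del).
  exists m; rewrite ler_pdivrMr ?exprn_gt0 // mulrC -ler_pdivrMr //.
  apply: (le_trans hm); rewrite -natrX ler_nat; exact/ltnW/ltn_expl.
apply: (nP m); apply: H => //.
by case: (xP m); case: (yP m).
Qed.

End Bisection.

(** * Goursat's lemma on grids *)

Section GridAlgebra.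
Variables (K : comNzRingType) (i : K).
Implicit Types (phi : K -> K) (w d : K).

Definition side_sum (phi : K -> K) (w d : K) (N : nat) : K :=
  \sum_(j < N) phi (w + d *+ j).

(** The Riemann sum of the contour integral of [phi] along the boundary of the
    square of side [N d] at [w]; opposite sides are sampled at corresponding
    points, which makes the sum vanish on affine functions. *)
Definition grid_sum (phi : K -> K) (w d : K) (N : nat) : K :=
  d * (side_sum phi w d N - side_sum phi (w + i * d *+ N) d N) +
  i * d * (side_sum phi (w + d *+ N) (i * d) N - side_sum phi w (i * d) N).

Lemma side_sum_double phi w d N :
  side_sum phi w d (N + N) = side_sum phi w d N + side_sum phi (w + d *+ N) d N.
Proof.
rewrite /side_sum big_split_ord /=; congr (_ + _); apply: eq_bigr => j _.
by rewrite mulrnDr addrA.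
Qed.

Lemma grid_sum_double phi w d N : grid_sum phi w d (N + N) =
  grid_sum phi w d N + grid_sum phi (w + d *+ N) d N + grid_sum phi (w + i * d *+ N) d N
  + grid_sum phi (w + d *+ N + i * d *+ N) d N.
Proof.
rewrite /grid_sum !side_sum_double !mulrnDr.
set x := d *+ N; set y := i * d *+ N.
have -> : w + (y + y) + x = w + x + y + y by ring.
have -> : w + (x + x) + y = w + x + y + x by ring.
have -> : w + (y + y) = w + y + y by ring.
have -> : w + (x + x) = w + x + x by ring.
have -> : w + y + x = w + x + y by ring.
ring.
Qed.

Lemma side_sum_affine a A w d N :
  side_sum (fun v => a + A * v) w d N = (a + A * w) *+ N + A * \sum_(j < N) d *+ j.
Proof.
rewrite /side_sum; under eq_bigr do rewrite mulrDr addrA.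
by rewrite big_split /= sumr_const card_ord mulr_sumr.
Qed.

Lemma grid_sum_affine a A w d N : grid_sum (fun v => a + A * v) w d N = 0.
Proof.
rewrite /grid_sum !side_sum_affine.
have -> : \sum_(j < N) (i * d) *+ j = i * \sum_(j < N) d *+ j.
  by rewrite mulr_sumr; apply: eq_bigr => j _; rewrite mulrnAr.
ring.
Qed.

Lemma grid_sumD phi psi w d N :
  grid_sum (fun v => phi v + psi v) w d N = grid_sum phi w d N + grid_sum psi w d N.
Proof. rewrite /grid_sum /side_sum !big_split /=; ring. Qed.

End GridAlgebra.

Section Goursat.
Variable R : realType.
Local Notation C := R[i].
Local Notation I := ('i%C : C).
Local Notation rc := (fun a : R => (a%:C)%C).

(** Complex differentiability at [z] with derivative [d], phrased with the
    real-valued modulus. *)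
Definition cdiff (f : C -> C) (z d : C) : Prop :=
  forall e : R, 0 < e -> exists2 del : R, 0 < del &
    forall h, cmod h <= del -> cmod (f (z + h) - f z - d * h) <= e * cmod h.

Definition ccont (f : C -> C) (z : C) : Prop :=
  forall e : R, 0 < e -> exists2 del : R, 0 < del &
    forall h, cmod h <= del -> cmod (f (z + h) - f z) <= e.

Lemma side_sum_bound phi w d N (M : R) :
  (forall j : 'I_N, cmod (phi (w + d *+ j)) <= M) ->
  cmod (side_sum phi w d N) <= N%:R * M.
Proof.
move=> H; apply: le_trans (cmod_sum _ _ _) _.
apply: le_trans (ler_sum _ (fun j _ => H j)) _.
by rewrite sumr_const card_ord mulr_natl.
Qed.

Lemma insquare_grid (w : C) (d : R) (N j k : nat) : 0 <= d -> (j <= N)%N -> (k <= N)%N ->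
  insquare w (d *+ N) (w + rc d *+ j + I * rc d *+ k).
Proof.
move=> d0 jN kN.
have -> : w + rc d *+ j + I * rc d *+ k = Complex (re w + d *+ j) (im w + d *+ k).
  case: w => a b.
  have Er m : rc d *+ m = Complex (d *+ m) 0.
    by rewrite -[rc d *+ m]mulr_natr -(rmorph_nat (real_complex R)) -rmorphM /= mulr_natr.
  have Ei m : I * rc d *+ m = Complex 0 (d *+ m).
    rewrite -mulrnAr Er; apply/eqP; rewrite eq_complex /=.
    by rewrite !(mul0r, mulr0, mul1r, subr0, oppr0, add0r, addr0) !eqxx.
  by rewrite Er Ei; apply/eqP; rewrite eq_complex /= !addr0 !eqxx.
split; rewrite /= ?lerDl ?lerD2l ?mulrn_wge0 //; [by rewrite -[_ *+ j]mulr_natr -[_ *+ N]mulr_natr ler_wpM2l ?ler_nat | by rewrite -[_ *+ k]mulr_natr -[_ *+ N]mulr_natr ler_wpM2l ?ler_nat].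
Qed.

Lemma grid_sum_bound phi w (d : R) (N : nat) (M : R) : 0 <= d ->
  (forall v, insquare w (d *+ N) v -> cmod (phi v) <= M) ->
  cmod (grid_sum I phi w (rc d) N) <= 4 * (d *+ N) * M.
Proof.
move=> d0 H.
have B (j k : nat) : (j <= N)%N -> (k <= N)%N ->
    cmod (phi (w + rc d *+ j + I * rc d *+ k)) <= M.
  by move=> jN kN; apply: H; exact: insquare_grid.
have B1 : cmod (side_sum phi w (rc d) N) <= N%:R * M.
  by apply: side_sum_bound => j; have := B j 0%N (ltnW (ltn_ord j)) isT; rewrite addr0.
have B2 : cmod (side_sum phi (w + I * rc d *+ N) (rc d) N) <= N%:R * M.
  by apply: side_sum_bound => j; have := B j N (ltnW (ltn_ord j)) (leqnn _); rewrite addrAC.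
have B3 : cmod (side_sum phi (w + rc d *+ N) (I * rc d) N) <= N%:R * M.
  by apply: side_sum_bound => j; have := B N j (leqnn _) (ltnW (ltn_ord j)).
have B4 : cmod (side_sum phi w (I * rc d) N) <= N%:R * M.
  by apply: side_sum_bound => j; have := B 0%N j isT (ltnW (ltn_ord j)); rewrite addr0.
have P x y : cmod x <= N%:R * M -> cmod y <= N%:R * M ->
    d * cmod (x - y) <= d * (2 * (N%:R * M)).
  move=> hx hy; rewrite ler_wpM2l //; apply: le_trans (cmodB _ _) _.
  by rewrite mulr_natl mulr2n lerD.
rewrite /grid_sum; apply: le_trans (cmodD _ _) _.
rewrite !cmodM cmod_i mul1r cmod_real ger0_norm //.
apply: le_trans (lerD (P _ _ B1 B2) (P _ _ B3 B4)) _.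
by rewrite -mulr_natr; apply: le_of_eq; ring.
Qed.

(** Goursat: a square whose grid sums exceed [eta l^2] would have a quarter with
    the same defect, whereas near a point of differentiability the sums are
    those of the remainder only. *)
Lemma goursat phi (w : C) (l : R) : 0 < l -> (forall v, exists d, cdiff phi v d) ->
  forall eta, 0 < eta -> exists K : nat, forall k : nat, (K <= k)%N ->
    cmod (grid_sum I phi w (rc (l / 2 ^+ k)) (2 ^ k)) <= eta.
Proof.
move=> l0 dphi eta eta0.
pose P (eta : R) w l := exists K : nat, forall k : nat, (K <= k)%N ->
    cmod (grid_sum I phi w (rc (l / 2 ^+ k)) (2 ^ k)) <= eta * l ^+ 2.
suff: P (eta / l ^+ 2) w l.
  by rewrite /P divfK // gt_eqF // exprn_gt0.
have : 0 < eta / l ^+ 2 by rewrite divr_gt0 // exprn_gt0.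
move: (eta / l ^+ 2) => {eta0} {}eta eta0.
apply: square_cousin => // {w l l0}.
- move=> w l l0 [K1 H1] [K2 H2] [K3 H3] [K4 H4].
  exists (maxn K1 (maxn K2 (maxn K3 K4))).+1 => -[//|k].
  rewrite ltnS !geq_max => /and4P[k1 k2 k3 k4].
  have E : l / 2 ^+ k.+1 = l / 2 / 2 ^+ k.
    by rewrite half_expn mulrAC.
  have E2 : rc (l / 2 / 2 ^+ k) *+ 2 ^ k = rc (l / 2).
    rewrite -[LHS]mulr_natr -(rmorph_nat (real_complex R)) -rmorphM /=.
    by rewrite natrX divfK // expf_neq0 // pnatr_eq0.
  rewrite E expnS mul2n -addnn grid_sum_double -!mulrnAr E2.
  apply: le_trans (cmodD _ _) _.
  have := cmodD (grid_sum I phi w (rc (l / 2 / 2 ^+ k)) (2 ^ k) +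
    grid_sum I phi (w + rc (l / 2)) (rc (l / 2 / 2 ^+ k)) (2 ^ k))
    (grid_sum I phi (w + I * rc (l / 2)) (rc (l / 2 / 2 ^+ k)) (2 ^ k)).
  have := cmodD (grid_sum I phi w (rc (l / 2 / 2 ^+ k)) (2 ^ k))
    (grid_sum I phi (w + rc (l / 2)) (rc (l / 2 / 2 ^+ k)) (2 ^ k)).
  move: (H1 _ k1) (H2 _ k2) (H3 _ k3) (H4 _ k4).
  have -> : eta * l ^+ 2 = 4 * (eta * (l / 2) ^+ 2) by field.
  set b := eta * (l / 2) ^+ 2; lra.
move=> v; have [d dv] := dphi v.
have e0 : 0 < eta / 8 by rewrite divr_gt0.
have [del del0 H] := dv _ e0.
exists (del / 2) => [|w l l0 ldel vw]; first by rewrite divr_gt0.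
exists 0%N => k _.
have E2 : l / 2 ^+ k *+ 2 ^ k = l.
  by rewrite -mulr_natr natrX divfK // expf_neq0 // pnatr_eq0.
pose rho u := phi u - (phi v - d * v + d * u).
have -> : phi = (fun u => rho u + ((phi v - d * v) + d * u)).
  by apply/funext => u; rewrite /rho addrNK.
rewrite grid_sumD grid_sum_affine addr0.
apply: le_trans (grid_sum_bound (M := eta / 8 * (2 * l)) _ _) _.
- by rewrite divr_ge0 ?ltW // exprn_gt0.
- rewrite E2 => u uw; have uv := insquare_dist vw uw.
  have -> : rho u = phi (v + (u - v)) - phi v - d * (u - v).
    by rewrite /rho [v + _]addrC subrK; ring.
  apply: le_trans (H _ _) _; first by move: uv ldel; lra.
  by rewrite ler_wpM2l // ltW.
by rewrite E2 expr2; apply: le_of_eq; field.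
Qed.

End Goursat.

Section CdiffCalculus.
Variable R : realType.
Local Notation C := R[i].
Implicit Types (f g : C -> C) (z d e : C).

Lemma cdiff_lip f z d : cdiff f z d -> exists2 del : R, 0 < del &
  forall h, cmod h <= del -> cmod (f (z + h) - f z) <= (cmod d + 1) * cmod h.
Proof.
move=> /(_ 1 ltr01)[del del0 H]; exists del => // h hd.
have -> : f (z + h) - f z = (f (z + h) - f z - d * h) + d * h by rewrite subrK.
apply: le_trans (cmodD _ _) _; rewrite mulrDl addrC lerD ?cmodM //; exact: H.
Qed.

Lemma cdiff_cont f z d : cdiff f z d -> ccont f z.
Proof.
move=> /cdiff_lip[del del0 H] e e0.
have K0 : 0 < cmod d + 1 by rewrite ltr_wpDl ?cmod_ge0.
exists (Num.min del (e / (cmod d + 1))); first by rewrite lt_min del0 divr_gt0.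
move=> h; rewrite le_min => /andP[h1 h2]; apply: le_trans (H _ h1) _.
by rewrite mulrC -ler_pdivlMr.
Qed.

Lemma cdiff_comp f g z d e :
  cdiff f z d -> cdiff g (f z) e -> cdiff (g \o f) z (e * d).
Proof.
move=> fz gz eps eps0.
have [d1 d10 H1] := cdiff_lip fz.
have K0 : 0 < cmod d + 1 by rewrite ltr_wpDl ?cmod_ge0.
have E0 : 0 < cmod e + 1 by rewrite ltr_wpDl ?cmod_ge0.
have [d2 d20 H2] := fz (eps / 2 / (cmod e + 1)) ltac:(by rewrite !divr_gt0).
have [d3 d30 H3] := gz (eps / 2 / (cmod d + 1)) ltac:(by rewrite !divr_gt0).
exists (Num.min d1 (Num.min d2 (d3 / (cmod d + 1)))).
  by rewrite !lt_min d10 d20 divr_gt0.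
move=> h; rewrite !le_min => /and3P[h1 h2 h3] /=.
set k := f (z + h) - f z.
have kh : cmod k <= (cmod d + 1) * cmod h by exact: H1.
have -> : g (f (z + h)) - g (f z) - e * d * h =
    (g (f z + k) - g (f z) - e * k) + e * (k - d * h).
  have -> : f z + k = f (z + h) by rewrite /k addrC subrK.
  by move: (g _) (g _) => u v; ring.
apply: le_trans (cmodD _ _) _.
rewrite [leRHS](_ : _ = eps / 2 * cmod h + eps / 2 * cmod h); last first.
  by rewrite -mulrDl -splitr.
apply: lerD.
  apply: le_trans (H3 _ _) _.
    by apply: le_trans kh _; rewrite mulrC -ler_pdivlMr.
  by rewrite -mulrA ler_wpM2l ?divr_ge0 ?(ltW eps0) // mulrC ler_pdivrMr // mulrC.
rewrite cmodM; apply: le_trans (ler_wpM2l (cmod_ge0 _) (H2 _ h2)) _.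
rewrite mulrA ler_wpM2r ?cmod_ge0 // mulrA ler_pdivrMr //.
by rewrite mulrC ler_wpM2l ?divr_ge0 ?(ltW eps0) // lerDl.
Qed.

Lemma cdiff_cst (a : C) z : cdiff (fun=> a) z 0.
Proof.
move=> e e0; exists 1 => // h _.
by rewrite subrr mul0r subr0 cmod0 mulr_ge0 ?cmod_ge0 ?ltW.
Qed.

Lemma cdiff_affine (a b : C) z : cdiff (fun t => a + t * b) z b.
Proof.
move=> e e0; exists 1 => // h _.
rewrite (_ : _ - _ = 0) ?cmod0 ?mulr_ge0 ?cmod_ge0 ?ltW //; by ring.
Qed.

Lemma cdiffD f g z d e :
  cdiff f z d -> cdiff g z e -> cdiff (fun t => f t + g t) z (d + e).
Proof.
move=> fz gz eps eps0; have eps2 : 0 < eps / 2 by rewrite divr_gt0.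
have [d1 d10 H1] := fz _ eps2; have [d2 d20 H2] := gz _ eps2.
exists (Num.min d1 d2); first by rewrite lt_min d10.
move=> h; rewrite le_min => /andP[h1 h2].
rewrite [_ - _](_ : _ = (f (z + h) - f z - d * h) + (g (z + h) - g z - e * h)); last by ring.
apply: le_trans (cmodD _ _) _; rewrite [eps]splitr mulrDl; apply: lerD; [exact: H1|exact: H2].
Qed.

Lemma cdiffM f g z d e :
  cdiff f z d -> cdiff g z e -> cdiff (fun t => f t * g t) z (d * g z + f z * e).
Proof.
move=> fz gz eps eps0.
pose K := cmod (f z) + cmod (g z) + (cmod d + 1) + 1.
have F0 := cmod_ge0 (f z); have G0 := cmod_ge0 (g z); have D0 := cmod_ge0 d.
have K0 : 0 < K by rewrite /K; move: F0 G0 D0; lra.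
have e10 : 0 < eps / K by rewrite divr_gt0.
have [d1 d10 H1] := cdiff_lip fz; have [d2 d20 H2] := fz _ e10.
have [d3 d30 H3] := gz _ e10; have [d4 d40 H4] := cdiff_cont gz e10.
exists (Num.min (Num.min d1 d2) (Num.min d3 d4)); first by rewrite !lt_min d10 d20 d30.
move=> h; rewrite !le_min => /andP[/andP[h1 h2] /andP[h3 h4]].
rewrite [_ - _](_ : _ = (f (z + h) - f z - d * h) * g z
  + f z * (g (z + h) - g z - e * h) + (f (z + h) - f z) * (g (z + h) - g z)); last by ring.
apply: le_trans (cmodD _ _) _; apply: le_trans (lerD (cmodD _ _) (lexx _)) _.
rewrite !cmodM.
apply: (@le_trans _ _ (eps / K * cmod h * cmod (g z) + cmod (f z) * (eps / K * cmod h)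
  + (cmod d + 1) * cmod h * (eps / K))).
  apply: lerD; first apply: lerD.
  - by rewrite ler_wpM2r ?cmod_ge0 // H2.
  - by rewrite ler_wpM2l ?cmod_ge0 // H3.
  - by rewrite ler_pM ?cmod_ge0 ?H1 ?H4.
have -> : eps * cmod h = eps / K * cmod h * K by rewrite mulrAC divfK ?gt_eqF.
have : 0 <= eps / K * cmod h by rewrite mulr_ge0 ?cmod_ge0 // ltW.
by move: (eps / K) (cmod h) => q m; rewrite /K; lra.
Qed.

Lemma cdiffV z : z != 0 -> cdiff (fun t => t^-1) z (- z^-2).
Proof.
move=> z0 e e0; have m0 : 0 < cmod z by rewrite cmod_gt0.
pose K := 2 / cmod z ^+ 3.
have K0 : 0 < K by rewrite divr_gt0 // exprn_gt0.
exists (Num.min (cmod z / 2) (e / K)); first by rewrite lt_min; apply/andP; split; apply: divr_gt0.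
move=> h; rewrite le_min => /andP[h1 h2].
have zh : cmod z / 2 <= cmod (z + h).
  have := cmodB (z + h) h; rewrite addrK; lra.
have zh0 : z + h != 0 by rewrite -cmod_gt0 (lt_le_trans _ zh) // divr_gt0.
rewrite [_ - _](_ : _ = h * h / (z ^+ 2 * (z + h))); last by field; rewrite z0 zh0.
rewrite !cmodM cmodV cmodM cmodX -mulrA mulrC ler_wpM2r ?cmod_ge0 //.
apply: (@le_trans _ _ (cmod h * K)); last by rewrite -ler_pdivlMr.
rewrite ler_wpM2l ?cmod_ge0 // /K.
have -> : 2 / cmod z ^+ 3 = (cmod z ^+ 2 * (cmod z / 2))^-1 by field; rewrite gt_eqF.
have z2 : 0 < cmod z ^+ 2 by rewrite exprn_gt0.
have A : 0 < cmod z ^+ 2 * (cmod z / 2) by rewrite mulr_gt0 // divr_gt0.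
have B : 0 < cmod z ^+ 2 * cmod (z + h) by rewrite mulr_gt0 // cmod_gt0.
by rewrite lef_pV2 ?posrE // ler_wpM2l // ltW.
Qed.

Lemma cdiff_slope f z c d b : z != c -> cdiff f z d ->
  exists e, cdiff (fun t => (f t - b) / (t - c)) z e.
Proof.
move=> zc fz.
have zc0 : - c + z * 1 != 0 by rewrite mulr1 addrC subr_eq0.
have H := cdiffM (cdiffD fz (cdiff_cst (- b) z))
  (cdiff_comp (cdiff_affine (- c) 1 z) (cdiffV zc0)).
eexists; rewrite (_ : (fun t => _) = (fun t => (f t + - b) * ((fun s => s^-1) \o (fun t => - c + t * 1)) t)); first exact: H.
by apply/funext => t /=; rewrite mulr1 [- c + t]addrC.
Qed.

End CdiffCalculus.

(** * The complex exponential *)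

Section ComplexExponential.
Variable R : realType.
Local Notation C := R[i].
Local Notation I := ('i%C : C).
Local Notation rc := (fun a : R => (a%:C)%C).

Definition cexp (w : C) : C := Complex (expR (re w) * cos (im w)) (expR (re w) * sin (im w)).

Lemma cexpD w h : cexp (w + h) = cexp w * cexp h.
Proof.
case: w h => [a b] [x y]; rewrite /cexp /= expRD cosD sinD.
by apply/eqP; rewrite eq_complex /=; apply/andP; split; apply/eqP; ring.
Qed.

Lemma cmod_cexp w : cmod (cexp w) = expR (re w).
Proof.
rewrite /Normc.normc /cexp !exprMn -mulrDr cos2Dsin2 mulr1 sqrtr_sqr.
by rewrite ger0_norm ?expR_ge0.
Qed.

Lemma cexp_neq0 w : cexp w != 0.
Proof. by rewrite -cmod_gt0 cmod_cexp expR_gt0. Qed.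

Lemma cexp_period w : cexp (w + I * rc (2 * pi)) = cexp w.
Proof.
case: w => a b; rewrite /cexp /= !(mul0r, mulr0, mul1r, subr0, oppr0, add0r, addr0).
have <- : pi *+ 2 = 2 * pi :> R by rewrite mulr_natl.
by rewrite cosD2pi sinD2pi.
Qed.

Lemma real_derive_eps (f : R -> R) (x d : R) : is_derive x (1 : R) f d ->
  forall e, 0 < e -> exists2 del : R, 0 < del &
    forall h, `|h| <= del -> `|f (x + h) - f x - d * h| <= e * `|h|.
Proof.
move=> [dv fd] e e0.
have : h^-1 *: (f (h *: 1 + x) - f x) @[h --> 0^'] --> d by rewrite -fd.
move=> /cvgrPdist_le/(_ _ e0); rewrite near_withinE => /nbhs_ballP[del /= del0 H].
exists (del / 2); first by rewrite divr_gt0.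
move=> h hd; have [->|h0] := eqVneq h 0.
  by rewrite addr0 subrr mulr0 subr0 normr0 mulr0.
have := H h; rewrite /ball /= sub0r normrN => /(_ _ h0) H'.
have {}H' := H' ltac:(by apply: le_lt_trans hd _; rewrite ltr_pdivrMr // mulr_natr mulr2n ltrDl).
have -> : f (x + h) - f x - d * h = - (d - h^-1 * (f (h *: 1 + x) - f x)) * h.
  rewrite /GRing.scale /= mulr1 [h + x]addrC opprB mulrBl mulrAC mulVf // mul1r.
  by [].
by rewrite normrM normrN ler_wpM2r.
Qed.

Lemma cdiff_cexp0 : cdiff cexp 0 1.
Proof.
move=> e0' e0'0.
pose e := Num.min (e0' / 8) 1.
have e0 : 0 < e by rewrite lt_min divr_gt0 //= ltr01.
have e1 : e <= 1 by rewrite ge_min lexx orbT.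
have e8 : 8 * e <= e0' by rewrite mulrC -ler_pdivlMr // ge_min lexx.
clearbody e.
have [d1 d10 H1] := real_derive_eps (is_derive_expR 0) e0.
have [d2 d20 H2] := real_derive_eps (is_derive_sin 0) e0.
have [d3 d30 H3] := real_derive_eps (is_derive_cos 0) e0.
exists (Num.min (Num.min d1 d2) (Num.min d3 e)).
  by rewrite !lt_min d10 d20 d30.
move=> [a b]; rewrite !le_min => /andP[/andP[h1 h2] /andP[h3 h4]].
set h := Complex a b in h1 h2 h3 h4 *.
have ah : `|a| <= cmod h := Re_le_cmod h; have bh : `|b| <= cmod h := Im_le_cmod h.
have := H1 a (le_trans ah h1); have := H2 b (le_trans bh h2); have := H3 b (le_trans bh h3).
rewrite !add0r expR0 sin0 cos0 oppr0 mul0r !subr0 ?addr0 !mul1r => C3 C2 C1.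
apply: (@le_trans _ _ (8 * e * cmod h)); last by rewrite ler_wpM2r ?cmod_ge0.
have -> : cexp h - cexp 0 - h =
    Complex ((expR a - 1 - a) * cos b + (1 + a) * (cos b - 1))
            ((expR a - 1) * sin b + (sin b - b)).
  rewrite /cexp /= expR0 sin0 cos0 mulr0 mulr1.
  by apply/eqP; rewrite eq_complex /=; apply/andP; split; apply/eqP; ring.
apply: le_trans (cmod_le_ReIm _) _; rewrite [re _]/= [im _]/=.
apply: le_trans (lerD (ler_normD _ _) (ler_normD _ _)) _; rewrite !normrM.
have cb : `|cos b| <= 1 by rewrite ler_norml cos_geN1 cos_le1.
have a1 : `|1 + a| <= 2.
  by apply: le_trans (ler_normD _ _) _; rewrite normr1; move: (ah) (h4) (e1); lra.
have ea : `|expR a - 1| <= 2 * e.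
  have -> : expR a - 1 = (expR a - 1 - a) + a by ring.
  apply: le_trans (ler_normD _ _) _.
  have : e * `|a| <= 1 * `|a| by rewrite ler_wpM2r.
  move: C1 ah h4; lra.
have sb : `|sin b| <= 2 * cmod h.
  have -> : sin b = (sin b - b) + b by ring.
  apply: le_trans (ler_normD _ _) _.
  have : e * `|b| <= 1 * `|b| by rewrite ler_wpM2r.
  move: C2 bh; lra.
have P1 : `|expR a - 1 - a| * `|cos b| <= (e * cmod h) * 1.
  by rewrite ler_pM // (le_trans C1) // ler_wpM2l // ltW.
have P2 : `|1 + a| * `|cos b - 1| <= 2 * (e * cmod h).
  by rewrite ler_pM // (le_trans C3) // ler_wpM2l // ltW.
have P3 : `|expR a - 1| * `|sin b| <= 2 * e * (2 * cmod h) by rewrite ler_pM.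
have P4 : `|sin b - b| <= e * cmod h by rewrite (le_trans C2) // ler_wpM2l // ltW.
by move: P1 P2 P3 P4; lra.
Qed.

Lemma cdiff_cexp w : cdiff cexp w (cexp w).
Proof.
move=> e e0; have [del del0 H] := cdiff_cexp0 (divr_gt0 e0 (expR_gt0 (re w))).
exists del => // h hd.
have -> : cexp (w + h) - cexp w - cexp w * h = cexp w * (cexp (0 + h) - cexp 0 - 1 * h).
  by rewrite cexpD add0r /cexp /= expR0 sin0 cos0 !mulr0 !mulr1; set u := Complex _ _; set v := Complex _ _; have -> : Complex 1 0 = 1 :> C by []; ring.
rewrite cmodM cmod_cexp mulrC -ler_pdivlMr ?expR_gt0 // mulrAC; exact: H.
Qed.

End ComplexExponential.

(** * The mean value property *)

Section MeanValue.
Variable R : realType.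
Local Notation C := R[i].
Local Notation I := ('i%C : C).
Local Notation rc := (fun a : R => (a%:C)%C).

Lemma re_vertical (a d : R) j : re (rc a + I * rc d *+ j) = a.
Proof.
rewrite -mulrnAr -[(d%:C)%C *+ j]mulr_natr -(rmorph_nat (real_complex R)) -rmorphM.
by rewrite /= !(mul0r, mulr0, mul1r, subr0, oppr0, addr0).
Qed.

(** In the coordinate [w] with [zeta = c + exp w], Goursat's lemma on squares of
    side [2 pi] says that the averages of [f] over the [2^k]-th roots of unity on
    the circles of radii [exp s] and [exp (s - 2 pi)] become equal as [k] grows;
    the averages over very small circles are close to [f c]. *)
Lemma center_le_circle (f : C -> C) (c : C) (r M : R) : 0 < r ->
  (forall z, z != c -> exists d, cdiff f z d) -> ccont f c ->
  (forall z, cmod (z - c) = r -> cmod (f z) <= M) -> cmod (f c) <= M.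
Proof.
move=> r0 df cf fM.
pose phi w := f (c + cexp w).
have dphi w : exists d, cdiff phi w d.
  have cw : c + cexp w * 1 != c by rewrite mulr1 -subr_eq0 addrAC subrr add0r cexp_neq0.
  have [d Hd] := df _ cw.
  have H := cdiff_comp (cdiff_comp (cdiff_cexp w) (cdiff_affine c 1 _)) Hd.
  by eexists; rewrite (_ : phi = f \o ((fun t => c + t * 1) \o (@cexp R))); [exact: H|apply/funext => t /=; rewrite mulr1].
have perphi w : phi (w + I * rc (2 * pi)) = phi w by rewrite /phi cexp_period.
pose l : R := 2 * pi.
have l0 : 0 < l by rewrite mulr_gt0 // pi_gt0.
pose avg (k : nat) (s : R) := side_sum phi (rc s) (I * rc (l / 2 ^+ k)) (2 ^ k).
have two0 k : 2 ^+ k != 0 :> R by rewrite expf_neq0 // pnatr_eq0.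
have E2 k : rc (l / 2 ^+ k) *+ 2 ^ k = rc l.
  rewrite -[LHS]mulr_natr -(rmorph_nat (real_complex R)) -rmorphM /=.
  by rewrite natrX divfK.
have step s eta : 0 < eta -> exists K : nat, forall k, (K <= k)%N ->
    cmod (avg k s - avg k (s - l)) <= eta * 2 ^+ k.
  (* By periodicity the sums over the two horizontal sides cancel. *)
  move=> eta0; have [K H] := goursat (rc (s - l)) l0 dphi (mulr_gt0 l0 eta0).
  exists K => k /H; rewrite /grid_sum -mulrnAr E2.
  have -> : side_sum phi (rc (s - l) + I * rc l) (rc (l / 2 ^+ k)) (2 ^ k) =
            side_sum phi (rc (s - l)) (rc (l / 2 ^+ k)) (2 ^ k).
    by apply: eq_bigr => j _; rewrite addrAC perphi.
  have -> : rc (s - l) + rc l = rc s by rewrite -rmorphD /= subrK.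
  rewrite subrr mulr0 add0r !cmodM cmod_i mul1r cmod_real.
  rewrite ger0_norm ?divr_ge0 ?exprn_ge0 ?(ltW l0) //.
  rewrite -mulrA ler_pM2l // mulrC ler_pdivrMr ?exprn_gt0 //.
have steps m s : forall eta, 0 < eta -> exists K : nat, forall k, (K <= k)%N ->
    cmod (avg k s - avg k (s - l *+ m)) <= eta * 2 ^+ k.
  elim: m => [|m IH] eta eta0.
    by exists 0%N => k _; rewrite mulr0n subr0 subrr cmod0 mulr_ge0 ?exprn_ge0 // ltW.
  have eta2 : 0 < eta / 2 by rewrite divr_gt0.
  have [K1 H1] := IH _ eta2; have [K2 H2] := step (s - l *+ m) _ eta2.
  exists (maxn K1 K2) => k; rewrite geq_max => /andP[k1 k2].
  have -> : avg k s - avg k (s - l *+ m.+1) = (avg k s - avg k (s - l *+ m)) +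
     (avg k (s - l *+ m) - avg k (s - l *+ m - l)).
    by rewrite mulrSr opprD addrA; set u := avg _ _; set v := avg _ _; set t := avg _ _; ring.
  apply: le_trans (cmodD _ _) _; rewrite [eta]splitr mulrDl.
  by apply: lerD; [exact: H1|exact: H2].
apply: (@le_of_eps _ _ _ 2) => eta eta0.
have [del del0 Hdel] := cf _ eta0.
pose s := ln r.
(* Finitely many steps inwards reach a circle on which [f] is close to [f c]. *)
have [m Hm] : exists m, expR (s - l *+ m) <= del.
  have [m Hm] := ex_nat_ge ((s - ln del) / l).
  exists m; rewrite -[leRHS](lnK del0) ler_expR.
  by move: Hm; rewrite ler_pdivrMr // mulr_natl; lra.
have [K HK] := steps m s _ eta0; have {HK} := HK K (leqnn _).
set u := avg _ _; set v := avg _ _ => uv.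
have n0 : 0 < 2 ^+ K :> R by rewrite exprn_gt0.
have uM : cmod u <= M * 2 ^+ K.
  rewrite -natrX [leRHS]mulrC; apply: side_sum_bound => j; apply: fM.
  by rewrite addrAC subrr add0r cmod_cexp re_vertical lnK.
have vM : cmod (v - f c *+ 2 ^ K) <= eta * 2 ^+ K.
  have -> : v - f c *+ 2 ^ K = side_sum (fun w => phi w - f c) (rc (s - l *+ m)) (I * rc (l / 2 ^+ K)) (2 ^ K).
    by rewrite /side_sum big_split /= sumr_const card_ord mulNrn.
  rewrite -natrX [leRHS]mulrC; apply: side_sum_bound => j; apply: Hdel.
  by rewrite cmod_cexp re_vertical.
rewrite -(ler_pM2r n0).
have -> : cmod (f c) * 2 ^+ K = cmod (f c *+ 2 ^ K).
  by rewrite -[f c *+ _]mulr_natr cmodM cmod_nat natrX.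
have -> : f c *+ 2 ^ K = u - (u - v) - (v - f c *+ 2 ^ K) by ring.
apply: le_trans (cmodB _ _) _; apply: le_trans (lerD (cmodB _ _) (lexx _)) _.
move: uM vM uv; set t := 2 ^+ K; have -> : (M + 2 * eta) * t = M * t + eta * t + eta * t by ring.
lra.
Qed.

End MeanValue.

(** * Cauchy estimates and Taylor's formula in one variable *)

Section OneVariable.
Variable R : realType.
Local Notation C := R[i].
Local Notation rc := (fun a : R => (a%:C)%C).
Implicit Types (f : C -> C) (c h : C).

Lemma cdiff_near f g z d (del : R) : 0 < del ->
  (forall h, cmod h <= del -> g (z + h) = f (z + h)) -> cdiff f z d -> cdiff g z d.
Proof.
move=> del0 fg fz e e0; have [del' del'0 H] := fz e e0.
exists (Num.min del del'); first by rewrite lt_min del0.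
move=> h; rewrite le_min => /andP[h1 h2].
have := fg 0; rewrite cmod0 addr0 => -> //; last exact: ltW.
by rewrite fg //; exact: H.
Qed.

(** The difference quotient at [c], completed by the derivative, is subject to
    the mean value inequality. *)
Lemma deriv_le_circle f f' c (r B : R) : 0 < r ->
  (forall z, cdiff f z (f' z)) ->
  (forall z, cmod (z - c) = r -> cmod (f z - f c) <= B) ->
  cmod (f' c) <= B / r.
Proof.
move=> r0 df fB.
pose g z := if z == c then f' c else (f z - f c) / (z - c).
have -> : f' c = g c by rewrite /g eqxx.
apply: (center_le_circle (r := r)) => //.
- move=> z zc; have [e He] := cdiff_slope (f c) zc (df z).
  have m0 : 0 < cmod (z - c) by rewrite cmod_gt0 subr_eq0.
  exists e; apply: (cdiff_near (del := cmod (z - c) / 2)) He; first by rewrite divr_gt0.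
  move=> h hz; rewrite /g; case: eqP => // zhc; exfalso.
  have E : z - c = - h by rewrite -zhc opprD addrA subrr add0r.
  by move: hz m0; rewrite E cmodN; lra.
- move=> e e0; have [del del0 H] := df c e e0; exists del => // h hd.
  rewrite /g eqxx; case: eqP => [|/eqP hc]; first by rewrite subrr cmod0 ltW.
  have h0 : h != 0 by apply: contra hc => /eqP->; rewrite addr0.
  have -> : c + h - c = h by rewrite addrAC subrr add0r.
  have -> : (f (c + h) - f c) / h - f' c = (f (c + h) - f c - f' c * h) / h.
    by rewrite [RHS]mulrBl mulfK.
  by rewrite cmodM cmodV ler_pdivrMr ?cmod_gt0 // H.
- move=> z zr; rewrite /g; case: eqP => [zc|_].
    by move: zr r0; rewrite zc subrr cmod0 => <-; rewrite ltxx.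
  by rewrite cmodM cmodV zr ler_wpM2r ?invr_ge0 ?(ltW r0) // fB.
Qed.

Lemma cauchy_deriv f f' c (r M : R) : 0 < r ->
  (forall z, cdiff f z (f' z)) ->
  (forall z, cmod (z - c) <= r -> cmod (f z) <= M) ->
  cmod (f' c) <= 2 * M / r.
Proof.
move=> r0 df fM; apply: deriv_le_circle df _ => // z zr.
apply: le_trans (cmodB _ _) _; rewrite [2 * M]mulr_natl mulr2n.
by apply: lerD; apply: fM; rewrite ?zr // subrr cmod0 ltW.
Qed.

(** Mean value inequality with a majorant [Phi], by bisection. *)
Lemma majorant_le (g : C -> C) (g' : R -> C) (Phi Phi' : R -> R) :
  (forall t, 0 <= t <= 1 -> cdiff g (rc t) (g' t)) ->
  (forall t, is_derive t (1 : R) Phi (Phi' t)) ->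
  (forall t, 0 <= t <= 1 -> cmod (g' t) <= Phi' t) ->
  cmod (g 1 - g 0) <= Phi 1 - Phi 0.
Proof.
move=> dg dPhi gP; apply: (@le_of_eps _ _ _ 1) => e e0; rewrite mul1r.
(* A square stands here for its projection to the real axis. *)
pose P (w : C) (l : R) := 0 <= re w -> re w + l <= 1 ->
  cmod (g (rc (re w + l)) - g (rc (re w))) <= Phi (re w + l) - Phi (re w) + e * l.
suff : P 0 1.
  by rewrite /P /= !add0r mulr1; apply.
apply: square_cousin => //.
- move=> w l l0 H1 H2 _ _ w0 wl.
  have := H1 w0 ltac:(lra); have := H2; rewrite /P ReD [re (rc _)]/= -addrA -splitr.
  move=> /(_ ltac:(by rewrite addr_ge0 // divr_ge0 // ltW) wl) => h2 h1.
  have -> : g (rc (re w + l)) - g (rc (re w)) =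
    (g (rc (re w + l)) - g (rc (re w + l / 2))) + (g (rc (re w + l / 2)) - g (rc (re w))).
    by rewrite addrA subrK.
  apply: le_trans (cmodD _ _) _; lra.
move=> v; have [v01|nv01] := boolP (0 <= re v <= 1); last first.
  exists 1 => // w l l0 _ [a b _ _] w0 wl; exfalso; move/negP: nv01; apply; lra.
have e2 : 0 < e / 2 by rewrite divr_gt0.
have [d1 d10 H1] := dg _ v01 _ e2.
have [d2 d20 H2] := real_derive_eps (dPhi (re v)) e2.
exists (Num.min d1 d2); first by rewrite lt_min d10.
move=> w l l0; rewrite le_min => /andP[l1 l2] [a b _ _] w0 wl.
set s := re v in H1 H2 v01 a b *.
have K (x : R) : `|x| <= l -> cmod (g (rc (s + x)) - g (rc s)) <= (Phi' s + e / 2) * `|x|.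
  move=> xl; have := H1 (rc x); rewrite cmod_real => /(_ (le_trans xl l1)).
  rewrite -rmorphD /= => H.
  have -> : g (rc (s + x)) - g (rc s) = (g (rc (s + x)) - g (rc s) - g' s * rc x) + g' s * rc x.
    by rewrite subrK.
  apply: le_trans (cmodD _ _) _; rewrite cmodM cmod_real mulrDl addrC.
  by rewrite lerD // ler_wpM2r // gP.
have L1 := K (re w + l - s); have L2 := K (re w - s).
have M1 := H2 (re w + l - s); have M2 := H2 (re w - s).
have n1 : `|re w + l - s| = re w + l - s by rewrite ger0_norm; lra.
have n2 : `|re w - s| = s - re w by rewrite ler0_norm; lra.
move: L1 L2 M1 M2; rewrite n1 n2 ![s + (_ - s)]addrC !subrK.
move=> /(_ ltac:(lra)) L1 /(_ ltac:(lra)) L2 /(_ ltac:(lra)) M1 /(_ ltac:(lra)) M2.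
have -> : g (rc (re w + l)) - g (rc (re w)) =
   (g (rc (re w + l)) - g (rc s)) - (g (rc (re w)) - g (rc s)).
  by rewrite opprB addrA subrK.
apply: le_trans (cmodB _ _) _.
move: M1 M2; rewrite !ler_norml => /andP[M1 _] /andP[_ M2].
move: L1 L2 M1 M2; nra.
Qed.

Lemma is_derive_monomial (q : R) m (t : R) :
  is_derive t (1 : R) (fun t => q * t ^+ m.+1) (q * (m.+1%:R * t ^+ m)).
Proof.
have H : is_derive t (1 : R) (q \*: (@idfun R) ^+ m.+1) (q *: (m.+1%:R *: (t ^+ m) *: (1 : R))).
  by apply: is_deriveZ; apply: is_derive_eq; rewrite scaler_nat.
have -> : (fun t => q * t ^+ m.+1) = q \*: (@idfun R) ^+ m.+1.
  by apply/funext => x; rewrite /GRing.scale /= exprfctE.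
by apply: is_derive_eq; rewrite /GRing.scale /= mulr1.
Qed.

Lemma mean_value f f' c h (L : R) : (forall z, cdiff f z (f' z)) ->
  (forall t : R, 0 <= t <= 1 -> cmod (f' (c + rc t * h)) <= L) ->
  cmod (f (c + h) - f c) <= L * cmod h.
Proof.
move=> df fL.
have H t : cdiff (f \o (fun t => c + t * h)) t (f' (c + t * h) * h).
  by apply: cdiff_comp; [exact: cdiff_affine|exact: df].
have := majorant_le (fun t _ => H (rc t)) (is_derive_monomial (L * cmod h) 0).
rewrite /= mul1r mul0r addr0 expr1n expr0n mulr1 mulr0 subr0; apply.
by move=> t t01; rewrite expr0 !mulr1 cmodM ler_wpM2r ?cmod_ge0 // fL.
Qed.

Lemma segment_in_ball (t r : R) (h : C) : 0 <= t <= 1 -> cmod h <= r -> cmod (rc t * h) <= r.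
Proof.
move=> /andP[t0 t1]; apply: le_trans; rewrite cmodM cmod_real ger0_norm //.
by rewrite ler_piMl // cmod_ge0.
Qed.

(** The estimate of the derivative, applied to the increment [f (z + h) - f z],
    which is itself small by the mean value inequality. *)
Lemma cauchy_deriv_lip f f' c h (r M : R) : 0 < r ->
  (forall z, cdiff f z (f' z)) ->
  (forall z, cmod (z - c) <= 3 * r -> cmod (f z) <= M) ->
  cmod h <= r -> cmod (f' (c + h) - f' c) <= 4 * M / r ^+ 2 * cmod h.
Proof.
move=> r0 df fM hr.
pose F z := f (z + h) - f z; pose F' z := f' (z + h) - f' z.
have dF z : cdiff F z (F' z).
  have H1 : cdiff (f \o (fun t => h + t * 1)) z (f' (h + z * 1) * 1).
    by apply: cdiff_comp; [exact: cdiff_affine|exact: df].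
  have H2 : cdiff (fun t => 0 + f t * - 1) z (f' z * - 1).
    have -> : f' z * - 1 = - 1 * f' z by rewrite mulrC.
    by apply: (@cdiff_comp R f (fun t => 0 + t * - 1)); [exact: df|exact: cdiff_affine].
  have := cdiffD H1 H2; rewrite !mulr1 mulrN1 [h + z]addrC.
  by apply: cdiff_near ltr01 _ => u _; rewrite /F /= add0r mulrN1 mulr1 [h + _]addrC.
have f'b w : cmod (w - c) <= 2 * r -> cmod (f' w) <= 2 * M / r.
  move=> wc; apply: cauchy_deriv df _ => // z zw; apply: fM.
  have -> : z - c = (z - w) + (w - c) by ring.
  apply: le_trans (cmodD _ _) _; lra.
have Fb z : cmod (z - c) <= r -> cmod (F z) <= 2 * M / r * cmod h.
  move=> zc; apply: mean_value df _ => t t01; apply: f'b.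
  have -> : z + rc t * h - c = (z - c) + rc t * h by ring.
  apply: le_trans (cmodD _ _) _; have := segment_in_ball t01 hr; lra.
apply: le_trans (cauchy_deriv r0 dF Fb) _.
by apply: le_of_eq; field; rewrite gt_eqF.
Qed.

(** The mean value inequality for [f z - f' c z], whose derivative is controlled
    by the Lipschitz estimate of [f']. *)
Lemma taylor2 f f' c h (r M : R) : 0 < r ->
  (forall z, cdiff f z (f' z)) ->
  (forall z, cmod (z - c) <= 3 * r -> cmod (f z) <= M) ->
  cmod h <= r -> cmod (f (c + h) - f c - f' c * h) <= 4 * M / r ^+ 2 * cmod h ^+ 2.
Proof.
move=> r0 df fM hr.
have M0 : 0 <= M by apply: le_trans (cmod_ge0 _) (fM c _); rewrite subrr cmod0 mulr_ge0 // ltW.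
have K0 : 0 <= 4 * M / r ^+ 2 by rewrite mulr_ge0 ?invr_ge0 ?exprn_ge0 ?mulr_ge0 // ltW.
have dG z : cdiff (fun t => f t + (0 + t * - f' c)) z (f' z + - f' c).
  by apply: cdiffD; [exact: df|exact: cdiff_affine].
have := mean_value (c := c) (h := h) dG (L := 4 * M / r ^+ 2 * cmod h).
rewrite -[_ * cmod h * cmod h]mulrA -expr2.
rewrite (_ : _ - (f c + _) = f (c + h) - f c - f' c * h); last by ring.
apply=> t t01; have tr := segment_in_ball t01 hr.
apply: le_trans (cauchy_deriv_lip r0 df fM tr) _.
by rewrite ler_wpM2l // segment_in_ball.
Qed.

Lemma cdiff_pow m (h : C) z :
  cdiff (fun t => (t * h) ^+ m / m`!%:R) z
    (if m is m'.+1 then h * ((z * h) ^+ m' / m'`!%:R) else 0).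
Proof.
elim: m => [|m IH].
  by rewrite (_ : (fun _ => _) = fun=> 1); [exact: cdiff_cst|apply/funext => t; rewrite expr0 fact0 divr1].
have H1 : cdiff (fun t => 0 + t * (h / m.+1%:R)) z (h / m.+1%:R) by exact: cdiff_affine.
have := cdiffM H1 IH.
have -> : (fun t => (0 + t * (h / m.+1%:R)) * ((t * h) ^+ m / m`!%:R)) =
          (fun t => (t * h) ^+ m.+1 / (m.+1)`!%:R).
  by apply/funext => t; rewrite add0r factS natrM exprS invfM; ring.
have m0 : m.+1%:R != 0 :> C by rewrite pnatr_eq0.
suff -> : h / m.+1%:R * ((z * h) ^+ m / m`!%:R) +
   (0 + z * (h / m.+1%:R)) * (if m is m'.+1 then h * ((z * h) ^+ m' / m'`!%:R) else 0) =
  h * ((z * h) ^+ m / m`!%:R) by [].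
case: m {IH H1} m0 => [|m] m0; first by rewrite mulr0 addr0 divr1.
have m1 : m.+1%:R != 0 :> C by rewrite pnatr_eq0.
have mf : m`!%:R != 0 :> C by rewrite pnatr_eq0 -lt0n fact_gt0.
rewrite add0r factS natrM exprS; set q := (z * h) ^+ m.
move: m0 m1 mf q; rewrite -[m.+2%:R]natr1; move: (m.+1%:R) (m`!%:R) => x y x1 x0 y0 q.
by field; rewrite x0 x1 y0.
Qed.

(** [D] lists the successive derivatives of [D 0]; induction on the order, the
    derivative of the remainder being the remainder of the derivative. *)
Lemma taylor_remainder (D : nat -> C -> C) c N h (K : R) :
  (forall a z, cdiff (D a) z (D a.+1 z)) ->
  (forall t : R, 0 <= t <= 1 -> cmod (D N (c + rc t * h)) <= K) ->
  cmod (D 0%N (c + h) - \sum_(a < N) D a c * (h ^+ a / a`!%:R))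
    <= K * (cmod h ^+ N / N`!%:R).
Proof.
elim: N D h => [|N IH] D h dD DK.
  rewrite big_ord0 subr0 expr0 fact0 divr1 mulr1 -[h]mul1r; apply: (DK 1).
  by rewrite ler01 lexx.
pose g t := D 0%N (c + t * h) - \sum_(a < N.+1) D a c * ((t * h) ^+ a / a`!%:R).
pose g' (t : R) := h * (D 1%N (c + rc t * h) - \sum_(a < N) D a.+1 c * ((rc t * h) ^+ a / a`!%:R)).
have dsum n z : cdiff (fun t => \sum_(a < n) D a c * ((t * h) ^+ a / a`!%:R)) z
    (\sum_(a < n) D a c * (if (a : nat) is m'.+1 then h * ((z * h) ^+ m' / m'`!%:R) else 0)).
  elim: n => [|n IHn].
    rewrite big_ord0 (_ : (fun t => _) = fun=> 0); first exact: cdiff_cst.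
    by apply/funext => t; rewrite big_ord0.
  rewrite big_ord_recr /= (_ : (fun t => _) = (fun t => (\sum_(a < n) D a c * ((t * h) ^+ a / a`!%:R)) +  D n c * ((t * h) ^+ n / n`!%:R))); last first.
    by apply/funext => t; rewrite big_ord_recr.
  apply: cdiffD => //.
  by have := cdiffM (cdiff_cst (D n c) z) (cdiff_pow n h z); rewrite mul0r add0r.
have dg z : cdiff g z (h * (D 1%N (c + z * h) - \sum_(a < N) D a.+1 c * ((z * h) ^+ a / a`!%:R))).
  have H1 : cdiff (D 0%N \o (fun t => c + t * h)) z (D 1%N (c + z * h) * h).
    by apply: cdiff_comp; [exact: cdiff_affine|exact: dD].
  have H2 := cdiffM (cdiff_cst (-1) z) (dsum N.+1 z).
  have := cdiffD H1 H2; rewrite mul0r add0r mulN1r big_ord_recl mulr0 add0r.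
  rewrite (_ : h * _ = D 1%N (c + z * h) * h - \sum_(i < N) D (lift ord0 i) c *
       match val (lift ord0 i) with | 0%N => 0 | m'.+1 => h * ((z * h) ^+ m' / (m'`!)%:R) end).
    by apply: cdiff_near ltr01 _ => u _; rewrite /g /= mulN1r.
  rewrite mulrBr mulrC; congr (_ - _); rewrite mulr_sumr; apply: eq_bigr => a _.
  by rewrite /= /bump leq0n add1n mulrCA.
pose q : R := K * (cmod h ^+ N.+1 / (N.+1)`!%:R).
have := majorant_le (g' := g') (fun t _ => dg (rc t)) (is_derive_monomial q N).
have -> : g 1 = D 0%N (c + h) - \sum_(a < N.+1) D a c * (h ^+ a / (a`!)%:R).
  by rewrite /g mul1r.
have -> : g 0 = 0.
  rewrite /g mul0r addr0 big_ord_recl expr0 fact0 divr1 mulr1 big1 ?addr0 ?subrr // => i _.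
  by rewrite /= /bump leq0n add1n expr0n mul0r mulr0.
rewrite subr0 expr1n mulr1 expr0n mulr0 subr0; apply.
move=> t t01; rewrite /g' cmodM.
have := IH (fun a => D a.+1) (rc t * h) (fun a => dD a.+1).
move=> /(_ _)/(le_trans _) H; apply: (@le_trans _ _ (cmod h * (K * (cmod (rc t * h) ^+ N / N`!%:R)))).
  rewrite ler_wpM2l ?cmod_ge0 //; apply: H => // s s01; rewrite mulrA -rmorphM /=.
  apply: DK; move: s01 t01 => /andP[s0 s1] /andP[t0 t1].
  by rewrite mulr_ge0 //= mulr_ile1.
apply: le_of_eq; rewrite cmodM cmod_real ger0_norm; last by case/andP: t01.
rewrite /q factS natrM exprMn [cmod h ^+ N.+1]exprS.
have m0 : N.+1%:R != 0 :> R by rewrite pnatr_eq0.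
have mf : N`!%:R != 0 :> R by rewrite pnatr_eq0 -lt0n fact_gt0.
by move: (N.+1%:R) (N`!%:R) (t ^+ N) (cmod h ^+ N) m0 mf => x y u v x0 y0; field; rewrite x0 y0.
Qed.

End OneVariable.

(** * Entire functions of several variables *)

Section L1Norm.
Variables (R : realType) (n : nat).
Local Notation C := R[i].
Implicit Types (z v : Cn R n).

(** The sum norm; unlike the Euclidean norm its triangle inequality is immediate,
    and the two are equivalent. *)
Definition l1norm (z : Cn R n) : R := \sum_(i < n) cmod (z ord0 i).

Lemma l1norm_ge0 z : 0 <= l1norm z.
Proof. by apply: sumr_ge0 => i _; exact: cmod_ge0. Qed.

Lemma l1norm0 : l1norm 0 = 0.
Proof. by rewrite /l1norm big1 // => i _; rewrite mxE cmod0. Qed.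

Lemma l1normD z v : l1norm (z + v) <= l1norm z + l1norm v.
Proof. by rewrite /l1norm -big_split /=; apply: ler_sum => i _; rewrite mxE cmodD. Qed.

Lemma l1normZ a z : l1norm (a *: z) = cmod a * l1norm z.
Proof. by rewrite /l1norm mulr_sumr; apply: eq_bigr => i _; rewrite mxE cmodM. Qed.

Lemma l1normN z : l1norm (- z) = l1norm z.
Proof. by rewrite -scaleN1r l1normZ cmodN cmod1 mul1r. Qed.

Lemma l1norm_delta i : l1norm (delta_mx ord0 i) = 1.
Proof.
rewrite /l1norm (bigD1 i) //= mxE !eqxx cmod1 big1 ?addr0 // => j ji.
by rewrite mxE (negbTE ji) andbF cmod0.
Qed.

Lemma coord_le_l1norm z i : cmod (z ord0 i) <= l1norm z.
Proof. by rewrite /l1norm (bigD1 i) //= lerDl sumr_ge0 // => j _; exact: cmod_ge0. Qed.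

Lemma l1norm_eq0 z : l1norm z = 0 -> z = 0.
Proof.
move=> z0; apply/rowP => i; rewrite mxE; apply/eqP; rewrite -cmod_eq0 eq_le cmod_ge0 andbT.
by rewrite -z0 coord_le_l1norm.
Qed.

Lemma enorm_ge0 z : 0 <= enorm z.
Proof. exact: sqrtr_ge0. Qed.

Lemma coord_le_enorm z i : cmod (z ord0 i) <= enorm z.
Proof.
rewrite -[leLHS]ger0_norm ?cmod_ge0 // -sqrtr_sqr ler_wsqrtr // (bigD1 i) //=.
by rewrite lerDl sumr_ge0 // => j _; exact: sqr_ge0.
Qed.

Lemma l1norm_le_enorm z : l1norm z <= n%:R * enorm z.
Proof.
apply: le_trans (ler_sum _ (fun i _ => coord_le_enorm z i)) _.
by rewrite sumr_const card_ord mulr_natl.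
Qed.

Lemma sum_sqr_le (I : Type) (s : seq I) (a : I -> R) : (forall i, 0 <= a i) ->
  \sum_(i <- s) a i ^+ 2 <= (\sum_(i <- s) a i) ^+ 2.
Proof.
move=> a0; elim: s => [|i s IH]; first by rewrite !big_nil expr0n.
have S0 : 0 <= \sum_(j <- s) a j by apply: sumr_ge0.
rewrite !big_cons sqrrD; have := mulr_ge0 (a0 i) S0; move: IH; lra.
Qed.

Lemma enorm_le_l1norm z : enorm z <= l1norm z.
Proof.
rewrite -[leRHS]ger0_norm ?l1norm_ge0 // -sqrtr_sqr ler_wsqrtr //.
by apply: sum_sqr_le => i; exact: cmod_ge0.
Qed.

End L1Norm.

Section Link.
Variables (R : realType) (n : nat).
Local Notation C := R[i].
Implicit Types (f g : Cn R n -> C) (z v h : Cn R n).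

Lemma entire_cst (a : C) : entire (fun _ : Cn R n => a).
Proof. by move=> z; exact: differentiable_cst. Qed.

Lemma entire_coord i : entire (fun z : Cn R n => z ord0 i).
Proof. by move=> z; exact: differentiable_coord. Qed.

Lemma entireD f g : entire f -> entire g -> entire (fun z => f z + g z).
Proof. by move=> ef eg z; apply: differentiableD; [exact: ef|exact: eg]. Qed.

Lemma entireM f g : entire f -> entire g -> entire (fun z => f z * g z).
Proof. by move=> ef eg z; apply: differentiableM; [exact: ef|exact: eg]. Qed.

Lemma entire_sum (I : Type) (s : seq I) (F : I -> Cn R n -> C) :
  (forall i, entire (F i)) -> entire (fun z => \sum_(i <- s) F i z).
Proof.
move=> eF; elim: s => [|i s IH].
  by under eq_fun do rewrite big_nil; exact: entire_cst.
by under eq_fun do rewrite big_cons; exact: entireD.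
Qed.

Lemma normCE (c : C) : `|c| = (cmod c)%:C%C.
Proof. by []. Qed.

Lemma entire_cdiff f z v : entire f -> forall t,
  cdiff (fun t => f (z + t *: v)) t ('D_v f (z + t *: v)).
Proof.
move=> ef t e e0; set w := z + t *: v.
have : derivable f w v by apply: diff_derivable; exact: ef.
rewrite /derivable => /cvg_ex[/= l fl].
have {l fl} : h^-1 *: ((f \o shift w) (h *: v) - f w) @[h --> 0^'] --> 'D_v f w.
  by rewrite /derive (cvg_lim _ fl).
have eC : 0 < (e%:C)%C :> C by rewrite ltcR.
move=> /cvgrPdist_le/(_ _ eC); rewrite near_withinE => /nbhs_ballP[del /= del0 H].
have rdel : 0 < re del by move: del0; rewrite ltcE => /andP[].
exists (re del / 2); first by rewrite divr_gt0.
move=> h hd; have [->|h0] := eqVneq h 0.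
  by rewrite addr0 subrr mulr0 subr0 cmod0 mulr0.
have := H h; rewrite /ball /= sub0r normrN => /(_ _ h0).
have hdel : `|h| < del.
  rewrite normCE ltcE /=; apply/andP; split.
    by move: del0; rewrite ltcE => /andP[].
  by apply: le_lt_trans hd _; rewrite ltr_pdivrMr // mulr_natr mulr2n ltrDl.
move=> /(_ hdel); rewrite normCE lecR => He.
have -> : f (z + (t + h) *: v) - f w - 'D_v f w * h =
   - ('D_v f w - h^-1 * (f (h *: v + w) - f w)) * h.
  have -> : z + (t + h) *: v = h *: v + w by rewrite /w scalerDl addrA addrC.
  by rewrite opprB mulrBl mulrAC mulVf // mul1r.
by rewrite cmodM cmodN ler_wpM2r ?cmod_ge0.
Qed.

Lemma cdiff_unique (f : C -> C) t a b : cdiff f t a -> cdiff f t b -> a = b.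
Proof.
move=> fa fb; apply/eqP; rewrite -subr_eq0 -cmod_eq0 eq_le cmod_ge0 andbT.
apply: (@le_of_eps _ _ _ 2) => e e0; rewrite add0r.
have [d1 d10 H1] := fa _ e0; have [d2 d20 H2] := fb _ e0.
pose d := Num.min d1 d2; have d0 : 0 < d by rewrite lt_min d10.
have cd : cmod ((d%:C)%C : C) = d by rewrite cmod_real ger0_norm // ltW.
have := H1 (d%:C)%C; have := H2 (d%:C)%C; rewrite cd => h2 h1.
have {}h1 := h1 ltac:(by rewrite ge_min lexx). have {}h2 := h2 ltac:(by rewrite ge_min lexx orbT).
rewrite -(ler_pM2r d0) -[X in _ * X <= _]cd -cmodM.
have -> : (a - b) * (d%:C)%C = (f (t + (d%:C)%C) - f t - b * (d%:C)%C) - (f (t + (d%:C)%C) - f t - a * (d%:C)%C) by ring.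
by apply: le_trans (cmodB _ _) _; move: h1 h2; lra.
Qed.

Lemma derivative_sum f z v : entire f ->
  'D_v f z = \sum_(i < n) v ord0 i * partial i f z.
Proof.
move=> ef; have efz : differentiable f z by exact: ef.
rewrite deriveE //.
rewrite [in LHS](row_sum_delta v) linear_sum; apply: eq_bigr => i _.
by rewrite linearZ /= /partial deriveE.
Qed.

Lemma l1norm_le_norm h : ((l1norm h)%:C)%C <= n%:R * `|h|.
Proof.
have coord i : `|h ord0 i| <= `|h|.
  apply/ler_addgt0Pr => e e0.
  have : ball (0 : Cn R n) (`|h| + e) h by rewrite mx_norm_ball /ball_ /= sub0r normrN ltrDl.
  by move=> [_ /(_ ord0 i)]; rewrite /ball /= mxE sub0r normrN => /ltW.
rewrite /l1norm rmorph_sum /=; apply: le_trans (ler_sum _ (fun i _ => coord i)) _.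
by rewrite sumr_const card_ord mulr_natl.
Qed.

(** The way back from modulus estimates to differentiability: a linear
    approximation with a quadratic error is the differential. *)
Lemma differentiable_taylor f z (a : 'I_n -> C) (r K : R) : 0 < r ->
  (forall h, l1norm h <= r ->
     cmod (f (z + h) - f z - \sum_(i < n) h ord0 i * a i) <= K * l1norm h ^+ 2) ->
  differentiable f z.
Proof.
move=> r0 H.
pose L h : C := \sum_(i < n) h ord0 i * a i.
have Llin : linear L.
  move=> c u v; rewrite /L scaler_sumr -big_split /=; apply: eq_bigr => i _.
  by rewrite !mxE mulrDl /GRing.scale /= mulrA.
pose Lm := GRing.isLinear.Build _ _ _ _ L Llin.
pose LL : {linear Cn R n -> C} := HB.pack L Lm.
have Lcont : continuous LL.
  move=> x; apply: differentiable_continuous.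
  have : entire L by apply: entire_sum => i; apply: entireM; [exact: entire_coord|exact: entire_cst].
  exact.
have E (e : C) : 0 < e -> \forall h \near (0 : Cn R n), `|f (z + h) - f z - L h| <= e * `|h|.
  move=> e0.
  have eE : e = ((re e)%:C)%C by rewrite RRe_real // ger0_real // ltW.
  move: eE e0; move: (re e) => x ->; rewrite ltcR => x0 {e}.
  pose K' := `|K| + 1; have K'0 : 0 < K' by rewrite ltr_wpDl.
  pose d := Num.min r (x / K' / n.+1%:R).
  have d0 : 0 < d by rewrite lt_min r0 !divr_gt0.
  apply/nbhs_normP; exists ((d / n.+1%:R)%:C)%C => /=.
    by rewrite ltcR divr_gt0.
  move=> h; rewrite /= sub0r normrN => hd.
  have nmd : l1norm h <= d.
    rewrite -lecR; apply: le_trans (l1norm_le_norm h) _.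
    apply: (@le_trans _ _ (n.+1%:R * `|h|)); first by rewrite ler_wpM2r ?ler_nat.
    apply: (@le_trans _ _ (n.+1%:R * ((d / n.+1%:R)%:C)%C)).
      by rewrite ler_wpM2l // ltW.
    by rewrite -(rmorph_nat (real_complex R)) -rmorphM /= mulrC divfK // pnatr_eq0.
  have h1 : l1norm h <= r by rewrite (le_trans nmd) // ge_min lexx.
  have h2 : l1norm h <= x / K' / n.+1%:R by rewrite (le_trans nmd) // ge_min lexx orbT.
  rewrite normCE; apply: (@le_trans _ _ ((K * l1norm h ^+ 2)%:C)%C).
    by rewrite lecR; exact: H.
  apply: (@le_trans _ _ ((x / n.+1%:R)%:C%C * (l1norm h)%:C%C)).
    rewrite -rmorphM lecR expr2 mulrA ler_wpM2r ?l1norm_ge0 //.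
    apply: (@le_trans _ _ (K' * l1norm h)).
      by rewrite ler_wpM2r ?l1norm_ge0 // (le_trans (ler_norm _)) // lerDl.
    by rewrite mulrC -ler_pdivlMr // mulrAC.
  rewrite rmorphM fmorphV rmorph_nat -mulrA ler_wpM2l ?ler0c ?(ltW x0) //.
  rewrite ler_pdivrMl ?ltr0n //.
  by apply: le_trans (l1norm_le_norm h) _; rewrite ler_wpM2r ?ler_nat.
have D : 'd f z = LL :> (Cn R n -> C).
  apply: diff_unique Lcont _; apply/eqaddoP => e /E; apply: filterS => h.
  by rewrite -[X in _ -> `|X| <= _]/(f (h + z) - (f z + L h)) opprD addrA [h + z]addrC.
apply/diff_locallyP; rewrite D; split=> //; apply/eqaddoP => e /E; apply: filterS => h.
by rewrite -[X in _ -> `|X| <= _]/(f (h + z) - (f z + L h)) opprD addrA [h + z]addrC.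
Qed.

End Link.

(** * Limits of sequences of entire functions *)

Section ComplexSequences.
Variable R : realType.
Local Notation C := R[i].
Implicit Types (u v : nat -> C) (a b l : C).

Definition ccvg u l := forall e : R, 0 < e -> exists N : nat, forall m : nat,
  (N <= m)%N -> cmod (u m - l) <= e.

Lemma real_cauchy_ex (x : nat -> R) :
  (forall e : R, 0 < e -> exists N : nat, forall m : nat, (N <= m)%N -> `|x m - x N| <= e) ->
  exists l : R, forall e : R, 0 < e -> exists N : nat, forall m : nat, (N <= m)%N -> `|x m - l| <= e.
Proof.
move=> cx; pose S : set R := [set a | exists N : nat, forall m : nat, (N <= m)%N -> a <= x m].
have SP e N : (forall m : nat, (N <= m)%N -> `|x m - x N| <= e) ->
    S (x N - e) /\ ubound S (x N + e).
  move=> H; split; first by exists N => m /H; rewrite ler_norml => /andP[]; lra.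
  move=> a [K HK]; have := HK _ (leq_maxl K N); have := H _ (leq_maxr K N).
  by rewrite ler_norml => /andP[]; lra.
have hS : has_sup S.
  by have [N /SP[? ?]] := cx 1 ltr01; split; [exists (x N - 1)|exists (x N + 1)].
exists (sup S) => e e0; have [N HN] := cx _ (divr_gt0 e0 (ltr0n R 2)).
exists N => m /HN; have [s1 s2] := SP _ _ HN.
have := ub_le_sup hS.2 s1; have := ge_sup hS.1 s2.
by rewrite !ler_norml => ? ? /andP[? ?]; apply/andP; split; lra.
Qed.

Lemma ccauchy_ex u :
  (forall e : R, 0 < e -> exists N : nat, forall m : nat, (N <= m)%N -> cmod (u m - u N) <= e) ->
  exists l, ccvg u l.
Proof.
move=> cu.
have [a Ha] : exists l : R, forall e : R, 0 < e -> exists N : nat, forall m : nat, (N <= m)%N -> `|re (u m) - l| <= e.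
  apply: (real_cauchy_ex (x := fun m => re (u m))) => e /cu[N HN]; exists N => m /HN.
  by rewrite -ReB; apply: le_trans; exact: Re_le_cmod.
have [b Hb] : exists l : R, forall e : R, 0 < e -> exists N : nat, forall m : nat, (N <= m)%N -> `|im (u m) - l| <= e.
  apply: (real_cauchy_ex (x := fun m => im (u m))) => e /cu[N HN]; exists N => m /HN.
  by rewrite -ImB; apply: le_trans; exact: Im_le_cmod.
exists (Complex a b) => e e0; have e2 : 0 < e / 2 by rewrite divr_gt0.
have [N1 H1] := Ha _ e2; have [N2 H2] := Hb _ e2.
exists (maxn N1 N2) => m; rewrite geq_max => /andP[m1 m2].
apply: le_trans (cmod_le_ReIm _) _; rewrite ReB ImB /=.
have := H1 _ m1; have := H2 _ m2; lra.
Qed.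

Lemma ccvg_cst a : ccvg (fun=> a) a.
Proof. by move=> e e0; exists 0%N => m _; rewrite subrr cmod0 ltW. Qed.

Lemma ccvgD u v a b : ccvg u a -> ccvg v b -> ccvg (fun m => u m + v m) (a + b).
Proof.
move=> ua vb e e0; have e2 : 0 < e / 2 by rewrite divr_gt0.
have [N1 H1] := ua _ e2; have [N2 H2] := vb _ e2.
exists (maxn N1 N2) => m; rewrite geq_max => /andP[m1 m2].
rewrite (_ : _ - _ = (u m - a) + (v m - b)); last by rewrite addrACA opprD.
apply: le_trans (cmodD _ _) _; have := H1 _ m1; have := H2 _ m2; lra.
Qed.

Lemma ccvgMl c u a : ccvg u a -> ccvg (fun m => c * u m) (c * a).
Proof.
move=> ua e e0; have c0 : 0 < cmod c + 1 by rewrite ltr_wpDl ?cmod_ge0.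
have [N H] := ua _ (divr_gt0 e0 c0); exists N => m /H.
rewrite ler_pdivlMr // -mulrBr cmodM => h; apply: le_trans h.
by rewrite mulrC ler_wpM2l ?cmod_ge0 // lerDl.
Qed.

Lemma ccvgB u v a b : ccvg u a -> ccvg v b -> ccvg (fun m => u m - v m) (a - b).
Proof.
move=> ua /(ccvgMl (-1)) vb; have := ccvgD ua vb; rewrite mulN1r.
by under eq_fun do rewrite mulN1r.
Qed.

Lemma ccvg_sum (I : Type) (s : seq I) (u : I -> nat -> C) (a : I -> C) :
  (forall i, ccvg (u i) (a i)) ->
  ccvg (fun m => \sum_(i <- s) u i m) (\sum_(i <- s) a i).
Proof.
move=> H; elim: s => [|i s IH].
  by rewrite big_nil; under eq_fun do rewrite big_nil; exact: ccvg_cst.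
by rewrite big_cons; under eq_fun do rewrite big_cons; exact: ccvgD.
Qed.

Lemma ccvg_le u a (B : R) : ccvg u a -> (forall m, cmod (u m) <= B) -> cmod a <= B.
Proof.
move=> ua uB; apply: (@le_of_eps _ _ _ 1) => e e0; have [N H] := ua _ e0.
have -> : a = u N - (u N - a) by rewrite opprB addrC subrK.
by apply: le_trans (cmodB _ _) _; rewrite mul1r lerD // H.
Qed.

Lemma ccvg_unique u a b : ccvg u a -> ccvg u b -> a = b.
Proof.
move=> ua ub; apply/eqP; rewrite -subr_eq0 -cmod_eq0 eq_le cmod_ge0 andbT.
by apply: ccvg_le (ccvgB ua ub) _ => m; rewrite subrr cmod0.
Qed.

Lemma ccvg_geometric u a (K : R) : (forall m, cmod (u m - a) <= K / 2 ^+ m) -> ccvg u a.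
Proof.
move=> H e e0; have [N HN] := ex_nat_ge (K / e).
exists N => m Nm; apply: le_trans (H m) _.
rewrite ler_pdivrMr ?exprn_gt0 // mulrC -ler_pdivrMr //; apply: (le_trans HN).
by rewrite -natrX ler_nat (leq_trans Nm) // ltnW // ltn_expl.
Qed.

End ComplexSequences.

Section SeveralVariables.
Variables (R : realType) (n : nat).
Local Notation C := R[i].
Local Notation rc := (fun a : R => (a%:C)%C).
Implicit Types (f g : Cn R n -> C) (z v h w : Cn R n).

Definition loc_bounded g := forall rho : R, exists M : R,
  forall z, l1norm z <= rho -> cmod (g z) <= M.

(** The one-variable estimate on the complex line through [z] in the direction
    of [h]; the disc available in the parameter has radius [3 / |h|]. *)
Lemma entire_taylor2 g z h (M : R) : entire g ->
  (forall w, l1norm (w - z) <= 3 -> cmod (g w) <= M) -> l1norm h <= 1 ->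
  cmod (g (z + h) - g z - 'D_h g z) <= 4 * M * l1norm h ^+ 2.
Proof.
move=> eg gM h1; have [h0|h0] := eqVneq (l1norm h) 0.
  rewrite (l1norm_eq0 h0) addr0 subrr derivative_sum // big1 ?subrr ?cmod0 ?l1norm0 ?expr0n ?mulr0 //.
  by move=> i _; rewrite mxE mul0r.
have hp : 0 < l1norm h by rewrite lt_def h0 l1norm_ge0.
have r0 : 0 < (l1norm h)^-1 by rewrite invr_gt0.
have := @taylor2 R (fun t => g (z + t *: h)) (fun t => 'D_h g (z + t *: h)) 0 1 _ M r0
  (entire_cdiff z h eg).
rewrite add0r scale1r scale0r addr0 mulr1 cmod1 expr1n mulr1 exprVn invrK; apply.
  move=> t; rewrite subr0 ler_pdivlMr // => t3; apply: gM.
  by rewrite addrAC subrr add0r l1normZ.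
by rewrite invf_ge1.
Qed.

Lemma entire_cauchy g z i (r M : R) : 0 < r -> entire g ->
  (forall t, cmod t <= r -> cmod (g (z + t *: delta_mx ord0 i)) <= M) ->
  cmod (partial i g z) <= 2 * M / r.
Proof.
move=> r0 eg gM.
have := @cauchy_deriv R (fun t => g (z + t *: delta_mx ord0 i))
  (fun t => partial i g (z + t *: delta_mx ord0 i)) 0 r M r0.
rewrite scale0r addr0; apply; first exact: entire_cdiff.
by move=> t; rewrite subr0; exact: gM.
Qed.

(** Pointwise convergence and local boundedness suffice: the quadratic Taylor
    remainders are uniform, which makes the first derivatives converge. *)
Lemma entire_limit (g : nat -> Cn R n -> C) G : (forall m, entire (g m)) ->
  (forall rho : R, exists M : R, forall m z, l1norm z <= rho -> cmod (g m z) <= M) ->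
  (forall z, ccvg (g^~ z) (G z)) -> entire G.
Proof.
move=> eg bg gG z.
have [M0 HM0] := bg (l1norm z + 3); pose M := Num.max M0 0.
have M_ge0 : 0 <= M by rewrite le_max lexx orbT.
have gM m w : l1norm (w - z) <= 3 -> cmod (g m w) <= M.
  move=> wz; rewrite le_max HM0 // -(subrK z w); apply: le_trans (l1normD _ _) _.
  by rewrite addrC lerD2l.
have T m h : l1norm h <= 1 -> cmod (g m (z + h) - g m z - 'D_h (g m) z) <= 4 * M * l1norm h ^+ 2.
  by move=> h1; apply: entire_taylor2 => //; exact: gM.
(* The difference quotients of step [t] differ from the partial derivatives by
   at most [4 M t], uniformly in [m]; hence the latter form a Cauchy sequence. *)
have [a Ha] : exists a : 'I_n -> C, forall i, ccvg (fun m => partial i (g m) z) (a i).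
  suff H : forall i, exists a, ccvg (fun m => partial i (g m) z) a.
    by exists (fun i => projT1 (cid (H i))) => i; exact: projT2 (cid (H i)).
  move=> i; apply: ccauchy_ex => e e0.
  pose t : R := Num.min 1 (e / (16 * M + 1)).
  have D0 : 0 < 16 * M + 1 by rewrite ltr_wpDl // mulr_ge0.
  have t0 : 0 < t by rewrite lt_min ltr01 divr_gt0.
  have t1 : t <= 1 by rewrite ge_min lexx.
  have te : t * (16 * M + 1) <= e by rewrite -ler_pdivlMr // ge_min lexx orbT.
  have e8 : 0 < e * t / 8 by rewrite !(mulr_gt0, divr_gt0).
  pose h : Cn R n := rc t *: delta_mx ord0 i.
  have nh : l1norm h = t by rewrite l1normZ l1norm_delta mulr1 cmod_real ger0_norm // ltW.
  have Dh m : 'D_h (g m) z = rc t * partial i (g m) z.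
    rewrite derivative_sum // (bigD1 i) //= big1 ?addr0; last first.
      by move=> j ji; rewrite !mxE (negbTE ji) andbF mulr0 mul0r.
    by rewrite !mxE !eqxx mulr1.
  have [N1 H1] := gG (z + h) _ e8; have [N2 H2] := gG z _ e8.
  exists (maxn N1 N2) => m Nm; set N := maxn N1 N2 in Nm *.
  have := T m h; have := T N h; rewrite nh !Dh => /(_ t1) TN /(_ t1) Tm.
  move: Nm; rewrite geq_max => /andP[m1 m2].
  have := H1 _ m1; have := H2 _ m2; have := H1 _ (leq_maxl N1 N2); have := H2 _ (leq_maxr N1 N2).
  rewrite -/N => a1 a2 a3 a4.
  rewrite -(ler_pM2l t0) -{1}[t]ger0_norm ?(ltW t0) // -cmod_real -cmodM.
  set Pm := partial i (g m) z in Tm *; set PN := partial i (g N) z in TN *.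
  have -> : rc t * (Pm - PN) = (g N (z + h) - g N z - rc t * PN) - (g m (z + h) - g m z - rc t * Pm)
     + ((g m (z + h) - G (z + h)) - (g m z - G z)) - ((g N (z + h) - G (z + h)) - (g N z - G z)) by ring.
  apply: le_trans (cmodB _ _) _.
  apply: le_trans (lerD (cmodD _ _) (cmodB _ _)) _.
  apply: le_trans (lerD (lerD (cmodB _ _) (cmodB _ _)) (lexx _)) _.
  apply: le_trans (lerD (lerD (lerD TN Tm) (lerD a4 a3)) (lerD a2 a1)) _.
  have q1 : t * (t * (16 * M + 1)) <= t * e by rewrite ler_pM2l.
  have q2 := mulr_gt0 t0 t0.
  clear -q1 q2; rewrite expr2; lra.
apply: (differentiable_taylor (a := a) (r := 1) (K := 4 * M)) => // h h1.
have H : ccvg (fun m => g m (z + h) - g m z - \sum_(i < n) h ord0 i * partial i (g m) z)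
    (G (z + h) - G z - \sum_(i < n) h ord0 i * a i).
  by apply: ccvgB; [exact: ccvgB|apply: ccvg_sum => i; exact: ccvgMl].
by apply: ccvg_le H _ => m; rewrite -derivative_sum //; exact: T.
Qed.

Lemma entire_shift f v : entire f -> entire (fun z => f (z + v)).
Proof.
move=> ef z; apply: (@differentiable_comp _ _ _ _ (fun z : Cn R n => z + v) f); last exact: ef.
exact: differentiableD.
Qed.

Definition entire_bd g := entire g /\ loc_bounded g.

(** Difference quotients are entire, and by the quadratic remainder they are
    locally bounded and converge to the partial derivative. *)
Lemma partial_entire_bd i f : entire_bd f -> entire_bd (partial i f).
Proof.
move=> [ef bf]; pose e : Cn R n := delta_mx ord0 i.
have bdf (rho : R) : exists2 M : R, 0 <= M & forall z, l1norm z <= rho ->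
    cmod (partial i f z) <= 2 * M /\
    forall t, 0 < t <= 1 -> cmod ((f (z + rc t *: e) - f z) / rc t - partial i f z) <= 4 * M * t.
  have [M0 HM0] := bf (rho + 3); pose M := Num.max M0 0.
  have M_ge0 : 0 <= M by rewrite le_max lexx orbT.
  have fM z w : l1norm z <= rho -> l1norm (w - z) <= 3 -> cmod (f w) <= M.
    move=> zr wz; rewrite le_max HM0 // -(subrK z w); apply: le_trans (l1normD _ _) _.
    by rewrite addrC lerD.
  exists M => // z zr; split.
    rewrite -[leRHS]divr1; apply: entire_cauchy => // t t1; apply: fM zr _.
    rewrite addrAC subrr add0r l1normZ l1norm_delta mulr1 (le_trans t1) //; lra.
  move=> t /andP[t0 t1].
  have nh : l1norm (rc t *: e) = t by rewrite l1normZ l1norm_delta mulr1 cmod_real ger0_norm // ltW.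
  have t0c : rc t != 0 by rewrite -cmod_gt0 cmod_real ger0_norm // ltW.
  have := @entire_taylor2 f z (rc t *: e) M ef (fun w => fM z w zr); rewrite nh => /(_ t1).
  have -> : 'D_(rc t *: e) f z = rc t * partial i f z.
    rewrite derivative_sum // (bigD1 i) //= big1 ?addr0; last first.
      by move=> j ji; rewrite !mxE (negbTE ji) andbF mulr0 mul0r.
    by rewrite !mxE !eqxx mulr1.
  have -> : (f (z + rc t *: e) - f z) / rc t - partial i f z =
     (f (z + rc t *: e) - f z - rc t * partial i f z) / rc t.
    by rewrite [RHS]mulrBl mulrAC divff // mul1r.
  by rewrite cmodM cmodV cmod_real ger0_norm ?(ltW t0) // ler_pdivrMr // expr2 mulrA.
split; last first.
  by move=> rho; have [M M0 H] := bdf rho; exists (2 * M) => z /H[].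
pose t (m : nat) : R := m.+1%:R^-1.
have t01 m : 0 < t m <= 1 by rewrite invr_gt0 ltr0n /= invf_le1 ?ltr0n // ler1n.
apply: (@entire_limit (fun m z => (f (z + rc (t m) *: e) - f z) / rc (t m))).
- move=> m; apply: entireM; last exact: entire_cst.
  apply: entireD; first exact: entire_shift.
  by under eq_fun do rewrite -mulN1r; apply: entireM => //; exact: entire_cst.
- move=> rho; have [M M0 H] := bdf rho; exists (4 * M + 2 * M) => m z /H[H1 H2].
  rewrite -(subrK (partial i f z) (_ / _)); apply: le_trans (cmodD _ _) _.
  apply: lerD => //; apply: le_trans (H2 _ (t01 m)) _.
  by have /andP[_ t1] := t01 m; rewrite ler_piMr // mulr_ge0.
- move=> z; have [M M0 H] := bdf (l1norm z); have [_ {}H] := H z (lexx _).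
  move=> eps eps0; have [N HN] := ex_nat_ge (4 * M / eps).
  exists N => m Nm; apply: le_trans (H _ (t01 m)) _.
  rewrite ler_pdivrMr ?ltr0n // [eps * _]mulrC -ler_pdivrMr // (le_trans HN) // ler_nat.
  exact: leq_trans Nm (leqnSn _).
Qed.

Definition partials (l : seq 'I_n) f := foldr (@partial R n) f l.

Lemma partials_entire_bd l f : entire_bd f -> entire_bd (partials l f).
Proof. by move=> bf; elim: l => //= i l IH; exact: partial_entire_bd. Qed.

(** Each derivative costs a step of length [r], so that a word of length [k]
    needs a ball of radius [k r]; choosing [r] of the form [rho / k] recovers the
    usual estimate up to a factor [c^k]. *)
Lemma partials_cauchy l f z (r M : R) : 0 < r -> entire_bd f ->
  (forall w, l1norm (w - z) <= (size l)%:R * r -> cmod (f w) <= M) ->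
  cmod (partials l f z) <= (2 / r) ^+ size l * M.
Proof.
move=> r0 bf; elim: l z => [|i l IH] z fM /=.
  by rewrite expr0 mul1r; apply: fM; rewrite mul0r subrr l1norm0.
have [el _] := partials_entire_bd l bf.
rewrite exprS; have -> : 2 / r * (2 / r) ^+ size l * M = 2 * ((2 / r) ^+ size l * M) / r.
  by rewrite [2 / r * _]mulrAC -!mulrA; congr (2 * _); rewrite mulrCA mulrC mulrA.
apply: entire_cauchy => // t tr; apply: IH => w wz; apply: fM.
have -> : w - z = (w - (z + t *: delta_mx ord0 i)) + t *: delta_mx ord0 i.
  by rewrite opprD addrA subrK.
apply: le_trans (l1normD _ _) _; rewrite l1normZ l1norm_delta mulr1 -[(size _)%:R]natr1 mulrDl mul1r.
exact: lerD.
Qed.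

Definition word (alpha : mindex n) : seq 'I_n :=
  flatten [seq nseq (alpha i) i | i <- enum 'I_n].

Lemma foldr_nseq (T S : Type) (op : T -> S -> S) k i x :
  foldr op x (nseq k i) = iter k (op i) x.
Proof. by elim: k => //= k ->. Qed.

Lemma foldr_word (S : Type) (op : 'I_n -> S -> S) (alpha : mindex n) x :
  foldr (fun i => iter (alpha i) (op i)) x (enum 'I_n) = foldr op x (word alpha).
Proof.
by rewrite /word; elim: (enum 'I_n) => //= i s ->; rewrite foldr_cat foldr_nseq.
Qed.

Lemma mpartial_word alpha f : mpartial alpha f = partials (word alpha) f.
Proof. exact: foldr_word. Qed.

Lemma size_word alpha : size (word alpha) = mdeg alpha.
Proof.
rewrite /word size_flatten /shape -map_comp sumnE big_map /mdeg -big_enum /=.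
by apply: eq_bigr => i _; rewrite size_nseq.
Qed.

Lemma mpartial_entire_bd alpha f : entire_bd f -> entire_bd (mpartial alpha f).
Proof. by rewrite mpartial_word; exact: partials_entire_bd. Qed.

End SeveralVariables.

(** * Taylor expansion in several variables *)

Lemma pow_le_fact_exp (R : realType) (y : R) k : 0 <= y -> y ^+ k <= k`!%:R * expR y.
Proof.
case: k => [|k] y0; first by rewrite expr0 fact0 mul1r (le_trans _ (expR_ge1Dx y)) // lerDl.
have f0 : 0 < (k.+1)`!%:R :> R by rewrite ltr0n fact_gt0.
rewrite mulrC -ler_pdivrMr //; apply: le_trans (expR_ge1Dxn k y0).
by rewrite lerDr.
Qed.

Lemma sum_geometric_half (R : realType) N (x : R) : 0 <= x ->
  \sum_(a < N) x / 2 ^+ a <= 2 * x.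
Proof.
move=> x0; suff -> : \sum_(a < N) x / 2 ^+ a = 2 * x - 2 * x / 2 ^+ N.
  by rewrite gerBl divr_ge0 ?mulr_ge0 ?exprn_ge0.
elim: N => [|N IH]; first by rewrite big_ord0 expr0 divr1 subrr.
rewrite big_ord_recr /= IH half_expn; lra.
Qed.

Section Taylor.
Variables (R : realType) (n : nat).
Local Notation C := R[i].
Local Notation rc := (fun a : R => (a%:C)%C).
Implicit Types (f g : Cn R n -> C) (z v h w : Cn R n) (l : seq 'I_n).
#[local] Opaque partial.

Lemma partial_lin i (a : C) f g z : entire f -> entire g ->
  partial i (fun z => a * f z + g z) z = a * partial i f z + partial i g z.
Proof.
move=> ef eg; pose e : Cn R n := delta_mx ord0 i.
have eh : entire (fun z => a * f z + g z).
  by apply: entireD => //; apply: entireM => //; exact: entire_cst.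
have H := entire_cdiff z e eh 0.
have := cdiffD (cdiffM (cdiff_cst a 0) (entire_cdiff z e ef 0)) (entire_cdiff z e eg 0).
rewrite mul0r add0r => /(cdiff_unique H); rewrite scale0r addr0; exact.
Qed.

Lemma entire_bd_lin (a : C) f g : entire_bd f -> entire_bd g -> entire_bd (fun z => a * f z + g z).
Proof.
move=> [ef bf] [eg bg]; split.
  by apply: entireD => //; apply: entireM => //; exact: entire_cst.
move=> rho; have [M HM] := bf rho; have [N HN] := bg rho.
exists (cmod a * M + N) => z zr; apply: le_trans (cmodD _ _) _; rewrite cmodM.
by apply: lerD; [rewrite ler_wpM2l ?cmod_ge0 // HM|exact: HN].
Qed.

Lemma partials_lin l (a : C) f g : entire_bd f -> entire_bd g ->
  partials l (fun z => a * f z + g z) = (fun z => a * partials l f z + partials l g z).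
Proof.
move=> bf bg; elim: l => [//|i l IH]; rewrite /partials /= -!/(partials _ _) IH.
apply/funext => z; apply: partial_lin; [exact: (partials_entire_bd l bf).1|exact: (partials_entire_bd l bg).1].
Qed.

Lemma entire_bd0 : entire_bd (fun _ : Cn R n => 0 : C).
Proof. by split; [exact: entire_cst|move=> rho; exists 0 => z _; rewrite cmod0]. Qed.

Lemma entire_bd_shift f v : entire_bd f -> entire_bd (fun z => f (z + v)).
Proof.
move=> [ef bf]; split; first exact: entire_shift.
move=> rho; have [M HM] := bf (rho + l1norm v); exists M => z zr; apply: HM.
by apply: le_trans (l1normD _ _) _; rewrite lerD2r.
Qed.

Lemma partials0 l : partials l (fun _ : Cn R n => 0 : C) = (fun _ => 0).
Proof.
have := partials_lin l (-1) entire_bd0 entire_bd0.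
have -> : (fun z : Cn R n => -1 * (fun=> 0) z + (fun=> 0) z) = (fun=> 0) :> (Cn R n -> C).
  by apply/funext => z; rewrite mulr0 add0r.
by move=> ->; apply/funext => z; rewrite mulN1r addNr.
Qed.

Lemma partials_sum (I : Type) (s : seq I) (P : pred I) l (c : I -> C) (F : I -> Cn R n -> C) :
  (forall x, entire_bd (F x)) ->
  entire_bd (fun z => \sum_(x <- s | P x) F x z * c x) /\
  partials l (fun z => \sum_(x <- s | P x) F x z * c x)
    = (fun z => \sum_(x <- s | P x) partials l (F x) z * c x).
Proof.
move=> bF; elim: s => [|x s [IHb IH]].
  have -> : (fun z => \sum_(x <- [::] | P x) F x z * c x) = (fun _ => 0 : C).
    by apply/funext => z; rewrite big_nil.
  split; first exact: entire_bd0.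
  by rewrite partials0; apply/funext => z; rewrite big_nil.
case Px : (P x); last first.
  rewrite (_ : (fun z => \sum_(y <- x :: s | P y) F y z * c y) = fun z => \sum_(y <- s | P y) F y z * c y).
    by split=> //; rewrite IH; apply/funext => z; rewrite big_cons Px.
  by apply/funext => z; rewrite big_cons Px.
have -> : (fun z => \sum_(y <- x :: s | P y) F y z * c y) =
    (fun z => c x * F x z + (fun z => \sum_(y <- s | P y) F y z * c y) z).
  by apply/funext => z; rewrite big_cons Px mulrC.
split; first exact: entire_bd_lin.
rewrite partials_lin // IH; apply/funext => z.
by rewrite big_cons Px [c x * _]mulrC.
Qed.

Variables (h : Cn R n).
Let c (i : 'I_n) (a : nat) : C := h ord0 i ^+ a / a`!%:R.

(** Taylor polynomials of order [N] taken successively in the variables [s],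
    as an operator on functions. *)
Fixpoint taylor_op (N : nat) (s : seq 'I_n) f : Cn R n -> C :=
  if s is i :: s' then
    fun z => \sum_(a < N) partials (nseq a i) (taylor_op N s' f) z * c i a
  else f.

Definition hshift (s : seq 'I_n) : Cn R n := \sum_(i <- s) h ord0 i *: delta_mx ord0 i.

Lemma taylor_op_entire_bd N s f : entire_bd f -> entire_bd (taylor_op N s f).
Proof.
move=> bf; elim: s => [//|i s IH] /=.
suff H : forall x : 'I_N, entire_bd (partials (nseq x i) (taylor_op N s f)).
  exact: (partials_sum (index_enum _) predT [::] (fun x : 'I_N => c i x) H).1.
by move=> a; exact: partials_entire_bd.
Qed.

(** The steps have length [rho / a], and [a^a <= a! e^a]. *)
Lemma cauchy_fact a i g z (rho M : R) : 0 < rho -> entire_bd g ->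
  (forall w, l1norm (w - z) <= rho -> cmod (g w) <= M) ->
  cmod (partials (nseq a i) g z) <= (2 * expR 1 / rho) ^+ a * a`!%:R * M.
Proof.
move=> rho0 bg gM.
have M0 : 0 <= M by apply: le_trans (cmod_ge0 _) (gM z _); rewrite subrr l1norm0 ltW.
case: a => [|a]; first by rewrite expr0 fact0 !mul1r; apply: gM; rewrite subrr l1norm0 ltW.
have a0 : 0 < a.+1%:R :> R by rewrite ltr0n.
have := @partials_cauchy R n (nseq a.+1 i) g z (rho / a.+1%:R) M.
rewrite size_nseq [a.+1%:R * _]mulrC divfK ?gt_eqF // => /(_ (divr_gt0 rho0 a0) bg gM) H.
apply: le_trans H _; rewrite ler_wpM2r //.
have -> : 2 / (rho / a.+1%:R) = (2 / rho) * a.+1%:R by rewrite invfM invrK mulrA.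
have -> : 2 * expR 1 / rho = (2 / rho) * expR 1 by rewrite mulrAC.
rewrite exprMn [leRHS]mulrC [in leRHS]exprMn mulrCA ler_wpM2l ?exprn_ge0 ?divr_ge0 ?(ltW rho0) //.
have := pow_le_fact_exp a.+1 (ltW a0); rewrite -expRM_natl mulr1; exact.
Qed.

(** Replacing one variable at a time: the error splits into the one-variable
    remainder in the first variable and the first Taylor operator applied to the
    error in the others.  With [D] this large each term of order [a] is at most
    [M / 2^a]. *)
Lemma taylor_op_remainder N (s : seq 'I_n) f z (D M : R) : entire_bd f ->
  8 * expR 1 * (l1norm h + 1) <= D ->
  (forall w, l1norm (w - z) <= (size s)%:R * D -> cmod (f w) <= M) ->
  cmod (f (z + hshift s) - taylor_op N s f z) <= (2 ^+ size s - 1) * (M / 2 ^+ N).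
Proof.
move=> bf hD; have h0 := l1norm_ge0 h; have E0 := @expR_gt0 R 1.
have E1 : 1 <= expR 1 :> R by rewrite (le_trans _ (expR_ge1Dx 1)) // lerDl.
pose rho : R := 4 * expR 1 * (l1norm h + 1).
have rho0 : 0 < rho by rewrite !mulr_gt0 // ltr_wpDl.
have rhoD : rho + l1norm h <= D.
  apply: le_trans hD; rewrite /rho; have : l1norm h <= expR 1 * l1norm h by rewrite ler_peMl.
  move: E0; lra.
have rD : rho <= D by apply: le_trans rhoD; rewrite lerDl.
have D0 : 0 <= D by apply: ltW; exact: lt_le_trans rD.
have small i : cmod (h ord0 i) * (2 * expR 1 / rho) <= 1 / 2.
  have -> : 2 * expR 1 / rho = 1 / 2 / (l1norm h + 1).
    by rewrite /rho; field; rewrite (gt_eqF E0) gt_eqF // ltr_wpDl.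
  rewrite mulrCA -[leRHS]mulr1 ler_wpM2l // ler_pdivrMr ?mul1r ?ltr_wpDl //.
  by apply: le_trans (coord_le_l1norm h i) _; rewrite lerDl.
clearbody rho.
have qb a i (K : R) : 0 <= K ->
    (2 * expR 1 / rho) ^+ a * (a`!)%:R * K * (cmod (h ord0 i) ^+ a / (a`!)%:R) <= K / 2 ^+ a.
  move=> K0; have f0 : (a`!)%:R != 0 :> R by rewrite pnatr_eq0 -lt0n fact_gt0.
  have -> : (2 * expR 1 / rho) ^+ a * (a`!)%:R * K * (cmod (h ord0 i) ^+ a / (a`!)%:R) =
      K * (cmod (h ord0 i) * (2 * expR 1 / rho)) ^+ a.
    by move: (_ / rho) (cmod _) f0 => q m f0; rewrite exprMn; move: (q ^+ a) (m ^+ a) => x y; field.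
  rewrite ler_wpM2l // -exprVn lerXn2r ?nnegrE ?invr_ge0 //.
    by rewrite mulr_ge0 ?cmod_ge0 // divr_ge0 ?(ltW rho0) // mulr_ge0 // ltW.
  by rewrite -[2^-1]div1r.
have cbound a i (K : R) g w : entire_bd g -> 0 <= K -> (forall u, l1norm (u - w) <= rho -> cmod (g u) <= K) ->
    cmod (partials (nseq a i) g w) * (cmod (h ord0 i) ^+ a / a`!%:R) <= K / 2 ^+ a.
  move=> bg K0 gK; apply: le_trans (qb a i K K0).
  rewrite ler_wpM2r ?divr_ge0 ?exprn_ge0 ?cmod_ge0 //.
  exact: cauchy_fact.
elim: s z => [|i s IH] z fM.
  by rewrite /hshift big_nil addr0 subrr cmod0 expr0 subrr mul0r.
have M0 : 0 <= M.
  by apply: le_trans (cmod_ge0 _) (fM z _); rewrite subrr l1norm0 mulr_ge0.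
pose G w := f (w + hshift s); pose T := taylor_op N s f.
have bG : entire_bd G by exact: entire_bd_shift.
have bT : entire_bd T by exact: taylor_op_entire_bd.
have nshift (u : seq 'I_n) : l1norm (hshift u) <= (size u)%:R * l1norm h.
  rewrite /hshift; elim: u => [|j u IHu]; first by rewrite big_nil l1norm0 mul0r.
  rewrite big_cons; apply: le_trans (l1normD _ _) _; rewrite -natr1 mulrDl mul1r addrC.
  by rewrite lerD // l1normZ l1norm_delta mulr1 coord_le_l1norm.
have szE : (size (i :: s))%:R = (size s)%:R + 1 :> R by rewrite /= -natr1.
have GT w : l1norm (w - z) <= D -> cmod (G w - T w) <= (2 ^+ size s - 1) * (M / 2 ^+ N).
  move=> wz; apply: IH => u uw; apply: fM; rewrite szE mulrDl mul1r.
  by rewrite -(subrK w u) -addrA; apply: le_trans (l1normD _ _) _; rewrite lerD.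
have hD' : l1norm h <= D by apply: le_trans rhoD; rewrite lerDr ltW.
have GM w : l1norm (w - z) <= D -> cmod (G w) <= M.
  move=> wz; apply: fM; rewrite szE mulrDl mul1r addrAC.
  apply: le_trans (l1normD _ _) _; rewrite [leRHS]addrC lerD //.
  by apply: le_trans (nshift s) _; rewrite ler_wpM2l.
have -> : f (z + hshift (i :: s)) - taylor_op N (i :: s) f z =
   (G (z + h ord0 i *: delta_mx ord0 i) - \sum_(a < N) partials (nseq a i) G z * c i a) +
   \sum_(a < N) partials (nseq a i) (fun w => (-1) * T w + G w) z * c i a.
  have -> : f (z + hshift (i :: s)) = G (z + h ord0 i *: delta_mx ord0 i).
    by rewrite /G /hshift big_cons addrA.
  rewrite -addrA; congr (_ + _); rewrite /= -sumrN -sumrN -big_split /=.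
  apply: eq_bigr => a _; rewrite partials_lin //.
  by rewrite mulN1r mulrDl mulNr addrC -addrA addrN addr0.
apply: le_trans (cmodD _ _) _.
have P0 : 0 <= (2 ^+ size s - 1) * (M / 2 ^+ N).
  rewrite mulr_ge0 ?divr_ge0 ?exprn_ge0 // subr_ge0 exprn_ege1 //; lra.
apply: (@le_trans _ _ (M / 2 ^+ N + 2 * ((2 ^+ size s - 1) * (M / 2 ^+ N)))); last first.
  rewrite [size _]/= [2 ^+ (size s).+1]exprS; move: (M / 2 ^+ N) (2 ^+ size s) => x y.
  by apply: le_of_eq; ring.
apply: lerD.
  pose Dv (a : nat) (t : C) := partials (nseq a i) G (z + t *: delta_mx ord0 i).
  have dDv a t : cdiff (Dv a) t (Dv a.+1 t).
    exact: (entire_cdiff z (delta_mx ord0 i) (partials_entire_bd (nseq a i) bG).1).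
  have := @taylor_remainder R Dv 0 N (h ord0 i) ((2 * expR 1 / rho) ^+ N * (N`!)%:R * M) dDv.
  rewrite /Dv add0r /= scale0r addr0 => T'.
  apply: le_trans (qb N i M M0); apply: T' => t t01.
  rewrite add0r; apply: cauchy_fact => // u uw; apply: GM.
  have -> : u - z = (u - (z + rc t * h ord0 i *: delta_mx ord0 i)) + rc t * h ord0 i *: delta_mx ord0 i.
    by rewrite opprD addrA subrK.
  apply: le_trans (l1normD _ _) _; apply: le_trans rhoD; rewrite lerD //.
  rewrite l1normZ l1norm_delta mulr1; apply: le_trans (segment_in_ball t01 (lexx _)) _.
  exact: coord_le_l1norm.
apply: le_trans (cmod_sum _ _ _) _.
apply: le_trans (sum_geometric_half N P0); apply: ler_sum => a _.
rewrite cmodM [cmod (c i a)]cmodM cmodX cmodV cmod_nat; apply: cbound => //.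
  exact: entire_bd_lin.
by move=> u uz; rewrite mulN1r addrC; apply: GT; apply: le_trans rD.
Qed.

End Taylor.

Section Cubes.
Variables (R : realType) (n : nat).
Local Notation C := R[i].
Implicit Types (f : Cn R n -> C) (z h : Cn R n) (s : seq 'I_n).
#[local] Opaque partial.

(** Sums over cubes factor into one-variable sums, and exhaust every absolutely
    convergent sum over multi-indices. *)
Definition cube (N : nat) : seq (mindex n) :=
  [seq [ffun i => (a i : nat)] | a : {ffun 'I_n -> 'I_N.+1}].

Lemma sum_cube_ffun (V : zmodType) N (F : mindex n -> V) :
  \sum_(alpha <- cube N) F alpha =
  \sum_(a : {ffun 'I_n -> 'I_N.+1}) F [ffun i => (a i : nat)].
Proof. by rewrite /cube big_image. Qed.

Lemma mem_cube N (alpha : mindex n) : (forall i, (alpha i <= N)%N) -> alpha \in cube N.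
Proof.
move=> H; rewrite /cube; apply/fintype.imageP; exists [ffun i => inord (alpha i)] => //.
by apply/ffunP => i; rewrite !ffunE inordK // ltnS.
Qed.

Lemma cube_uniq N : uniq (cube N).
Proof.
rewrite map_inj_uniq ?enum_uniq // => a b /ffunP ab.
by apply/ffunP => i; apply/val_inj; have := ab i; rewrite !ffunE.
Qed.

Definition word_on s (a : 'I_n -> nat) : seq 'I_n := flatten [seq nseq (a i) i | i <- s].

Lemma eq_word_on s (a b : 'I_n -> nat) : {in s, a =1 b} -> word_on s a = word_on s b.
Proof. by move=> ab; congr flatten; apply/eq_in_map => i /ab ->. Qed.

Definition update N (a : {ffun 'I_n -> 'I_N.+1}) i (k : 'I_N.+1) : {ffun 'I_n -> 'I_N.+1} :=
  [ffun j => if j == i then k else a j].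

(** Nested sums are sums over functions [a] supported in [s]; the induction step
    splits [a] into its value at the new variable and the rest. *)
Lemma taylor_op_word_on h N s f : uniq s -> entire_bd f -> taylor_op h N.+1 s f = (fun z =>
  \sum_(a : {ffun 'I_n -> 'I_N.+1} | [forall i, (i \in s) || (a i == ord0)])
    partials (word_on s (fun i => a i)) f z * \prod_(i <- s) (h ord0 i ^+ a i / (a i)`!%:R)).
Proof.
elim: s => [|i s IH] us bf.
  apply/funext => z; rewrite (big_pred1 [ffun=> ord0]) => [|a]; first by rewrite big_nil mulr1.
  apply/forallP/eqP => [H|-> j]; last by rewrite ffunE eqxx.
  by apply/ffunP => j; rewrite ffunE; apply/eqP; exact: H.
move: us => /= /andP[iNs us]; have {}IH := IH us bf.
apply/funext => z.
under eq_bigr => k _.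
  rewrite IH (partials_sum _ _ _ _ _).2; last by move=> a; exact: partials_entire_bd.
  rewrite mulr_suml; over.
rewrite pair_big_dep /=.
rewrite (reindex_onto (fun p : 'I_N.+1 * {ffun 'I_n -> 'I_N.+1} => update p.2 i p.1)
   (fun a => (a i, update a i ord0))) /=; last first.
  move=> a _; apply/ffunP => j; rewrite !ffunE; case: eqP => [->|//].
  by [].
apply: eq_big => [[k a]|[k a] _] /=.
  apply/forallP/andP => [H|[/forallP H /eqP[_ E]] j].
    split; first by apply/forallP => j; rewrite ffunE inE; case: eqP => //= _; exact: H.
    apply/eqP; congr (_, _); first by rewrite ffunE eqxx.
    apply/ffunP => j; rewrite !ffunE; case: eqP => [->|//].
    by have := H i; rewrite (negbTE iNs) => /eqP.
  have := H j; rewrite ffunE inE; case: eqP => //= -> _.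
  by rewrite -E ffunE eqxx eqxx orbT.
have ns j : j \in s -> (j == i) = false by move=> js; apply: contraNF iNs => /eqP <-.
have -> : word_on (i :: s) (fun j => update a i k j) = nseq k i ++ word_on s (fun j => a j).
  rewrite /word_on /= ffunE eqxx; congr (_ ++ flatten _); apply/eq_in_map => j js.
  by rewrite ffunE ns.
rewrite big_cons ffunE eqxx -mulrA [X in _ * X]mulrC /partials foldr_cat; congr (_ * (_ * _)).
by apply: eq_big_seq => j js; rewrite ffunE ns.
Qed.

Lemma taylor_op_cube h N f z : entire_bd f -> taylor_op h N.+1 (enum 'I_n) f z =
  \sum_(alpha <- cube N) mpartial alpha f z *
    \prod_(i < n) (h ord0 i ^+ alpha i / (alpha i)`!%:R).
Proof.
move=> bf; rewrite taylor_op_word_on ?enum_uniq // sum_cube_ffun.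
apply: eq_big => [a|a _]; first by apply/forallP => i; rewrite mem_enum.
rewrite mpartial_word; congr (partials _ _ _ * _).
  by apply: eq_word_on => i _; rewrite ffunE.
by rewrite big_enum /=; apply: eq_bigr => i _; rewrite ffunE.
Qed.

Lemma taylor_ccvg f z h : entire_bd f -> ccvg (fun N => \sum_(alpha <- cube N) mpartial alpha f z *
    \prod_(i < n) (h ord0 i ^+ alpha i / (alpha i)`!%:R)) (f (z + h)).
Proof.
move=> bf; have hE : hshift h (enum 'I_n) = h.
  by rewrite /hshift big_enum /= -row_sum_delta.
pose D : R := 8 * expR 1 * (l1norm h + 1).
have [M HM] := bf.2 (l1norm z + n%:R * D).
apply: (@ccvg_geometric _ _ _ (2 ^+ n * `|M|)) => N.
rewrite cmodC -taylor_op_cube // -[in f _]hE; apply: le_trans (taylor_op_remainder (D := D) (M := `|M|) _ bf _ _) _ => //.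
  move=> w; rewrite size_enum_ord => wz; apply: le_trans (ler_norm _); apply: HM.
  by rewrite -(subrK z w); apply: le_trans (l1normD _ _) _; rewrite addrC lerD2l.
rewrite size_enum_ord half_expn -[leRHS]mulrA ler_pM ?divr_ge0 ?exprn_ge0 ?subr_ge0 ?exprn_ege1 //.
- by rewrite ler1n.
- by rewrite gerBl.
- by rewrite ler_piMr ?divr_ge0 ?exprn_ge0 // invf_le1 // ler1n.
Qed.

End Cubes.

(** * Sums over multi-indices with geometric majorants *)

Section MultiIndexSums.
Variables (R : realType) (n : nat).
Local Notation C := R[i].
Implicit Types (alpha : mindex n) (s t : seq (mindex n)).

Lemma ler_sum_uniq_sub (T : eqType) (s t : seq T) (F : T -> R) : uniq s -> uniq t ->
  {subset s <= t} -> (forall x, 0 <= F x) -> \sum_(x <- s) F x <= \sum_(x <- t) F x.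
Proof.
move=> us ut st F0; rewrite [leRHS](bigID (mem s)) /= -[\sum_(x <- t | x \in s) _]big_filter.
have -> : \sum_(x <- [seq x <- t | x \in s]) F x = \sum_(x <- s) F x.
  apply: perm_big; apply: uniq_perm => // [|x]; first exact: filter_uniq.
  by rewrite mem_filter andb_idr //; exact: st.
by rewrite lerDl sumr_ge0.
Qed.

(** A finite set lies in a cube, over which the sum factors into [n] geometric
    sums. *)
Lemma sum_half_le s : uniq s -> \sum_(alpha <- s) (2^-1 : R) ^+ mdeg alpha <= 2 ^+ n.
Proof.
move=> us; pose N := \max_(alpha <- s) mdeg alpha.
apply: (@le_trans _ _ (\sum_(alpha <- cube n N) (2^-1 : R) ^+ mdeg alpha)).
  apply: ler_sum_uniq_sub; [by []|exact: cube_uniq|move=> alpha al|move=> alpha].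
    apply: mem_cube => i; rewrite (@leq_trans (mdeg alpha)) //.
      by rewrite /mdeg (bigD1 i) //= leq_addr.
    exact: (@leq_bigmax_seq _ _ predT (@mdeg n)).
  by rewrite exprn_ge0 // invr_ge0.
rewrite sum_cube_ffun.
have -> : \sum_(a : {ffun 'I_n -> 'I_N.+1}) (2^-1 : R) ^+ mdeg [ffun i => (a i : nat)] =
    \prod_(i < n) \sum_(k < N.+1) (2^-1 : R) ^+ k.
  rewrite bigA_distr_bigA; apply: eq_bigr => a _; rewrite /mdeg expr_sum.
  by apply: eq_bigr => i _; rewrite ffunE.
have H : \sum_(k < N.+1) (2^-1 : R) ^+ k <= 2.
  have := sum_geometric_half N.+1 (@ler01 R); rewrite mulr1.
  by under eq_bigr do rewrite mul1r -exprVn.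
by rewrite prodr_const card_ord lerXn2r ?nnegrE // sumr_ge0.
Qed.

Lemma mdeg_notin_cube N alpha : alpha \notin cube n N -> (N <= mdeg alpha)%N.
Proof.
apply: contraNT; rewrite -ltnNge => aN; apply: mem_cube => i.
by rewrite (leq_trans _ (ltnW aN)) // /mdeg (bigD1 i) //= leq_addr.
Qed.

Variables (c : mindex n -> C) (K : R).
Hypothesis cK : forall alpha, cmod (c alpha) <= K * (4^-1) ^+ mdeg alpha.

Let K0 : 0 <= K.
Proof.
have := le_trans (cmod_ge0 _) (cK [ffun=> 0%N]).
by rewrite pmulr_lge0 // exprn_gt0 // invr_gt0.
Qed.

(** Half of the decay of [4^-k] is spent on [2^-N], the other half on summing. *)
Lemma tail_sum_le N s : uniq s -> (forall alpha, alpha \in s -> (N <= mdeg alpha)%N) ->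
  \sum_(alpha <- s) cmod (c alpha) <= K * 2 ^+ n / 2 ^+ N.
Proof.
move=> us sN; apply: (@le_trans _ _ (\sum_(alpha <- s) K / 2 ^+ N * 2^-1 ^+ mdeg alpha)).
  rewrite big_seq [leRHS]big_seq; apply: ler_sum => alpha /sN al.
  apply: (le_trans (cK alpha)); rewrite -mulrA ler_wpM2l //.
  have -> : 4^-1 = 2^-1 * 2^-1 :> R by field.
  rewrite exprMn ler_wpM2r ?exprn_ge0 ?invr_ge0 // -exprVn.
  by rewrite ler_wiXn2l ?invr_ge0 // invf_le1 // ler1n.
rewrite -mulr_sumr mulrAC ler_wpM2r ?invr_ge0 ?exprn_ge0 //.
by rewrite ler_wpM2l // sum_half_le.
Qed.

Lemma sum_abs_le s : uniq s -> \sum_(alpha <- s) cmod (c alpha) <= K * 2 ^+ n.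
Proof. by move=> us; have := @tail_sum_le 0 s us; rewrite expr0 divr1; apply. Qed.

Lemma summable_geometric :
  esum.summable [set: mindex n] (fun alpha => (cmod (c alpha))%:E).
Proof.
rewrite /summable; apply: (@le_lt_trans _ _ (K * 2 ^+ n)%:E); last exact: ltry.
apply: ge_ereal_sup => _ [A [finA _] <-].
rewrite fsbig_finite //= (eq_bigr (fun alpha => (cmod (c alpha))%:E)); last first.
  by move=> alpha _; rewrite ger0_norm ?cmod_ge0.
rewrite sumEFin lee_fin; apply: sum_abs_le; exact: fset_uniq.
Qed.

Lemma sum_diff_cube N s : uniq s -> {subset cube n N <= s} ->
  cmod (\sum_(alpha <- s) c alpha - \sum_(alpha <- cube n N) c alpha) <= K * 2 ^+ n / 2 ^+ N.
Proof.
move=> us sub; rewrite (bigID (mem (cube n N))) /= -big_filter.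
have -> : \sum_(x <- [seq x <- s | x \in cube n N]) c x = \sum_(x <- cube n N) c x.
  apply: perm_big; apply: uniq_perm => [||x]; [exact: filter_uniq|exact: cube_uniq|].
  by rewrite mem_filter andb_idr //; exact: sub.
rewrite addrAC subrr add0r -big_filter; apply: le_trans (cmod_sum _ _ _) _.
apply: tail_sum_le => [|alpha]; first exact: filter_uniq.
by rewrite mem_filter => /andP[/mdeg_notin_cube].
Qed.

Lemma cube_sub N M : (N <= M)%N -> {subset cube n N <= cube n M}.
Proof.
move=> NM alpha /fintype.imageP[a _ ->]; apply: mem_cube => i; rewrite ffunE.
by rewrite (leq_trans _ NM) // -ltnS ltn_ord.
Qed.

(** Every finite set containing a large cube has almost the same sum as the cube,
    so the net of finite sums has the limit of the cube sums. *)
Lemma sum_cube_le N :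
  cmod (summability.sum c - \sum_(alpha <- cube n N) c alpha) <= K * 2 ^+ n / 2 ^+ N.
Proof.
have n20 (e : R) : 0 < e -> exists N, K * 2 ^+ n / 2 ^+ N <= e.
  move=> e0; have [m Hm] := ex_nat_ge (K * 2 ^+ n / e); exists m.
  rewrite ler_pdivrMr ?exprn_gt0 // [e * _]mulrC -ler_pdivrMr //; apply: (le_trans Hm).
  by rewrite -natrX ler_nat ltnW // ltn_expl.
have [l Hl] : exists l, ccvg (fun N => \sum_(alpha <- cube n N) c alpha) l.
  apply: ccauchy_ex => e /n20[m Hm]; exists m => k mk.
  by apply: le_trans Hm; apply: sum_diff_cube; [exact: cube_uniq|exact: cube_sub].
suff -> : summability.sum c = l.
  apply: (@ccvg_le _ (fun M => \sum_(alpha <- cube n (M + N)) c alpha - \sum_(alpha <- cube n N) c alpha)).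
    apply: ccvgB; last exact: ccvg_cst.
    move=> e /Hl[m Hm]; exists m => k mk; apply: Hm; exact: leq_trans (leq_addr _ _).
  by move=> M; apply: sum_diff_cube; [exact: cube_uniq|apply: cube_sub; exact: leq_addl].
have FF : ProperFilter (@summability.totally (mindex n)) by exact: summability.totally_filter.
rewrite /summability.sum; apply: cvg_lim => //.
apply/cvgrPdist_le => e e0.
have eE : e = ((re e)%:C)%C by rewrite RRe_real // ger0_real // ltW.
move: eE e0; move: (re e) => x ->; rewrite ltcR => x0 {e}.
have x2 : 0 < x / 2 by rewrite divr_gt0.
have [m1 H1] := Hl _ x2; have [m2 H2] := n20 _ x2.
pose m := maxn m1 m2.
exists [fset alpha in cube n m]%fset => // A /= mA.
have -> : summability.partial_sum c A = \sum_(alpha <- enum_fset A) c alpha.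
  by rewrite /summability.partial_sum big_seq_fsetE.
rewrite normCE lecR cmodC.
rewrite (_ : _ - l = (\sum_(alpha <- enum_fset A) c alpha - \sum_(alpha <- cube n m) c alpha) +
  (\sum_(alpha <- cube n m) c alpha - l)); last by rewrite addrA subrK.
apply: le_trans (cmodD _ _) _; rewrite [x]splitr; apply: lerD.
  apply: le_trans (sum_diff_cube (fset_uniq A) _) _.
    by move=> alpha am; apply: (fsubsetP mA); rewrite !inE.
  apply: le_trans H2; rewrite ler_wpM2l ?mulr_ge0 ?exprn_ge0 //.
  rewrite lef_pV2 ?posrE ?exprn_gt0 // -!natrX ler_nat leq_exp2l //; exact: leq_maxr.
by apply: H1; exact: leq_maxl.
Qed.

Lemma sum_le : cmod (summability.sum c) <= K * 2 ^+ n.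
Proof.
have H : ccvg (fun N => \sum_(alpha <- cube n N) c alpha) (summability.sum c).
  by apply: ccvg_geometric => N; rewrite cmodC; exact: sum_cube_le.
apply: ccvg_le H _ => N; apply: le_trans (cmod_sum _ _ _) _.
by apply: sum_abs_le; exact: cube_uniq.
Qed.

Lemma sum_ccvg : ccvg (fun N => \sum_(alpha <- cube n N) c alpha) (summability.sum c).
Proof. by apply: ccvg_geometric => N; rewrite cmodC; exact: sum_cube_le. Qed.

End MultiIndexSums.

(** * Growth estimates *)

Section RealInequalities.
Variable R : realType.
Implicit Types (x y a b p th : R).

Lemma powR_le x y r : 0 <= r -> 0 <= x -> x <= y -> x `^ r <= y `^ r.
Proof.
by move=> r0 x0 xy; apply: ge0_ler_powR; rewrite ?nnegrE // (le_trans x0).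
Qed.

Lemma powRD_le a b p : 0 <= p -> 0 <= a -> 0 <= b ->
  (a + b) `^ p <= 2 `^ p * (a `^ p + b `^ p).
Proof.
move=> p0 a0 b0; wlog ab : a b a0 b0 / a <= b.
  move=> H; have [|/ltW] := leP a b; first exact: H.
  by move=> ba; rewrite addrC [X in _ * X]addrC; exact: H.
apply: (@le_trans _ _ ((2 * b) `^ p)).
  by apply: powR_le; rewrite ?addr_ge0 //; lra.
by rewrite powRM // ler_wpM2l ?powR_ge0 // lerDr powR_ge0.
Qed.

Lemma powR_expr x th k : (x `^ th) ^+ k = (x `^ k%:R) `^ th.
Proof. by rewrite -[LHS](powR_mulrn k (powR_ge0 x th)) powRAC. Qed.

Lemma mul_powR_pred x a : 0 < x -> x * x `^ (a - 1) = x `^ a.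
Proof.
move=> x0; have -> : x `^ a = x `^ (1 + (a - 1)) by congr (_ `^ _); ring.
by rewrite [RHS]powRD ?(gt_eqF x0) ?implybT // powRr1 // ltW.
Qed.

(** [k^k] and [k!] agree up to a factor [e^k]; the sign of [th] decides which of
    the two comparisons is needed. *)
Lemma pow_self_powR_le k th :
  (k%:R ^+ k) `^ th <= expR `|th| ^+ k * (k`!)%:R `^ th :> R.
Proof.
have f0 : 0 < k`!%:R :> R by rewrite ltr0n fact_gt0.
have [th0|th0] := leP 0 th.
  apply: (@le_trans _ _ ((k`!%:R * expR k%:R) `^ th)).
    by apply: powR_le; rewrite ?exprn_ge0 // pow_le_fact_exp.
  rewrite powRM ?expR_ge0 ?(ltW f0) // mulrC -expRM.
  by rewrite -expRM_natr ger0_norm // [th * _]mulrC.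
have kk : k`!%:R <= k%:R ^+ k :> R.
  rewrite -natrX ler_nat; elim: k {f0} => // k IH.
  by rewrite factS expnS leq_mul // (leq_trans IH) //; case: k {IH} => // k; rewrite leq_exp2r.
have kk0 : 0 < k%:R ^+ k :> R by exact: lt_le_trans kk.
have -> : th = - `|th| by rewrite ltr0_norm // opprK.
rewrite !powRN normrN normr_id.
apply: (@le_trans _ _ ((k`!%:R : R) `^ `|th|)^-1).
  by rewrite lef_pV2 ?posrE ?powR_gt0 // powR_le // ltW.
by rewrite ler_peMl ?invr_ge0 ?powR_ge0 // exprn_ege1 // (le_trans _ (expR_ge1Dx _)) // lerDl.
Qed.

(** From [y^k <= k! e^y] with [y = p s x^p], raised to the power [1/p]. *)
Lemma pow_le_exp_powR x p s k : 0 < p -> 0 < s -> 0 <= x ->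
  x ^+ k <= (k`!)%:R `^ p^-1 * ((p * s) `^ (- p^-1)) ^+ k * expR (s * x `^ p).
Proof.
move=> p0 s0 x0; have ps : 0 < p * s by rewrite mulr_gt0.
have p'0 : 0 <= p^-1 by rewrite invr_ge0 ltW.
pose y := p * s * x `^ p.
have y0 : 0 <= y by rewrite mulr_ge0 ?powR_ge0 // ltW.
have xk : x ^+ k = (y ^+ k) `^ p^-1 * ((p * s) `^ (- p^-1)) ^+ k.
  have -> : x = y `^ p^-1 * (p * s) `^ (- p^-1).
    rewrite /y powRM ?powR_ge0 ?(ltW ps) // -powRrM divff ?gt_eqF // powRr1 //.
    by rewrite powRN mulrAC divff ?mul1r // gt_eqF // powR_gt0.
  by rewrite exprMn [X in X * _]powR_expr powR_mulrn.
rewrite xk mulrAC ler_wpM2r ?exprn_ge0 ?powR_ge0 //.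
apply: (@le_trans _ _ ((k`!%:R * expR y) `^ p^-1)).
  by apply: powR_le; rewrite ?exprn_ge0 // pow_le_fact_exp.
rewrite powRM ?expR_ge0 // ler_wpM2l ?powR_ge0 // -expRM.
rewrite (_ : y / p = s * x `^ p) // /y.
by field; rewrite gt_eqF.
Qed.

End RealInequalities.

Lemma bin_le_exp2 m k : ('C(m, k) <= 2 ^ m)%N.
Proof.
elim: m k => [|m IH] [|k] //; first by rewrite bin0 expn_gt0.
by rewrite binS expnS mul2n -addnn leq_add.
Qed.

(** Binomial coefficients are at most powers of 2. *)
Lemma fact_sum_le (I : Type) (s : seq I) (a : I -> nat) :
  ((\sum_(i <- s) a i)`! <= 2 ^ (size s * \sum_(i <- s) a i) * \prod_(i <- s) (a i)`!)%N.
Proof.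
elim: s => [|i s IH]; first by rewrite !big_nil.
rewrite !big_cons; set b := (\sum_(j <- s) a j)%N in IH *.
have -> : ((a i + b)`! = 'C(a i + b, a i) * ((a i)`! * b`!))%N.
  by have := bin_fact (leq_addr b (a i)); rewrite addKn => <-.
apply: (@leq_trans (2 ^ (a i + b) * ((a i)`! * (2 ^ (size s * b) * \prod_(j <- s) (a j)`!)))).
  by rewrite leq_mul ?bin_le_exp2 // leq_mul.
set F := (\prod_(j <- s) _)%N.
have -> : (2 ^ (a i + b) * ((a i)`! * (2 ^ (size s * b) * F)) =
    2 ^ (a i + b + size s * b) * ((a i)`! * F))%N by rewrite (expnD 2 (a i + b)) -!mulnA; congr (_ * _)%N; exact: mulnCA.
rewrite leq_mul // leq_exp2l //= mulSn leq_add2l.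
by rewrite leq_mul // leq_addl.
Qed.

Definition mfact (n : nat) (alpha : mindex n) : nat := (\prod_(i < n) (alpha i)`!)%N.

Lemma mfact_gt0 n (alpha : mindex n) : (0 < mfact alpha)%N.
Proof. by rewrite prodn_gt0 // => i; exact: fact_gt0. Qed.

Lemma fact_mdeg_le n (alpha : mindex n) :
  ((mdeg alpha)`! <= 2 ^ (n * mdeg alpha) * mfact alpha)%N.
Proof.
by have := fact_sum_le (index_enum 'I_n) alpha; rewrite /index_enum -enumT size_enum_ord !big_enum.
Qed.

Section Growth.
Variables (R : realType) (n : nat) (p : R).
Hypothesis p0 : 0 < p.
Local Notation C := R[i].
Implicit Types (f g : Cn R n -> C) (z w h : Cn R n) (tau M : R).

Let th := 1 - p^-1.

Definition growth tau M f := forall z, cmod (f z) <= M * expR (tau * l1norm z `^ p).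

Lemma growth_entire_bd f tau M : 0 <= tau -> 0 <= M -> entire f -> growth tau M f -> entire_bd f.
Proof.
move=> t0 M0 ef gf; split=> // rho; exists (M * expR (tau * `|rho| `^ p)) => z zr.
apply: le_trans (gf z) _; rewrite ler_wpM2l // ler_expR ler_wpM2l //.
apply: powR_le; [exact: ltW|exact: l1norm_ge0|exact: le_trans (ler_norm _)].
Qed.

Lemma inAp_growth f : inAp p f -> exists tau M, [/\ 0 < tau, 0 <= M, entire f & growth tau M f].
Proof.
move=> [tau t0 [ef /wnorm_ltP[M M0 fM]]]; exists tau, M; split; [exact: t0|exact: M0|exact: ef|move=> z].
apply: le_trans (fM z) _; rewrite ler_wpM2l // ler_expR ler_wpM2l ?(ltW t0) //.
by rewrite powR_le ?enorm_ge0 ?enorm_le_l1norm // ltW.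
Qed.

Lemma l1norm_powR_le z : l1norm z `^ p <= n%:R `^ p * enorm z `^ p.
Proof.
rewrite -powRM ?enorm_ge0 // powR_le ?l1norm_ge0 ?(ltW p0) //; exact: l1norm_le_enorm.
Qed.

(** Cauchy estimates with steps [r = k^(1/p - 1)]: the ball has radius
    [k r = k^(1/p)], on which [|w|^p] exceeds a multiple of [|z|^p] by at most a
    multiple of [k]. *)
Lemma mpartial_growth f tau M : 0 <= tau -> 0 <= M -> entire_bd f -> growth tau M f ->
  let A := 2 * expR `|th| * expR (tau * 2 `^ p) in
  forall alpha z, cmod (mpartial alpha f z) <=
    M * A ^+ mdeg alpha * (mdeg alpha)`!%:R `^ th * expR (tau * 2 `^ p * l1norm z `^ p).
Proof.
move=> t0 M0 bf gf A alpha z; rewrite mpartial_word.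
have p21 : 1 <= 2 `^ p :> R.
  by rewrite -[leLHS](powRr0 (2 : R)); apply: ler_powR; [rewrite ler1n|exact: ltW].
case: (posnP (mdeg alpha)) => [k0|k0].
  have -> : word alpha = [::] by apply/nilP; rewrite /nilp size_word k0.
  rewrite k0 expr0 fact0 powR1 !mulr1; apply: (le_trans (gf z)).
  rewrite ler_wpM2l // ler_expR ler_wpM2r ?powR_ge0 // ler_peMr //.
set k := mdeg alpha in k0 *.
have kr0 : 0 < k%:R :> R by rewrite ltr0n.
pose r : R := k%:R `^ (p^-1 - 1).
have r0 : 0 < r by rewrite powR_gt0.
have krE : k%:R * r = k%:R `^ p^-1.
  exact: mul_powR_pred.
have krp : (k%:R * r) `^ p = k%:R.
  by rewrite krE -powRrM mulVf ?gt_eqF // powRr1 // ltW.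
pose M' := M * expR (tau * 2 `^ p * l1norm z `^ p) * expR (tau * 2 `^ p) ^+ k.
have := partials_cauchy (l := word alpha) (z := z) (r := r) (M := M') r0 bf.
rewrite size_word -/k => H; apply: le_trans (H _) _.
  move=> w wz; apply: le_trans (gf w) _; rewrite /M' -mulrA ler_wpM2l //.
  rewrite -expRM_natr -expRD ler_expR -!mulrA -mulrDr ler_wpM2l // -mulrDr.
  apply: (@le_trans _ _ ((l1norm z + k%:R * r) `^ p)).
    apply: powR_le; rewrite ?l1norm_ge0 ?(ltW p0) // -(subrK z w).
    by apply: le_trans (l1normD _ _) _; rewrite addrC lerD2l.
  by rewrite -{2}krp powRD_le ?l1norm_ge0 ?mulr_ge0 // ltW.
have -> : (2 / r) ^+ k = 2 ^+ k * (k%:R ^+ k) `^ th.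
  by rewrite exprMn /r -powRN opprB powR_expr powR_mulrn.
rewrite /M' /A !exprMn.
have := pow_self_powR_le k th; set u := _ `^ th; set v := _ `^ th => uv.
set e1 := expR _ ^+ k in uv *; set e2 := expR _ ^+ k; set e3 := expR _.
have -> : 2 ^+ k * u * (M * e3 * e2) = (M * 2 ^+ k * e3 * e2) * u by ring.
have -> : M * (2 ^+ k * e1 * e2) * v * e3 = (M * 2 ^+ k * e3 * e2) * (e1 * v) by ring.
by rewrite ler_wpM2l // !mulr_ge0 ?exprn_ge0 ?expR_ge0.
Qed.

Definition centered_monomial z (alpha : mindex n) : Cn R n -> C :=
  fun w => \prod_(i < n) (w ord0 i - z ord0 i) ^+ alpha i.

Lemma mono_entire z alpha : entire (centered_monomial z alpha).
Proof.
rewrite /centered_monomial; elim: (index_enum _) => [|i s IH].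
  by under eq_fun do rewrite big_nil; exact: entire_cst.
under eq_fun do rewrite big_cons; apply: entireM; last exact: IH.
elim: (alpha i) => [|k IHk]; first by under eq_fun do rewrite expr0; exact: entire_cst.
under eq_fun do rewrite exprS; apply: entireM; last exact: IHk.
by apply: entireD; [exact: entire_coord|exact: entire_cst].
Qed.

Lemma cmod_mono_le z alpha w : cmod (centered_monomial z alpha w) <= l1norm (w - z) ^+ mdeg alpha.
Proof.
rewrite cmod_prod /mdeg expr_sum; apply: ler_prod => i _; rewrite cmod_ge0 cmodX /=.
rewrite lerXn2r ?nnegrE ?cmod_ge0 ?l1norm_ge0 //.
by have := coord_le_l1norm (w - z) i; rewrite !mxE.
Qed.

Lemma mono_growth z alpha (s : R) : 0 < s ->
  growth (s * 2 `^ p) ((mdeg alpha)`!%:R `^ p^-1 * ((p * s) `^ (- p^-1)) ^+ mdeg alpha *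
    expR (s * 2 `^ p * l1norm z `^ p)) (centered_monomial z alpha).
Proof.
move=> s0 w; apply: le_trans (cmod_mono_le _ _ _) _.
apply: le_trans (pow_le_exp_powR _ p0 s0 (l1norm_ge0 _)) _.
rewrite -[leRHS]mulrA ler_wpM2l ?mulr_ge0 ?exprn_ge0 ?powR_ge0 //.
rewrite -expRD ler_expR -!mulrA -mulrDr ler_wpM2l ?(ltW s0) // -mulrDr.
apply: le_trans (powRD_le (ltW p0) (l1norm_ge0 z) (l1norm_ge0 w)).
apply: powR_le; rewrite ?(ltW p0) ?l1norm_ge0 //.
by apply: le_trans (l1normD _ _) _; rewrite l1normN addrC.
Qed.

End Growth.

(** * Continuity in the inductive limit topology *)

Section Topology.
Variables (R : realType) (n : nat) (p : R).
Local Notation C := R[i].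
Local Notation Ap := (@Ap R n p).
Implicit Types (f g h : Ap) (tau M : R).

Definition dominated tau M (g : Cn R n -> C) :=
  forall z, cmod (g z) <= M * expR (tau * enorm z `^ p).

Lemma wnorm_leP tau M (g : Cn R n -> C) : (wnorm p tau g <= M%:E)%E <-> dominated tau M g.
Proof.
have E z : (cmod (g z) * expR (- tau * enorm z `^ p) <= M) =
    (cmod (g z) <= M * expR (tau * enorm z `^ p)).
  by rewrite mulNr expRN ler_pdivrMr ?expR_gt0.
split=> [H z|H].
  rewrite -E -lee_fin; apply: le_trans H.
  by apply: ereal_sup_ubound; exists z.
by apply: ge_ereal_sup => _ [z _ <-]; rewrite lee_fin E; exact: H.
Qed.

Lemma ApE (a b : C) f g z : (a *: f + b *: g : Ap) z = a * f z + b * g z.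
Proof. by []. Qed.

Lemma ApZE a f z : (a *: f : Ap) z = a * f z.
Proof. by []. Qed.

Lemma open_ApE (U : set Ap) : open U <-> ind_open U.
Proof. by []. Qed.

Definition step_bounded (F : Ap -> Ap) := forall tau, 0 < tau ->
  exists A tau', [/\ 0 < A, 0 < tau' &
    forall g M, 0 <= M -> dominated tau M g -> dominated tau' (A * M) (F g)].

Lemma step_bounded_continuous (F : {linear Ap -> Ap}) : step_bounded F -> continuous F.
Proof.
move=> bF; apply/continuousP => U /open_ApE oU; apply/open_ApE => f /= /oU[V [cV nV sV]].
exists (F @^-1` V); split.
- by move=> a b g h ab Vg Vh; rewrite /= linearD !linearZ; exact: cV.
- move=> tau t0; have [A [tau' [A0 t'0 H]]] := bF tau t0.
  have [r r0 Hr] := nV _ t'0; exists (r / A); first by rewrite divr_gt0.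
  move=> g /wnorm_leP gb; apply: Hr; apply/wnorm_leP.
  have -> : r = A * (r / A) by rewrite mulrC divfK // gt_eqF.
  by apply: H => //; rewrite divr_ge0 // ltW.
- by move=> g Vg; rewrite /= linearD; exact: sV.
Qed.

(** The points around which [V] still contains an absolutely convex
    neighbourhood form an open subset of [V]: if [W] serves for [f], half of [W]
    serves for the points of [f + W / 2]. *)
Lemma ind_nbhs0 (V : set Ap) : abs_convex V -> step_nbhs0 V -> nbhs (0 : Ap) V.
Proof.
move=> cV nV; rewrite nbhsE.
pose U : set Ap := [set f | exists W : set Ap,
  [/\ abs_convex W, step_nbhs0 W & forall g, W g -> V (f + g)]].
have W0 (W : set Ap) : step_nbhs0 W -> W 0.
  move=> nW; have [r r0 Hr] := nW 1 ltr01; apply: Hr; apply/wnorm_leP => z.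
  by rewrite (_ : (0 : Ap) z = 0) // cmod0 mulr_ge0 ?expR_ge0 // ltW.
exists U; last first.
  by move=> f [W [_ /W0 w0 H]]; rewrite -[f]addr0; exact: H.
split; last by exists V; split=> // g; rewrite add0r.
apply/open_ApE => f [W [cW nW sW]].
pose W' : set Ap := [set g | W ((2 : C) *: g)].
have cW' : abs_convex W'.
  move=> a b g h ab Wg Wh; rewrite /W' /= scalerDr !scalerA ![2 * _]mulrC -!scalerA.
  exact: cW.
have nW' : step_nbhs0 W'.
  move=> tau t0; have [r r0 Hr] := nW _ t0; exists (r / 2); first by rewrite divr_gt0.
  move=> g /wnorm_leP gb; apply: Hr; apply/wnorm_leP => z; rewrite ApZE cmodM cmod_nat.
  by have := gb z; lra.
exists W'; split=> // g Wg; exists W'; split=> // g' Wg'; rewrite -addrA; apply: sW.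
have -> : g + g' = (2^-1 : C) *: ((2 : C) *: g) + (2^-1 : C) *: ((2 : C) *: g').
  by rewrite !scalerA mulVf ?pnatr_eq0 // !scale1r.
by apply: cW => //; rewrite cmodV cmod_nat; lra.
Qed.

(** Otherwise there are [g_m] in the unit ball of one step and points [z_m] with
    [(m + 1) exp ((m + 1) |z_m|^p) < |F g_m (z_m)|]; the functions dominated by
    [|F g_m (z_m)| / (m + 1)] at every [z_m] then form a neighbourhood of 0,
    although no positive multiple of the unit ball is mapped into it. *)
Lemma continuous_step_bounded (F : {linear Ap -> Ap}) : continuous F -> step_bounded F.
Proof.
move=> cF tau t0; apply: contrapT => nB.
have bad (m : nat) : exists gz : Ap * Cn R n, dominated tau 1 gz.1 /\
    m.+1%:R * expR (m.+1%:R * enorm gz.2 `^ p) < cmod (F gz.1 gz.2).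
  apply: contrapT => nm_; apply: nB; exists m.+1%:R, m.+1%:R; split=> // g M M0 gM z.
  have [MM|MM] := eqVneq M 0.
    have g0 : g = 0.
      apply: val_inj; apply/funext => w; apply/eqP; rewrite -cmod_eq0 eq_le cmod_ge0 andbT.
      by have := gM w; rewrite MM mul0r.
    by rewrite g0 linear0 MM mulr0 mul0r (_ : (0 : Ap) z = 0) // cmod0.
  have Mp : 0 < M by rewrite lt_def MM.
  pose g1 : Ap := ((M^-1)%:C)%C *: g.
  have g1b : dominated tau 1 g1.
    move=> w; rewrite ApZE cmodM cmod_real ger0_norm ?invr_ge0 // mul1r mulrC.
    by rewrite ler_pdivrMr // mulrC.
  rewrite leNgt; apply/negP => bz; apply: nm_; exists (g1, z); split=> //=.
  rewrite linearZ ApZE cmodM cmod_real ger0_norm ?invr_ge0 // [M^-1 * _]mulrC ltr_pdivlMr //.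
  by rewrite mulrAC.
pose gz m := projT1 (cid (bad m)).
have gzP m : dominated tau 1 (gz m).1 /\
    m.+1%:R * expR (m.+1%:R * enorm (gz m).2 `^ p) < cmod (F (gz m).1 (gz m).2).
  exact: projT2 (cid (bad m)).
pose z m := (gz m).2; pose a m : R := cmod (F (gz m).1 (z m)).
have a0 m : 0 < a m.
  by case: (gzP m) => _; apply: le_lt_trans; rewrite mulr_ge0 ?expR_ge0.
pose V : set Ap := [set h | forall m, m.+1%:R * cmod (h (z m)) <= a m].
have cV : abs_convex V.
  move=> x y f g xy Vf Vg m; rewrite ApE.
  apply: (@le_trans _ _ (cmod x * (m.+1%:R * cmod (f (z m))) + cmod y * (m.+1%:R * cmod (g (z m))))).
    rewrite ![cmod _ * (_ * _)]mulrCA -mulrDr ler_wpM2l // -!cmodM; exact: cmodD.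
  apply: (@le_trans _ _ (cmod x * a m + cmod y * a m)).
    by apply: lerD; rewrite ler_wpM2l ?cmod_ge0.
  by rewrite -mulrDl ler_piMl // ltW.
(* On the step of exponent [s], the conditions with [s <= m] hold on the unit
   ball by the choice of [z m], and the finitely many others for small [r]. *)
have nV : step_nbhs0 V.
  move=> s s0; have [N HN] := ex_nat_ge s.
  have [r r0 Hr] : exists2 r : R, 0 < r & forall m, (m < N)%N ->
      m.+1%:R * (r * expR (s * enorm (z m) `^ p)) <= a m.
    elim: N {HN} => [|N [r r0 IH]]; first by exists 1.
    have q0 : 0 < N.+1%:R * expR (s * enorm (z N) `^ p) by rewrite mulr_gt0 ?expR_gt0.
    pose q := a N / (N.+1%:R * expR (s * enorm (z N) `^ p)).
    have rq : Num.min r q <= r by rewrite ge_min lexx.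
    have qq : Num.min r q <= q by rewrite ge_min lexx orbT.
    exists (Num.min r q); first by rewrite lt_min r0 divr_gt0.
    move=> m; rewrite ltnS leq_eqVlt => /orP[/eqP->|/IH mN].
      by rewrite mulrCA -ler_pdivlMr.
    exact: le_trans (ler_wpM2l (ler0n _ _) (ler_wpM2r (expR_ge0 _) rq)) mN.
  have rr : Num.min r 1 <= r by rewrite ge_min lexx.
  have r1 : Num.min r 1 <= 1 by rewrite ge_min lexx orbT.
  exists (Num.min r 1); first by rewrite lt_min r0 ltr01.
  move=> h /wnorm_leP hb m; apply: (le_trans (ler_wpM2l (ler0n _ _) (hb (z m)))).
  have [mN|Nm] := ltnP m N.
    exact: le_trans (ler_wpM2l (ler0n _ _) (ler_wpM2r (expR_ge0 _) rr)) (Hr m mN).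
  have [_ /ltW] := gzP m; apply: le_trans; apply: (ler_wpM2l (ler0n _ _)).
  apply: (le_trans (ler_wpM2r (expR_ge0 _) r1)).
  rewrite mul1r ler_expR; apply: (ler_wpM2r (powR_ge0 _ _)); apply: (le_trans HN).
  by rewrite ler_nat; exact: leq_trans Nm (leqnSn _).
(* By continuity some multiple [r g_m] is mapped into [V]; at [z m] this says
   [r (m + 1) <= 1] for every [m]. *)
have := ind_nbhs0 cV nV; rewrite -[X in nbhs X](linear0 F) => /(cF 0).
rewrite /= nbhsE; case=> O [oO O0] OV.
have [W [_ nW OW]] := (open_ApE O).1 oO 0 O0.
have [r r0 Hr] := nW _ t0.
have [m Hm] := ex_nat_ge r^-1.
have : V (F ((r%:C)%C *: (gz m).1)).
  apply: OV; rewrite -[_ *: _]add0r; apply: OW; apply: Hr; apply/wnorm_leP => w.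
  rewrite ApZE cmodM cmod_real ger0_norm ?(ltW r0) // ler_wpM2l ?(ltW r0) //.
  by have := (gzP m).1 w; rewrite mul1r.
move=> /(_ m); rewrite linearZ ApZE cmodM cmod_real ger0_norm ?(ltW r0) // -/(a m) mulrA.
apply/negP; rewrite -ltNge -[ltLHS]mul1r ltr_pM2r //.
rewrite -ltr_pdivrMr // div1r; apply: le_lt_trans Hm _.
by rewrite ltr_nat.
Qed.

End Topology.

(** * Operators of the class D_p act continuously *)

Section Action.
Variables (R : realType) (n : nat) (p : R).
Hypothesis p0 : 0 < p.
Local Notation C := R[i].
Local Notation Ap := (@Ap R n p).
Implicit Types (f g : Cn R n -> C) (P Q : formal_op R n) (tau M : R).

Lemma dominated_growth tau M f : 0 <= tau -> 0 <= M -> dominated p tau M f -> growth p tau M f.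
Proof.
move=> t0 M0 bf z; apply: (le_trans (bf z)); apply: (ler_wpM2l M0).
rewrite ler_expR; apply: (ler_wpM2l t0).
exact: powR_le (ltW p0) (enorm_ge0 z) (enorm_le_l1norm z).
Qed.

Lemma growth_dominated tau M f : 0 <= tau -> 0 <= M -> growth p tau M f ->
  dominated p (tau * n%:R `^ p + 1) M f.
Proof.
move=> t0 M0 gf z; apply: (le_trans (gf z)); apply: (ler_wpM2l M0).
rewrite ler_expR mulrDl mul1r; apply: (@le_trans _ _ (tau * n%:R `^ p * enorm z `^ p)).
  rewrite -mulrA; apply: (ler_wpM2l t0); exact: l1norm_powR_le.
by rewrite lerDl powR_ge0.
Qed.

Lemma growth_inAp tau M f : 0 <= tau -> 0 <= M -> entire f -> growth p tau M f -> inAp p f.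
Proof.
move=> t0 M0 ef gf; exists (tau * n%:R `^ p + 1).
  by apply: ltr_wpDl => //; rewrite mulr_ge0 ?powR_ge0.
by split; [exact: ef|apply/wnorm_ltP; exists M; [exact: M0|exact: growth_dominated]].
Qed.

(** The factorial weights of the coefficients and of the derivatives cancel, and
    the freedom in [eps] makes the remaining geometric factor small. *)
Lemma op_term_bound P tau : inDp p P -> 0 <= tau ->
  exists A tau', [/\ 0 < A, 0 < tau' &
    forall f M, 0 <= M -> entire_bd f -> growth p tau M f -> forall z alpha,
      cmod (op_term P f z alpha) <=
        A * M * expR (tau' * l1norm z `^ p) * 4^-1 ^+ mdeg alpha].
Proof.
move=> hP t0.
pose A0 : R := 2 * expR `|1 - p^-1| * expR (tau * 2 `^ p).
have A00 : 0 < A0 by rewrite !mulr_gt0 ?expR_gt0.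
(* [A0^k] is the geometric factor of the estimate for the derivatives. *)
have [B [A [B0 A_gt0 H]]] := hP (4^-1 / A0) (divr_gt0 (eq_ind_r _ (ltr0n R 4) (invr_gt0 4)) A00).
exists A, (B + tau * 2 `^ p); split=> //.
  by rewrite ltr_pwDl // mulr_ge0 ?powR_ge0.
move=> f M M0 bf gf z alpha; rewrite /op_term cmodM.
have h1 := H z alpha; have h2 := mpartial_growth p0 t0 M0 bf gf alpha z.
apply: le_trans (ler_pM (cmod_ge0 _) (cmod_ge0 _) h1 h2) _.
set k := mdeg alpha; set w := _ `^ (1 - p^-1).
have w0 : w != 0 by rewrite gt_eqF // powR_gt0 // ltr0n fact_gt0.
have e1 : expR (B * enorm z `^ p) <= expR (B * l1norm z `^ p).
  rewrite ler_expR; apply: (ler_wpM2l (ltW B0)).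
  exact: powR_le (ltW p0) (enorm_ge0 z) (enorm_le_l1norm z).
rewrite -/A0 mulrDl expRD.
set u := expR (B * enorm z `^ p) in e1 *; set v := expR (B * l1norm z `^ p) in e1 *.
set x := expR _.
have -> : A * ((4^-1 / A0) ^+ k / w) * u * (M * A0 ^+ k * w * x) =
    A * M * x * 4^-1 ^+ k * u * (A0 ^+ k / A0 ^+ k) * (w / w).
  rewrite exprMn [A0^-1 ^+ k]exprVn; move: (4^-1 ^+ k) (A0 ^+ k) => q r; ring.
have ek : A0 ^+ k != 0 by exact: expf_neq0 (lt0r_neq0 A00).
rewrite (divff w0) (divff ek) !mulr1.
rewrite [leRHS](_ : _ = A * M * x * 4^-1 ^+ k * v); last by ring.
apply: ler_wpM2l e1; have q0 : 0 <= 4^-1 ^+ k :> R by rewrite exprn_ge0.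
exact: mulr_ge0 (mulr_ge0 (mulr_ge0 (ltW A_gt0) M0) (expR_ge0 _)) q0.
Qed.

Lemma op_growth P tau : inDp p P -> 0 <= tau ->
  exists A tau', [/\ 0 < A, 0 < tau' &
    forall f M, 0 <= M -> entire_bd f -> growth p tau M f ->
      [/\ op_converges P f, entire (op_apply P f) & growth p tau' (A * M) (op_apply P f)]].
Proof.
move=> hP t0; have [A [tau' [A0 t'0 H]]] := op_term_bound hP t0.
exists (A * 2 ^+ n), tau'; split=> //; first by rewrite mulr_gt0 // exprn_gt0.
move=> f M M0 bf gf; have {}H := H f M M0 bf gf.
have gr : growth p tau' (A * 2 ^+ n * M) (op_apply P f).
  move=> z; apply: le_trans (sum_le (H z)) _.
  by apply: le_of_eq; ring.
split=> //.
  by move=> z; exact: summable_geometric (H z).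
apply: (@entire_limit R n (fun N z => \sum_(alpha <- cube n N) op_term P f z alpha)).
- move=> N; apply: entire_sum => alpha; apply: entireM; first exact: coef_entire.
  exact: (mpartial_entire_bd alpha bf).1.
- move=> rho; exists (A * M * expR (tau' * `|rho| `^ p) * 2 ^+ n) => N z zr.
  apply: le_trans (cmod_sum _ _ _) _.
  apply: le_trans (sum_abs_le (H z) (cube_uniq n N)) _.
  apply: ler_wpM2r; first exact: exprn_ge0.
  apply: ler_wpM2l; first by rewrite mulr_ge0 // ltW.
  rewrite ler_expR; apply: (ler_wpM2l (ltW t'0)).
  apply: powR_le; [exact: ltW|exact: l1norm_ge0|exact: le_trans (ler_norm _)].
- by move=> z; exact: sum_ccvg (H z).
Qed.

Lemma inAp_entire_bd f : inAp p f -> entire_bd f.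
Proof.
by move=> /(inAp_growth p0)[tau [M [t0 M0 ef gf]]]; exact: growth_entire_bd (ltW t0) M0 ef gf.
Qed.

Lemma Ap_inAp (f : Ap) : inAp p f.
Proof. by have /asboolP := valP f. Qed.

Definition ApOf f (hf : inAp p f) : Ap := MkAp (asboolT hf).

Lemma op_inAp P f : inDp p P -> inAp p f -> op_converges P f /\ inAp p (op_apply P f).
Proof.
move=> hP hf; have [tau [M [t0 M0 ef gf]]] := inAp_growth p0 hf.
have [A [tau' [A0 t'0 H]]] := op_growth hP (ltW t0).
have [cv en gr] := H f M M0 (inAp_entire_bd hf) gf; split=> //.
by apply: growth_inAp gr; rewrite ?mulr_ge0 // ltW.
Qed.

Lemma op_apply_ccvg P f z : inDp p P -> inAp p f ->
  ccvg (fun N => \sum_(alpha <- cube n N) op_term P f z alpha) (op_apply P f z).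
Proof.
move=> hP hf; have [tau [M [t0 M0 ef gf]]] := inAp_growth p0 hf.
have [A [tau' [A0 t'0 H]]] := op_term_bound hP (ltW t0).
exact: sum_ccvg (H f M M0 (inAp_entire_bd hf) gf z).
Qed.

Lemma op_operator P : inDp p P -> exists2 F : {linear Ap -> Ap}, continuous F &
  forall f : Ap, F f = op_apply P f :> (Cn R n -> C).
Proof.
move=> hP.
pose F (f : Ap) : Ap := ApOf (op_inAp hP (Ap_inAp f)).2.
have Flin : linear F.
  move=> a f g; apply: val_inj; apply/funext => z.
  have hz := op_apply_ccvg z hP (Ap_inAp (a *: f + g)).
  have fz := op_apply_ccvg z hP (Ap_inAp f); have gz := op_apply_ccvg z hP (Ap_inAp g).
  have E alpha : op_term P (a *: f + g) z alpha = a * op_term P f z alpha + op_term P g z alpha.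
    rewrite /op_term !mpartial_word.
    have -> : partials (word alpha) (a *: f + g) z =
        a * partials (word alpha) f z + partials (word alpha) g z.
      by have /(congr1 (@^~ z)) := partials_lin (word alpha) a (inAp_entire_bd (Ap_inAp f)) (inAp_entire_bd (Ap_inAp g)).
    ring.
  apply: ccvg_unique hz _.
  have -> : (fun N => \sum_(alpha <- cube n N) op_term P (a *: f + g) z alpha) =
     (fun N => a * (\sum_(alpha <- cube n N) op_term P f z alpha) +
        \sum_(alpha <- cube n N) op_term P g z alpha).
    by apply/funext => N; rewrite mulr_sumr -big_split; apply: eq_bigr => alpha _; exact: E.
  exact: ccvgD (ccvgMl a fz) gz.
pose Fm := GRing.isLinear.Build _ _ _ _ F Flin.
pose FF : {linear Ap -> Ap} := HB.pack F Fm.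
exists FF => //; apply: step_bounded_continuous => tau t0.
have [A [tau' [A0 t'0 H]]] := op_growth hP (ltW t0).
exists A, (tau' * n%:R `^ p + 1); split=> //.
  by apply: ltr_wpDl => //; rewrite mulr_ge0 ?powR_ge0 // ltW.
move=> g M M0 bg; have gg := dominated_growth (ltW t0) M0 bg.
have [_ _ gr] := H g M M0 (inAp_entire_bd (Ap_inAp g)) gg.
by apply: growth_dominated gr; [exact: ltW|rewrite mulr_ge0 // ltW].
Qed.

End Action.

(** * The symbol of a continuous operator *)

Section FunctionsInAp.
Variables (R : realType) (n : nat) (p : R).
Hypothesis p0 : 0 < p.
Local Notation C := R[i].
Local Notation Ap := (@Ap R n p).
Implicit Types (f g : Cn R n -> C).

Lemma powR_conj (x q : R) : 0 < x -> x `^ (1 - q) * x `^ q = x.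
Proof.
move=> x0; rewrite -powRD; first by rewrite subrK powRr1 // ltW.
by rewrite (gt_eqF x0) implybT.
Qed.

Lemma ex_powR_eq (q : R) : 0 < q -> exists2 s : R, 0 < s & (p * s) `^ (- p^-1) = q.
Proof.
move=> q0; exists (q `^ (- p) / p); first by rewrite divr_gt0 // powR_gt0.
by rewrite mulrC divfK ?gt_eqF // -powRrM mulrNN divff ?gt_eqF // powRr1 // ltW.
Qed.

Lemma inAp_lin (a : C) f g : inAp p f -> inAp p g -> inAp p (fun w => a * f w + g w).
Proof. by move=> hf hg; exact: (Ap_inAp (a *: ApOf hf + ApOf hg)). Qed.

Lemma inAp_cst (c : C) : inAp p (fun _ : Cn R n => c).
Proof.
apply: (@growth_inAp _ _ _ p0 0 (cmod c)); [exact: lexx|exact: cmod_ge0|exact: entire_cst|].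
by move=> z; rewrite mul0r expR0 mulr1.
Qed.

Lemma inAp_coord i (c : C) : inAp p (fun w : Cn R n => w ord0 i - c).
Proof.
have -> : (fun w : Cn R n => w ord0 i - c) = (fun w => 1 * w ord0 i + (fun=> - c) w).
  by apply/funext => w; rewrite mul1r.
apply: inAp_lin; last exact: inAp_cst.
apply: (@growth_inAp _ _ _ p0 1 ((1`!)%:R `^ p^-1 * ((p * 1) `^ (- p^-1)) ^+ 1)).
- exact: ler01.
- by rewrite mulr_ge0 ?powR_ge0 // exprn_ge0 // powR_ge0.
- exact: entire_coord.
move=> z; apply: (le_trans (coord_le_l1norm z i)); rewrite -[leLHS]expr1.
exact: pow_le_exp_powR p0 ltr01 (l1norm_ge0 z).
Qed.

Lemma inApM f g : inAp p f -> inAp p g -> inAp p (fun w => f w * g w).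
Proof.
move=> /(inAp_growth p0)[s [M [s0 M0 ef gf]]] /(inAp_growth p0)[t [N [t0 N0 eg gg]]].
apply: (@growth_inAp _ _ _ p0 (s + t) (M * N)).
- by rewrite addr_ge0 // ltW.
- exact: mulr_ge0.
- exact: entireM.
move=> z; rewrite cmodM mulrDl expRD mulrACA.
exact: ler_pM (cmod_ge0 _) (cmod_ge0 _) (gf z) (gg z).
Qed.

Lemma inAp_mono (z : Cn R n) (alpha : mindex n) : inAp p (centered_monomial z alpha).
Proof.
apply: growth_inAp p0 _ _ _ _ _ _ (mono_growth p0 z alpha ltr01).
- by rewrite mul1r powR_ge0.
- by rewrite !mulr_ge0 ?exprn_ge0 ?powR_ge0 ?expR_ge0.
- exact: mono_entire.
Qed.

Lemma mono_word (z : Cn R n) (alpha : mindex n) : centered_monomial z alpha = fun w => \prod_(i <- word alpha) (w ord0 i - z ord0 i).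
Proof.
apply/funext => w; rewrite /centered_monomial /word big_flatten big_map big_enum /=.
by apply: eq_bigr => i _; rewrite big_nseq -Monoid.iteropE.
Qed.

End FunctionsInAp.

Section Symbol.
Variables (R : realType) (n : nat) (p : R).
Hypothesis p0 : 0 < p.
Local Notation C := R[i].
Local Notation Ap := (@Ap R n p).
Variable F : {linear Ap -> Ap}.
Hypothesis cF : continuous F.
Implicit Types (f g : Cn R n -> C).

(** [F] as an operator on plain functions, so that it can be applied without
    carrying proofs of membership in the space. *)
Definition ext_op g : Cn R n -> C :=
  if pselect (inAp p g) is left h then F (ApOf h) else fun=> 0.

Lemma ext_opE (f : Ap) : ext_op f = F f.
Proof.
rewrite /ext_op; case: pselect => [h|[]]; last exact: Ap_inAp.
by congr (Ap_val (F _)); apply: val_inj.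
Qed.

Lemma ext_op_lin (a : C) f g z : inAp p f -> inAp p g ->
  ext_op (fun w => a * f w + g w) z = a * ext_op f z + ext_op g z.
Proof.
move=> hf hg; have := ext_opE (a *: ApOf hf + ApOf hg); rewrite linearP.
have -> : ext_op (a *: ApOf hf + ApOf hg) = ext_op (fun w => a * f w + g w) by [].
move=> ->; have -> : ext_op f = F (ApOf hf) by rewrite -ext_opE.
by have -> : ext_op g = F (ApOf hg) by rewrite -ext_opE.
Qed.

Lemma ext_op_inAp g : inAp p (ext_op g).
Proof. by rewrite /ext_op; case: pselect => [h|_]; [exact: Ap_inAp|exact: inAp_cst]. Qed.

Lemma ext_op_growth tau : 0 <= tau -> exists A tau', [/\ 0 < A, 0 < tau' &
  forall g M, 0 <= M -> entire g -> growth p tau M g -> growth p tau' (A * M) (ext_op g)].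
Proof.
move=> t0; have t1 : 0 < tau * n%:R `^ p + 1.
  by apply: ltr_wpDl => //; rewrite mulr_ge0 ?powR_ge0.
have [A [tau' [A0 t'0 H]]] := continuous_step_bounded cF t1.
exists A, tau'; split=> // g M M0 eg gg.
have hg := growth_inAp p0 t0 M0 eg gg.
apply: (dominated_growth p0 (ltW t'0) (mulr_ge0 (ltW A0) M0)).
have -> : ext_op g = F (ApOf hg) by rewrite -ext_opE.
exact: (H (ApOf hg) M M0 (growth_dominated p0 t0 M0 gg)).
Qed.

Lemma ext_op_sum (I : Type) (s : seq I) (c : I -> C) (G : I -> Cn R n -> C) z :
  (forall x, inAp p (G x)) ->
  inAp p (fun w => \sum_(x <- s) c x * G x w) /\
  ext_op (fun w => \sum_(x <- s) c x * G x w) z = \sum_(x <- s) c x * ext_op (G x) z.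
Proof.
move=> hG; have F0 : ext_op (fun=> 0) z = 0.
  have := ext_op_lin (-1) z (inAp_cst n p0 0) (inAp_cst n p0 0).
  have -> : (fun w : Cn R n => -1 * (fun=> 0) w + (fun=> 0) w) = (fun=> 0) :> (Cn R n -> C).
    by apply/funext => w; rewrite mulr0 addr0.
  by rewrite mulN1r addNr.
elim: s => [|x s [IH1 IH2]].
  under eq_fun do rewrite big_nil.
  by rewrite big_nil; split; [exact: inAp_cst|exact: F0].
under eq_fun do rewrite big_cons.
split; first exact: (inAp_lin (c x) (hG x) IH1).
by rewrite big_cons (ext_op_lin (c x) z (hG x) IH1) IH2.
Qed.

(** Expanding the product turns the dependence on [z] into a polynomial one:
    [F (g (zeta_i - z_i)) = F (g zeta_i) - z_i F g], and the factors are removed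
    one by one. *)
Lemma ext_op_shifted_entire (s : seq 'I_n) g : inAp p g ->
  entire (fun z => ext_op (fun w => g w * \prod_(i <- s) (w ord0 i - z ord0 i)) z).
Proof.
elim: s g => [|i s IH] g hg.
  have -> : (fun z : Cn R n => ext_op (fun w => g w * \prod_(i <- [::]) (w ord0 i - z ord0 i)) z) = ext_op g.
    apply/funext => z; congr (ext_op _ z); apply/funext => w.
    by rewrite big_nil mulr1.
  exact: (inAp_entire_bd p0 (ext_op_inAp g)).1.
have hpr (z : Cn R n) : inAp p (fun w => \prod_(i <- s) (w ord0 i - z ord0 i)).
  elim: (s) => [|j l IHl]; first by under eq_fun do rewrite big_nil; exact: inAp_cst.
  by under eq_fun do rewrite big_cons; apply: inApM IHl => //; exact: inAp_coord.
pose gi (w : Cn R n) := g w * w ord0 i.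
have hgi : inAp p gi.
  apply: inApM => //; have := inAp_coord p0 i 0.
  by under eq_fun do rewrite subr0.
have -> : (fun z : Cn R n => ext_op (fun w => g w * \prod_(j <- i :: s) (w ord0 j - z ord0 j)) z) =
  (fun z : Cn R n => (-1 * z ord0 i) * ext_op (fun w => g w * \prod_(j <- s) (w ord0 j - z ord0 j)) z
            + ext_op (fun w => gi w * \prod_(j <- s) (w ord0 j - z ord0 j)) z).
  apply/funext => z; rewrite -ext_op_lin; [|exact: inApM|exact: inApM].
  by congr (ext_op _ z); apply/funext => w; rewrite big_cons /gi; ring.
apply: entireD; last exact: IH.
apply: entireM; last exact: IH.
by apply: entireM; [exact: entire_cst|exact: entire_coord].
Qed.

(** The coefficients are forced by the values on centred monomials: all terms but
    one of the operator vanish at the centre. *)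
Definition symbol (alpha : mindex n) (z : Cn R n) : C :=
  ext_op (centered_monomial z alpha) z * ((mfact alpha)%:R)^-1.

Lemma symbol_entire alpha : entire (symbol alpha).
Proof.
apply: entireM; last exact: entire_cst.
have := ext_op_shifted_entire (word alpha) (inAp_cst n p0 1).
congr entire; apply/funext => z; rewrite mono_word.
by congr (ext_op _ z); apply/funext => w; rewrite mul1r.
Qed.

Definition symbol_op : formal_op R n := FormalOp symbol_entire.

Lemma inv_mfact_le (alpha : mindex n) :
  ((mfact alpha)%:R : R)^-1 <= (2 ^+ n) ^+ mdeg alpha / (mdeg alpha)`!%:R.
Proof.
have f0 : 0 < (mdeg alpha)`!%:R :> R by rewrite ltr0n fact_gt0.
have m0 : 0 < (mfact alpha)%:R :> R by rewrite ltr0n mfact_gt0.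
rewrite ler_pdivlMr // mulrC ler_pdivrMr // -exprM -natrX -natrM ler_nat.
exact: fact_mdeg_le.
Qed.

(** The step is the one on which monomials of degree [k] are of size
    [(k!)^(1/p) q^k] with [q = eps / 2^n], the factor [2^n] making up for
    [alpha!] instead of [|alpha|!]. *)
Lemma symbol_inDp : inDp p symbol_op.
Proof.
move=> eps eps0; pose q : R := eps / 2 ^+ n.
have q0 : 0 < q by rewrite divr_gt0 // exprn_gt0.
have epsE : eps = q * 2 ^+ n by rewrite divfK // expf_neq0 // pnatr_eq0.
clearbody q.
have [s s0 sq] := ex_powR_eq p0 q0.
have t0 : 0 <= s * 2 `^ p by rewrite mulr_ge0 ?powR_ge0 // ltW.
have [A [tau' [A0 t'0 H]]] := ext_op_growth t0.
exists ((s * 2 `^ p + tau') * n%:R `^ p + 1), A; split=> //.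
  by apply: ltr_wpDl => //; rewrite mulr_ge0 ?powR_ge0 // addr_ge0 // ltW.
move=> z alpha; have gm := mono_growth p0 z alpha s0; rewrite sq in gm.
set k := mdeg alpha in gm *; pose x : R := k`!%:R.
have x0 : 0 < x by rewrite ltr0n fact_gt0.
rewrite -/x in gm *.
set e1 := expR (s * 2 `^ p * l1norm z `^ p) in gm.
have K0 : 0 <= x `^ p^-1 * q ^+ k * e1.
  by rewrite !mulr_ge0 ?powR_ge0 ?exprn_ge0 ?expR_ge0 // ltW.
have h := H _ _ K0 (mono_entire z alpha) gm z.
rewrite /= /symbol cmodM cmodV cmod_nat.
apply: le_trans (ler_pM (cmod_ge0 _) _ h (inv_mfact_le alpha)) _.
  by rewrite invr_ge0.
set e2 := expR (tau' * l1norm z `^ p).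
have -> : A * (x `^ p^-1 * q ^+ k * e1) * e2 * ((2 ^+ n) ^+ mdeg alpha / (mdeg alpha)`!%:R) =
   A * (eps ^+ k / x `^ (1 - p^-1)) * (e1 * e2).
  rewrite epsE -/k -/x exprMn; have := powR_conj p^-1 x0.
  have u0 : x `^ (1 - p^-1) != 0 by rewrite gt_eqF // powR_gt0.
  have v0 : x `^ p^-1 != 0 by rewrite gt_eqF // powR_gt0.
  move: (x `^ p^-1) (x `^ (1 - p^-1)) (q ^+ k) ((2 ^+ n) ^+ k) u0 v0 => v u a b u0 v0 <-.
  by field; rewrite u0 v0.
apply: ler_wpM2l.
  by rewrite mulr_ge0 ?(ltW A0) // divr_ge0 ?powR_ge0 // exprn_ge0 // ltW.
rewrite -expRD ler_expR -mulrDl [leRHS]mulrDl mul1r.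
apply: (@le_trans _ _ ((s * 2 `^ p + tau') * n%:R `^ p * enorm z `^ p)).
  rewrite -mulrA; apply: ler_wpM2l; first by rewrite addr_ge0 // ltW.
  exact: l1norm_powR_le.
by rewrite lerDl powR_ge0.
Qed.

(** At a fixed [z] the Taylor series of [f] at [z] converges to [f] in the norm
    of a larger step, where [F] is bounded. *)
Lemma symbol_represents (f : Ap) z : F f z = op_apply symbol_op f z.
Proof.
have hf := Ap_inAp f; have bf := inAp_entire_bd p0 hf.
have [tau [M [t0 M0 ef gf]]] := inAp_growth p0 hf.
suff lim : ccvg (fun N => \sum_(alpha <- cube n N) op_term symbol_op f z alpha) (F f z).
  exact: ccvg_unique lim (op_apply_ccvg p0 z symbol_inDp hf).
have mg := mpartial_growth p0 (ltW t0) M0 bf gf.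
set A0 := 2 * expR `|_| * expR _ in mg.
have A00 : 0 < A0 by rewrite !mulr_gt0 ?expR_gt0.
(* [A0^k] comes from the derivatives of [f], [2^(n k)] from the passage between
   [alpha!] and [k!]; the factor [q^k] of the monomials has to beat both. *)
pose q : R := 4^-1 / A0 / 2 ^+ n.
have q0 : 0 < q by rewrite !divr_gt0 ?invr_gt0 ?exprn_gt0.
have qE : 4^-1 = A0 * q * 2 ^+ n.
  rewrite -mulrA divfK ?expf_neq0 ?pnatr_eq0 // mulrCA mulfV ?mulr1 //.
  exact: lt0r_neq0.
clearbody q.
have [s s0 sq] := ex_powR_eq p0 q0.
pose t1 : R := s * 2 `^ p.
have t10 : 0 <= t1 by rewrite mulr_ge0 ?powR_ge0 // ltW.
pose K : R := M * expR (tau * 2 `^ p * l1norm z `^ p) * expR (t1 * l1norm z `^ p).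
have K0 : 0 <= K by rewrite !mulr_ge0 ?expR_ge0.
pose d (w : Cn R n) (alpha : mindex n) : C := mpartial alpha f z / (mfact alpha)%:R * centered_monomial z alpha w.
have dK w alpha : cmod (d w alpha) <= K * expR (t1 * l1norm w `^ p) * 4^-1 ^+ mdeg alpha.
  rewrite /d !cmodM cmodV cmod_nat; have := mono_growth p0 z alpha s0 w; rewrite sq => gm.
  have := ler_pM (cmod_ge0 _) _ (mg alpha z) (inv_mfact_le alpha).
  rewrite invr_ge0 ler0n => /(_ isT) h1.
  have h2 := ler_pM (mulr_ge0 (cmod_ge0 _) _) (cmod_ge0 _) h1 gm.
  apply: le_trans (h2 _) _; first by rewrite invr_ge0.
  set k := mdeg alpha; pose x : R := k`!%:R; rewrite -/x.
  have x0 : 0 < x by rewrite ltr0n fact_gt0.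
  apply: le_of_eq; rewrite /K -/t1.
  rewrite qE !exprMn; have := powR_conj p^-1 x0.
  move: (expR (tau * _ * _)) (expR (t1 * l1norm z `^ p)) (expR (t1 * l1norm w `^ p)) => e1 e2 e3.
  have u0 : x `^ (1 - p^-1) != 0 by rewrite gt_eqF // powR_gt0.
  have v0 : x `^ p^-1 != 0 by rewrite gt_eqF // powR_gt0.
  move: (x `^ p^-1) (x `^ (1 - p^-1)) (q ^+ k) ((2 ^+ n) ^+ k) (A0 ^+ k) u0 v0 => v u a b c u0 v0 <-.
  by field; rewrite u0 v0.
have [A [t2 [A_gt0 t20 H]]] := ext_op_growth t10.
pose S N (w : Cn R n) := \sum_(alpha <- cube n N) d w alpha.
have hS N : inAp p (S N) /\ ext_op (S N) z = \sum_(alpha <- cube n N) op_term symbol_op f z alpha.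
  have := ext_op_sum (cube n N) (fun alpha => mpartial alpha f z / (mfact alpha)%:R) z (inAp_mono p0 z).
  move=> [h1 h2]; split; first exact: h1.
  rewrite [LHS]h2; apply: eq_bigr => alpha _.
  by rewrite /op_term /= /symbol; ring.
have dS N w : cmod (-1 * S N w + f w) <= K * 2 ^+ n / 2 ^+ N * expR (t1 * l1norm w `^ p).
  have cv : ccvg (fun m => S (m + N)%N w - S N w) (f w - S N w).
    apply: ccvgB; last exact: ccvg_cst.
    have := taylor_ccvg z (w - z) bf; rewrite [z + _]addrC subrK => cv e /cv[m Hm].
    exists m => m' mm'; have := Hm (m' + N)%N (leq_trans mm' (leq_addr _ _)).
    rewrite /S; under eq_bigr => alpha _.
      rewrite (_ : mpartial alpha f z * _ = d w alpha); last first.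
        rewrite /d -mulrA; congr (_ * _); rewrite big_split /= prodfV mulrC /mfact natr_prod.
        by congr (_ * _); apply: eq_bigr => i _; rewrite !mxE.
      over.
    by [].
  rewrite mulN1r addrC; apply: ccvg_le cv _ => m.
  apply: le_trans (sum_diff_cube (dK w) (cube_uniq _ _) (cube_sub (leq_addl _ _))) _.
  by apply: le_of_eq; ring.
apply: (@ccvg_geometric _ _ _ (A * (K * 2 ^+ n) * expR (t2 * l1norm z `^ p))) => N.
rewrite -(hS N).2 -ext_opE.
have hN : inAp p (fun w => -1 * S N w + f w) by exact: inAp_lin _ (hS N).1 hf.
have KN0 : 0 <= K * 2 ^+ n / 2 ^+ N by rewrite divr_ge0 ?mulr_ge0 ?exprn_ge0.
have := H _ _ KN0 (inAp_entire_bd p0 hN).1 (dS N) z.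
rewrite (ext_op_lin (-1) z (hS N).1 hf) mulN1r addrC cmodC => h.
by apply: (le_trans h); apply: le_of_eq; ring.
Qed.

End Symbol.

(** * Recovering the coefficients *)

Section Uniqueness.
Variables (R : realType) (n : nat).
Local Notation C := R[i].
Implicit Types (f g : Cn R n -> C) (z w : Cn R n) (alpha beta gam : mindex n).

Lemma mono_entire_bd z alpha : entire_bd (centered_monomial z alpha).
Proof. exact: (inAp_entire_bd (@ltr01 R) (inAp_mono (@ltr01 R) z alpha)). Qed.

Lemma cdiff_shifted_pow (a t : C) m : cdiff (fun t => (a + t) ^+ m) t (m%:R * (a + t) ^+ m.-1).
Proof.
elim: m => [|m IH]; first by rewrite mul0r; under eq_fun do rewrite expr0; exact: cdiff_cst.
have H : cdiff (fun t => a + t) t 1.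
  have := cdiff_affine a 1 t; congr (cdiff _ t 1).
  by apply/funext => s; rewrite mulr1.
have := cdiffM H IH; rewrite (_ : 1 * _ + _ = m.+1%:R * (a + t) ^+ m.+1.-1); last first.
  case: m {IH} => [|m]; first by rewrite !mul0r mulr0 addr0 !mul1r.
  by rewrite -[m.+2%:R]natr1 /= exprS; move: (_ ^+ m) (m.+1%:R) => x y; ring.
by under [X in cdiff X _ _]eq_fun do rewrite -exprS.
Qed.

Definition mindex_update gam i (k : nat) : mindex n := [ffun j => if j == i then k else gam j].

Lemma partial_mono i z gam :
  partial i (centered_monomial z gam) = fun w => (gam i)%:R * centered_monomial z (mindex_update gam i (gam i).-1) w.
Proof.
apply/funext => w; pose rest : C := \prod_(j < n | j != i) (w ord0 j - z ord0 j) ^+ gam j.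
have monoE gam' t : (forall j, j != i -> gam' j = gam j) ->
    centered_monomial z gam' (w + t *: delta_mx ord0 i) = (w ord0 i - z ord0 i + t) ^+ gam' i * rest.
  move=> gg; rewrite /centered_monomial (bigD1 i) //= !mxE !eqxx mulr1 addrAC; congr (_ * _).
  apply: eq_bigr => j ji; rewrite gg // !mxE (negbTE ji) andbF mulr0 addr0 //.
have := entire_cdiff w (delta_mx ord0 i) (@mono_entire R n z gam) 0.
rewrite scale0r addr0; under [X in cdiff X _ _]eq_fun do rewrite monoE //.
have := cdiffM (cdiff_shifted_pow (w ord0 i - z ord0 i) 0 (gam i)) (cdiff_cst rest 0).
move=> H1 H2; rewrite [LHS](cdiff_unique H2 H1) mulr0 addr0.
have := monoE (mindex_update gam i (gam i).-1) 0; rewrite scale0r addr0 => -> => [|j ji].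
  by rewrite ffunE eqxx mulrA.
by rewrite ffunE (negbTE ji).
Qed.

Lemma partials_scale l (c : C) f : entire_bd f ->
  partials l (fun w => c * f w) = fun w => c * partials l f w.
Proof.
move=> bf; have := partials_lin l c bf (@entire_bd0 R n); rewrite partials0.
have -> : (fun z => c * f z + (fun=> 0) z) = (fun w => c * f w) by apply/funext => w; rewrite addr0.
by move=> ->; apply/funext => w; rewrite addr0.
Qed.

Lemma partials_nseq_mono i z gam k : partials (nseq k i) (centered_monomial z gam) =
  fun w => (gam i ^_ k)%:R * centered_monomial z (mindex_update gam i (gam i - k)%N) w.
Proof.
elim: k => [|k IH].
  rewrite /= ffactn0 subn0; apply/funext => w; rewrite mul1r; congr (centered_monomial z _ w).
  by apply/ffunP => j; rewrite ffunE; case: eqP => [->|].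
have -> : partials (nseq k.+1 i) (centered_monomial z gam) = partials [:: i] (partials (nseq k i) (centered_monomial z gam)) by [].
rewrite IH partials_scale; last exact: mono_entire_bd.
have -> : partials [:: i] (centered_monomial z (mindex_update gam i (gam i - k)%N)) = partial i (centered_monomial z (mindex_update gam i (gam i - k)%N)) by [].
rewrite partial_mono; apply/funext => w; rewrite mulrA -natrM ffunE eqxx -ffactnSr.
congr (_ * centered_monomial z _ w); apply/ffunP => j; rewrite !ffunE; case: eqP => // _.
by rewrite subnS.
Qed.

Lemma partials_word_on_mono s z alpha beta : uniq s -> partials (word_on s beta) (centered_monomial z alpha) =
  fun w => (\prod_(i <- s) (alpha i ^_ beta i))%N%:R *
    centered_monomial z [ffun j => if j \in s then (alpha j - beta j)%N else alpha j] w.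
Proof.
elim: s => [|i s IH] /=.
  move=> _; apply/funext => w; rewrite big_nil mul1r; congr (centered_monomial z _ w).
  by apply/ffunP => j; rewrite ffunE.
move=> /andP[iNs us]; rewrite /partials foldr_cat -/(partials _ _) -/(partials _ _) IH //.
rewrite partials_scale; last exact: mono_entire_bd.
rewrite partials_nseq_mono; apply/funext => w; rewrite big_cons mulrA -natrM ffunE (negbTE iNs) mulnC.
congr (_ * centered_monomial z _ w); apply/ffunP => j; rewrite !ffunE inE.
by case: eqP => [->|].
Qed.

Lemma mpartial_mono_diag z alpha beta : mpartial beta (centered_monomial z alpha) z =
  if beta == alpha then (mfact alpha)%:R else 0.
Proof.
rewrite mpartial_word [partials _ _](partials_word_on_mono z alpha beta (enum_uniq 'I_n)).
have -> : [ffun j => if j \in enum 'I_n then (alpha j - beta j)%N else alpha j] =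
    [ffun j => (alpha j - beta j)%N] :> mindex n.
  by apply/ffunP => j; rewrite !ffunE mem_enum.
rewrite big_enum /=; case: eqP => [->|/eqP ne].
  rewrite /centered_monomial [X in _ * X]big1 ?mulr1 => [|i _]; last by rewrite ffunE subnn expr0.
  by congr (_%:R); apply: eq_bigr => i _; rewrite ffactnn.
have [i ai] : exists i, beta i != alpha i.
  apply/existsP; apply: contraNT ne; rewrite negb_exists => /forallP H.
  by apply/eqP/ffunP => i; apply/eqP; have := H i; rewrite negbK.
have [lt|ge] := ltnP (alpha i) (beta i).
  by rewrite (bigD1 i) //= ffact_small // mul0n mul0r.
rewrite /centered_monomial [X in _ * X](bigD1 i) //= ffunE subrr expr0n.
by rewrite subn_eq0 leqNgt ltn_neqAle ai ge /= mul0r mulr0.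
Qed.

(** Only the term of index [alpha] survives at the centre of the monomial. *)
Lemma op_apply_mono (p : R) (P : formal_op R n) z alpha : 0 < p -> inDp p P ->
  op_apply P (centered_monomial z alpha) z = coef P alpha z * (mfact alpha)%:R.
Proof.
move=> p0 hP; have lim := op_apply_ccvg p0 z hP (inAp_mono p0 z alpha).
suff H : ccvg (fun N => \sum_(beta <- cube n N) op_term P (centered_monomial z alpha) z beta)
    (coef P alpha z * (mfact alpha)%:R) by exact: ccvg_unique lim H.
move=> e e0; exists (mdeg alpha) => N aN.
have aN' : alpha \in cube n N.
  by apply: mem_cube => i; rewrite (leq_trans _ aN) // /mdeg (bigD1 i) //= leq_addr.
rewrite (bigD1_seq alpha) ?cube_uniq //= big1 ?addr0 => [|beta ba].
  by rewrite /op_term mpartial_mono_diag eqxx subrr cmod0 ltW.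
by rewrite /op_term mpartial_mono_diag (negbTE ba) mulr0.
Qed.

Lemma formal_op_eq (P Q : formal_op R n) : coef P =2 coef Q -> P = Q.
Proof.
case: P Q => [a ea] [b eb] /= ab; have E : a = b by apply/funext => al; apply/funext => z.
by case: _ / E eb => eb; congr FormalOp; exact: Prop_irrelevance.
Qed.

Lemma op_unique (p : R) (P Q : formal_op R n) : 0 < p -> inDp p P -> inDp p Q ->
  (forall f : Ap n p, op_apply P f = op_apply Q f) -> P = Q.
Proof.
move=> p0 hP hQ PQ; apply: formal_op_eq => alpha z.
have := congr1 (@^~ z) (PQ (ApOf (inAp_mono p0 z alpha))).
rewrite /= !(@op_apply_mono p) // => /mulIf; apply.
by rewrite pnatr_eq0 -lt0n mfact_gt0.
Qed.

End Uniqueness.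

Theorem theorem3p2 (R : realType) (n : nat) (p : R)
    (n_ge1 : (1 <= n)%N) (p_gt0 : 0 < p) :
  (forall P : formal_op R n, inDp p P ->
     (forall f : Cn R n -> R[i], inAp p f ->
        op_converges P f /\ inAp p (op_apply P f)) /\
     (exists2 F : {linear Ap n p -> Ap n p}, continuous F &
        forall f : Ap n p, F f = op_apply P f :> (Cn R n -> R[i])))
  /\
  (forall F : {linear Ap n p -> Ap n p}, continuous F ->
     exists! P : formal_op R n, inDp p P /\
       forall f : Ap n p, F f = op_apply P f :> (Cn R n -> R[i])).
Proof.
split=> [P hP|F cF].
  split=> [f hf|]; first exact: op_inAp.
  exact: op_operator.
exists (symbol_op p_gt0 F); split.
  split=> [|f]; first exact: symbol_inDp.
  by apply/funext => z; exact: symbol_represents.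
move=> Q [hQ FQ]; apply: (op_unique p_gt0 (symbol_inDp p_gt0 cF) hQ) => f.
by rewrite -FQ; apply/funext => z; rewrite -symbol_represents.
Qed.
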